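(* Let $(N_n)_{n\in\mathbb N_0}$ be a Galton--Watson process with $N_0=1$ such that $N_1$ has mean $m>1$, strictly positive variance, finite $p_0$-th moment for some $p_0>2$, and $\mathbb P[N_1=0]=0$. Let $N_\infty=\lim_{n\to\infty}N_n/m^n$ (the limit exists a.s. and is strictly positive) and let $\sigma^2=\operatorname{Var}N_\infty$. Then for every sequence $(T_n)_{n\in\mathbb N}$ of $\mathbb N_0$-valued stopping times (with respect to $\mathcal F_k=\sigma(N_0,\dots,N_k)$) with $T_n\uparrow\infty$ a.s. as $n\to\infty$, $$\mathcal L\left(\sqrt{m^{T_n}}\left(N_\infty-\frac{N_{T_n}}{m^{T_n}}\right)\Bigg|\,\mathcal F_{T_n}\right)$$ converges, as $n\to\infty$, in the almost sure weak sense to the kernel $\omega\mapsto\mathcal N_{0,\sigma^2N_\infty(\omega)}$.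
   Context: $\mathcal L(X\mid\mathcal G)$ denotes a (regular) version of the conditional distribution of the real random variable $X$ given the $\sigma$-algebra $\mathcal G$, viewed as a random probability measure (kernel). A sequence of kernels $Q_n$ converges to a kernel $Q$ in the almost sure weak sense if for almost every $\omega$ the probability measures $Q_n(\omega)$ converge weakly to $Q(\omega)$. $\mathcal N_{0,s^2}$ is the normal distribution with mean $0$ and variance $s^2$. $\mathcal F_{T_n}$ is the usual stopped $\sigma$-algebra. *)

(* Defs.v *)
(* MathComp-Analysis: measure theory and probability over an abstract realType. *)
From HB Require Import structures.
From mathcomp Require Import all_boot all_order all_algebra.
From mathcomp Require Import all_classical all_reals all_analysis.

Set Implicit Arguments.
Unset Strict Implicit.
Unset Printing Implicit Defensive.

Import Order.TTheory GRing.Theory Num.Theory.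
Import numFieldNormedType.Exports.

Local Open Scope classical_set_scope.
Local Open Scope ring_scope.

Definition mutually_independent {d d'} {T : measurableType d}
    {T' : measurableType d'} {R : realType} (P : probability T R)
    {I : eqType} (X : I -> T -> T') : Prop :=
  forall (J : seq I) (A : I -> set T'), uniq J ->
    (forall i, measurable (A i)) ->
    P (\bigcap_(i in [set` J]) (X i @^-1` A i)) =
      (\prod_(i <- J) P (X i @^-1` A i))%E.

(* [xi n i] is the number of children of the i-th individual of generation [n]. *)
Definition galton_watson {d} {T : measurableType d} {R : realType}
    (P : probability T R) (z0 : nat) (N : nat -> T -> nat) : Prop :=
  exists xi : nat -> nat -> {RV P >-> nat},
    [/\ mutually_independent P (fun ni : nat * nat => xi ni.1 ni.2 : T -> nat),
        forall n i (B : set nat),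
          distribution P (xi n i) B = distribution P (xi 0%N 0%N) B,
        forall w, N 0%N w = z0 &
        forall n w, N n.+1 w = (\sum_(i < N n w) xi n i w)%N].

(* The limit of N_n / m^n; by convention [limn] returns an arbitrary value on
   the event where the sequence does not converge. *)
Definition gw_limit {T : Type} {R : realType} (m : R) (N : nat -> T -> nat)
    (w : T) : R := limn (fun n => (N n w)%:R / m ^+ n : R).

Definition natural_filtration {T : Type} (N : nat -> T -> nat) (k : nat) :
    set (set T) :=
  <<s \bigcup_(i in `I_k.+1) preimage_set_system setT (N i) measurable >>.

Definition stopping_time {T : Type} (F : nat -> set (set T))
    (tau : T -> nat) : Prop :=
  forall k, F k [set w | (tau w <= k)%N].

Definition stopped_sigma_algebra {d} {T : measurableType d}
    (F : nat -> set (set T)) (tau : T -> nat) : set (set T) :=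
  [set A | measurable A /\ forall k, F k (A `&` [set w | (tau w <= k)%N])].

(* [Q] is a regular version of the conditional law of [X] given the
   sigma-algebra [G]: measurability of [w |-> Q w B] with respect to [G] is part
   of the type of probability kernels with source [g_sigma_algebraType G]. *)
Definition regular_cond_law {d} {T : measurableType d} {R : realType}
    (P : probability T R) (G : set (set T)) (X : T -> R)
    (Q : R.-pker (g_sigma_algebraType G) ~> (measurableTypeR R)) : Prop :=
  forall (A : set T) (B : set (measurableTypeR R)), G A -> measurable B ->
    (\int[P]_(w in A) Q w B)%E = P (A `&` X @^-1` B).

Definition weakly_cvg {R : realType}
    (mu : nat -> {measure set (measurableTypeR R) -> \bar R})
    (nu : {measure set (measurableTypeR R) -> \bar R}) : Prop :=
  forall f : R -> R, continuous f -> (exists M : R, forall x, `|f x| <= M) ->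
    (\int[mu n]_x (f x)%:E)%E @[n --> \oo] --> (\int[nu]_x (f x)%:E)%E.

(* Main.v *)
Require Import Defs.
From HB Require Import structures.
From mathcomp Require Import all_boot all_order all_algebra.
From mathcomp Require Import all_classical all_reals all_analysis.
From mathcomp Require Import measurable_realfun.
From mathcomp Require Import ring lra.

(** Given the first k generations, each of the N_k individuals alive starts an
    independent copy of the whole process, so that
    sqrt(m^k) (N_oo - N_k / m^k) is m^(-k/2) times a sum of N_k independent
    copies of the centred variable N_oo - 1. As N_k / m^k tends to N_oo > 0, the
    number of summands times the variance of one rescaled summand tends to
    sigma^2 N_oo, and the central limit theorem gives the normal law. The
    conditional law at time k is thus a deterministic function of the pair
    (k, N_k); an event of the stopped sigma-algebra on which tau = k belongs to
    F_k, so the same function evaluated at (tau, N_tau) gives the conditional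
    law at a stopping time, and only the convergence of this deterministic
    function along (tau_n, N_(tau_n)) remains to be proved.

    Independent copies are never constructed. For a random variable Y, let
    [avg P Y] map a function f to x |-> E f(x + Y). Its z-th iterate at 0 is the
    expectation of f at a sum of z independent copies of Y, and the law of the
    process is described by such iterates: [branching_property] computes the
    integral of g(N_(k+j)) over an event of F_k on which N_k = z as the
    probability of the event times the z-th iterate of the averaging operator of
    N_j. It follows from the independence of the offspring variables of
    generation k from F_k ([natural_filtration_future]) by induction on j.
    Letting j tend to infinity gives [branching_limit], the same formula for the
    limit N_oo.

    Moments are read off from [branching_property] applied to squares:
    the increments of N_n / m^n have geometrically decreasing second moments,
    whence almost sure and L^2 convergence, E N_oo = 1 and
    0 < Var N_oo < +oo. Positivity of the limit comes from the fixed-point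
    equation q = E q^(N_1) satisfied by q = P(N_oo <= 0), obtained from the
    Laplace transform of N_oo.

    The central limit theorem [clt_smooth] is proved by Trotter's form of
    Lindeberg's method: the averaging operators of the summands are replaced one
    by one by Gaussian averaging operators, which form a semigroup
    ([gavg_semigroup]); averaging is a contraction for the supremum norm, and one
    replacement costs little on functions with a second-order Taylor expansion.
    It is applied to smooth approximations [ramp] of indicators of half-lines.
    They sandwich the tails of the kernels ([kernel_tail_sandwich]), which is
    enough for weak convergence to a law without atoms
    ([weakly_cvg_sandwich]); countably many ramps suffice, so that the exceptional
    null sets can be united. *)

Set Implicit Arguments.
Unset Strict Implicit.
Unset Printing Implicit Defensive.

Import Order.TTheory GRing.Theory Num.Theory.
Import numFieldNormedType.Exports.

Local Open Scope classical_set_scope.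
Local Open Scope ring_scope.

(** * Averaging over a random shift *)

Definition bounded_cts {R : realType} (f : R -> R) :=
  continuous f /\ exists M, forall x, `|f x| <= M.

(** Convolution with the law of -Y: [iter z (avg P Y) f 0] is the expectation of
    f at a sum of z independent copies of Y. *)
Definition avg {d} {T : measurableType d} {R : realType} (P : probability T R)
  (Y : T -> R) (f : R -> R) (x : R) : R := \int[P]_w f (x + Y w).

Section real_integrable.
Context d (T : measurableType d) (R : realType) (mu : {measure set T -> \bar R}).
Implicit Types f g : T -> R.

Lemma integrableRD f g : mu.-integrable setT (EFin \o f) ->
  mu.-integrable setT (EFin \o g) ->
  mu.-integrable setT (EFin \o (fun x => f x + g x)).
Proof. by move=> jf jg; exact: (integrableD measurableT jf jg). Qed.

Lemma integrableRB f g : mu.-integrable setT (EFin \o f) ->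
  mu.-integrable setT (EFin \o g) ->
  mu.-integrable setT (EFin \o (fun x => f x - g x)).
Proof. by move=> jf jg; exact: (integrableB measurableT jf jg). Qed.

Lemma integrableRZ c f : mu.-integrable setT (EFin \o f) ->
  mu.-integrable setT (EFin \o (fun x => c * f x)).
Proof. by move=> jf; exact: (integrableZl measurableT c jf). Qed.

End real_integrable.

Section average.
Context d (T : measurableType d) (R : realType) (P : probability T R).
Implicit Types (Y : T -> R) (f g : R -> R).

Lemma integrable_bounded (h : T -> R) (M : R) :
  measurable_fun setT h -> (forall w, `|h w| <= M) ->
  P.-integrable setT (EFin \o h).
Proof.
move=> mh hM; apply: measurable_bounded_integrable => //.
  by rewrite [X in (X < _)%E]probability_setT ltry.
exists M; split; first exact: num_real.
by move=> y My w _; exact: le_trans (hM w) (ltW My).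
Qed.

Lemma measurable_shift Y f x : measurable_fun setT Y -> continuous f ->
  measurable_fun setT (fun w => f (x + Y w)).
Proof.
move=> mY cf.
have mf := continuous_measurable_fun cf.
apply: (@measurableT_comp _ _ _ _ _ _ f) => //.
exact: measurable_funD.
Qed.

Lemma integrable_shift Y f x : measurable_fun setT Y -> bounded_cts f ->
  P.-integrable setT (EFin \o (fun w => f (x + Y w))).
Proof.
move=> mY [cf [M fM]]; apply: (@integrable_bounded _ M) => //.
exact: measurable_shift.
Qed.

Lemma Rintegral_prob_cst (r : R) : \int[P]_w r = r.
Proof. by rewrite Rintegral_cst// [X in fine X]probability_setT mulr1. Qed.

Lemma normr_avg_le Y f M x : measurable_fun setT Y -> continuous f ->
  (forall y, `|f y| <= M) -> `|avg P Y f x| <= M.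
Proof.
move=> mY cf fM.
have bf : bounded_cts f by split=> //; exists M.
have intf := integrable_shift x mY bf.
rewrite /avg (le_trans (le_normr_Rintegral _ _))//.
rewrite -[leRHS]Rintegral_prob_cst; apply: le_Rintegral => //.
- apply: (@integrable_bounded _ M); last by move=> w; rewrite normr_id.
  apply: measurableT_comp => //; exact: measurable_shift.
- by apply: (@integrable_bounded _ `|M|).
Qed.

(** The points x_n + Y_n at which f_n is evaluated move with n, so pointwise
    convergence of f_n is not enough; the last hypothesis, continuous
    convergence, is, and it is inherited by the averages, which makes the
    statement iterable. *)
Lemma cvg_avg (Y_ : nat -> T -> R) Y (f_ : nat -> R -> R) f (M : R) (x_ : nat -> R) (x : R) :
  (forall n, measurable_fun setT (Y_ n)) -> measurable_fun setT Y ->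
  (forall n, continuous (f_ n)) -> continuous f ->
  (forall n y, `|f_ n y| <= M) ->
  {ae P, forall w, Y_ n w @[n --> \oo] --> Y w} ->
  x_ n @[n --> \oo] --> x ->
  (forall (y_ : nat -> R) (y : R), y_ n @[n --> \oo] --> y ->
     f_ n (y_ n) @[n --> \oo] --> f y) ->
  avg P (Y_ n) (f_ n) (x_ n) @[n --> \oo] --> avg P Y f x.
Proof.
move=> mY_ mY cf_ cf fM YY xx ff.
rewrite /avg /Rintegral; apply: fine_cvg.
have fM0 y : `|f y| <= M.
  have h : f_ n y @[n --> \oo] --> f y by apply: (ff (cst y)); exact: cvg_cst.
  have {}h : `|f_ n y| @[n --> \oo] --> `|f y| by exact: cvg_norm h.
  rewrite -(cvg_lim _ h)//; apply: limr_le; first by apply/cvg_ex; exists `|f y|.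
  by apply: nearW => n; exact: fM.
rewrite fineK; last first.
  apply: integrable_fin_num => //; apply: (integrable_shift x mY).
  by split=> //; exists M.
have [|||||_ _] // := @dominated_convergence _ T R P setT measurableT
  (fun n w => (f_ n (x_ n + Y_ n w))%:E) (fun w => (f (x + Y w))%:E) (cst M%:E).
- by move=> n; apply/measurable_EFinP; exact: measurable_shift.
- by apply/measurable_EFinP; exact: measurable_shift.
- apply: filterS YY => w Yw _; apply: cvg_EFin; first exact: nearW.
  by apply: ff; exact: cvgD.
- by apply: (@integrable_bounded (cst M) `|M|).
- by apply: aeW => w n _ /=; rewrite lee_fin.
Qed.

Lemma continuous_avg Y f : measurable_fun setT Y -> bounded_cts f ->
  continuous (avg P Y f).
Proof.
move=> mY [cf [M fM]] x; apply/(@cvg_nbhsP _ R^o) => u ux.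
apply: (@cvg_avg (fun=> Y) Y (fun=> f) f M) => //.
  by apply: aeW => w; exact: cvg_cst.
move=> y_ y yy; apply: continuous_cvg => //; exact: cf.
Qed.

Lemma bounded_cts_avg Y f : measurable_fun setT Y -> bounded_cts f ->
  bounded_cts (avg P Y f).
Proof.
move=> mY bf; split; first exact: continuous_avg.
by have [cf [M fM]] := bf; exists M => x; exact: normr_avg_le.
Qed.

Lemma bounded_cts_iter_avg Y f z : measurable_fun setT Y -> bounded_cts f ->
  bounded_cts (iter z (avg P Y) f).
Proof. by move=> mY bf; elim: z => //= z IH; exact: bounded_cts_avg. Qed.

(** Averaging commutes with translations, so centring the variable only moves
    the point of evaluation. *)
Lemma iter_avg_sub Y a f z x :
  iter z (avg P (fun w => Y w - a)) f x = iter z (avg P Y) f (x - a *+ z).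
Proof.
elim: z x => [|z IH] x /=; first by rewrite mulr0n subr0.
rewrite /avg; apply: eq_Rintegral => w _; rewrite IH; congr (iter z _ f _).
by rewrite mulrS; ring.
Qed.

Lemma cvg_iter_avg (Y_ : nat -> T -> R) Y f z (x_ : nat -> R) (x : R) :
  (forall n, measurable_fun setT (Y_ n)) -> measurable_fun setT Y ->
  bounded_cts f ->
  {ae P, forall w, Y_ n w @[n --> \oo] --> Y w} ->
  x_ n @[n --> \oo] --> x ->
  iter z (avg P (Y_ n)) f (x_ n) @[n --> \oo] --> iter z (avg P Y) f x.
Proof.
move=> mY_ mY bf YY; have [cf [M fM]] := bf.
elim: z x_ x => [|z IH] x_ x xx /=.
  by apply: continuous_cvg => //; exact: cf.
apply: (@cvg_avg _ _ (fun n => iter z (avg P (Y_ n)) f) _ M) => //.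
- by move=> n; have [] := bounded_cts_iter_avg z (mY_ n) bf.
- by have [] := bounded_cts_iter_avg z mY bf.
- move=> n; elim: {IH} z => //= z IH y.
  by apply: normr_avg_le => //; have [] := bounded_cts_iter_avg z (mY_ n) bf.
Qed.

End average.

(** * Normal densities and their moments *)

Section gaussian_density.
Context {R : realType}.
Local Notation mu := (@lebesgue_measure R).
Implicit Types s r a b x v : R.

Lemma normal_pdf_expE s x v : 0 < s ->
  normal_pdf x s v = normal_peak s * expR (- (v - x) ^+ 2 / (s ^+ 2 *+ 2)).
Proof. by move=> s0; rewrite normal_pdfE ?gt_eqF. Qed.

Lemma normal_peak_scale s r : 0 < s -> 0 < r ->
  normal_peak r = normal_peak s * (s / r).
Proof.
move=> s0 r0; rewrite /normal_peak.
have E (t : R) : 0 < t -> Num.sqrt (t ^+ 2 * pi *+ 2) = t * Num.sqrt (pi *+ 2).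
  by move=> t0; rewrite -mulrnAr sqrtrM ?sqr_ge0// sqrtr_sqr gtr0_norm.
rewrite !E// !invfM mulrACA mulVf ?gt_eqF// mul1r mulrC.
done.
Qed.

(** Likelihood ratio of two normal densities with different means. Together with
    [normal_pdf_scale], it yields the first two moments by comparing total masses
    through 1 + t <= exp t. *)
Lemma normal_pdf_shift s x a v : 0 < s ->
  normal_pdf (x + a) s v =
  normal_pdf x s v * expR ((v - x) * (a / s ^+ 2) - a ^+ 2 / (s ^+ 2 *+ 2)).
Proof.
move=> s0; rewrite !normal_pdf_expE// -mulrA -expRD; congr (_ * expR _).
by field; rewrite gt_eqF.
Qed.

Lemma normal_pdf_scale s r x v : 0 < s -> 0 < r ->
  normal_pdf x r v = normal_pdf x s v * (s / r) *
     expR ((v - x) ^+ 2 * (1 / s ^+ 2 - 1 / r ^+ 2) / 2).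
Proof.
move=> s0 r0; rewrite !normal_pdf_expE// (normal_peak_scale s0 r0).
rewrite [_ * expR _ * (s / r)]mulrAC -[RHS]mulrA -expRD.
congr (_ * expR _).
by field; rewrite !gt_eqF.
Qed.

Lemma integrable_normal_pdfR s x :
  mu.-integrable setT (EFin \o normal_pdf x s).
Proof. exact: integrable_normal_pdf. Qed.

Lemma Rintegral_normal_pdf s x : \int[mu]_v normal_pdf x s v = 1.
Proof. by rewrite /Rintegral integral_normal_pdf. Qed.

(** A weight exp((v - x)^2 / (4 s^2)) turns the density of deviation s into
    sqrt 2 times the density of deviation sqrt 2 * s, whose mass is finite. *)
Lemma integrable_pdf_dominated s x (h : R -> R) (C : R) : 0 < s ->
  measurable_fun setT h ->
  (forall v, `|h v| <= C * expR ((v - x) ^+ 2 / (s ^+ 2 *+ 4))) ->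
  mu.-integrable setT (EFin \o (fun v => h v * normal_pdf x s v)) /\
  `|\int[mu]_v (h v * normal_pdf x s v)| <= C * 2.
Proof.
move=> s0 mh hC.
have r0 : 0 < s * Num.sqrt 2 by rewrite mulr_gt0// sqrtr_gt0.
have q0 : Num.sqrt 2 != 0 :> R by rewrite gt_eqF// sqrtr_gt0.
have C0 : 0 <= C.
  have := le_trans (normr_ge0 _) (hC x).
  by rewrite pmulr_lge0// expR_gt0.
have pE v : expR ((v - x) ^+ 2 / (s ^+ 2 *+ 4)) * normal_pdf x s v
    = Num.sqrt 2 * normal_pdf x (s * Num.sqrt 2) v.
  rewrite (normal_pdf_scale x v s0 r0) exprMn sqr_sqrtr//.
  rewrite -[LHS]mulrC !mulrA.
  have -> : Num.sqrt 2 * normal_pdf x s v * s / (s * Num.sqrt 2) =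
    normal_pdf x s v by field; rewrite q0 gt_eqF.
  by congr (_ * expR _); field; rewrite gt_eqF.
have hle v : `|h v * normal_pdf x s v| <=
    (C * Num.sqrt 2) * normal_pdf x (s * Num.sqrt 2) v.
  rewrite normrM (ger0_norm (normal_pdf_ge0 _ _ _)) -mulrA -pE mulrA.
  by rewrite ler_wpM2r ?normal_pdf_ge0.
have ig : mu.-integrable setT
    (EFin \o (fun v => (C * Num.sqrt 2) * normal_pdf x (s * Num.sqrt 2) v)).
  rewrite (_ : _ \o _ = (fun v => (C * Num.sqrt 2)%:E *
    (EFin \o normal_pdf x (s * Num.sqrt 2)) v)%E)//.
  exact/integrableZl/integrable_normal_pdfR.
have mhp : measurable_fun setT (fun v => h v * normal_pdf x s v).
  by apply: measurable_funM => //; exact: measurable_normal_pdf.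
have ih : mu.-integrable setT (EFin \o (fun v => h v * normal_pdf x s v)).
  apply: (le_integrable _ _ _ ig) => //; first exact/measurable_EFinP.
  by move=> v _ /=; rewrite lee_fin (le_trans (hle v))// ler_norm.
split=> //; rewrite (le_trans (le_normr_Rintegral _ _))//.
apply: (@le_trans _ _ (\int[mu]_v
   ((C * Num.sqrt 2) * normal_pdf x (s * Num.sqrt 2) v))).
  by apply: le_Rintegral => //; exact: integrable_norm.
rewrite RintegralZl//; last exact: integrable_normal_pdfR.
rewrite Rintegral_normal_pdf mulr1 ler_wpM2l//.
rewrite -[leRHS]ger0_norm// -[leRHS]sqrtr_sqr ler_sqrt//.
by rewrite expr2; lra.
Qed.

Lemma expR_quarter_bounds s u : 0 < s ->
  [/\ `|u| <= 2 * s * expR (u ^+ 2 / (s ^+ 2 *+ 4)),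
      u ^+ 2 <= 4 * s ^+ 2 * expR (u ^+ 2 / (s ^+ 2 *+ 4)) &
      `|u| ^+ 3 <= 32 * s ^+ 3 * expR (u ^+ 2 / (s ^+ 2 *+ 4))].
Proof.
move=> s0; set q := `|u| / s.
have uq : `|u| = s * q by rewrite /q mulrC divfK// gt_eqF.
have q0 : 0 <= q by rewrite divr_ge0// ltW.
have -> : u ^+ 2 / (s ^+ 2 *+ 4) = q ^+ 2 / 8 + q ^+ 2 / 8.
  by rewrite -real_normK ?num_real// uq; field; rewrite gt_eqF.
rewrite -(real_normK (num_real u)) uq.
(* Both factors of exp(q^2/8) exp(q^2/8) are at least 1 + q^2/8, which gives a
   fourth power of q, enough to dominate the cube. *)
have e0 := expR_ge1Dx (q ^+ 2 / 8).
have e1 : 1 + q ^+ 2 / 4 + q ^+ 4 / 64 <= expR (q ^+ 2 / 8 + q ^+ 2 / 8).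
  rewrite expRD; have -> : 1 + q ^+ 2 / 4 + q ^+ 4 / 64 =
    (1 + q ^+ 2 / 8) * (1 + q ^+ 2 / 8) by field.
  by apply: ler_pM => //; rewrite addr_ge0// divr_ge0// sqr_ge0.
set E := expR _ in e1 *.
have q2 : 0 <= q ^+ 2 by exact: sqr_ge0.
have q4 : 0 <= q ^+ 4 by rewrite exprn_ge0.
split.
- rewrite [2 * s]mulrC -mulrA ler_pM2l//; have := sqr_ge0 (q - 1); nra.
- rewrite exprMn (_ : 4 * _ * E = s ^+ 2 * (4 * E)); last by ring.
  rewrite ler_pM2l ?exprn_gt0//; nra.
- rewrite exprMn (_ : 32 * _ * E = s ^+ 3 * (32 * E)); last by ring.
  rewrite ler_pM2l ?exprn_gt0//.
  have : q ^+ 3 <= (q ^+ 2 + q ^+ 4) / 2.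
    have := mulr_ge0 q2 (sqr_ge0 (q - 1)).
    rewrite (_ : q ^+ 2 * _ = q ^+ 4 - 2 * q ^+ 3 + q ^+ 2); last by ring.
    lra.
  lra.
Qed.

(** Moving the mean by M, the first moment itself, multiplies the density by at
    least 1 + (M/s^2)(v - x) - M^2/(2s^2). Both densities have mass 1, so
    M^2/s^2 <= M^2/(2s^2) and M = 0. *)
Lemma normal_pdf_mean0 s x : 0 < s ->
  mu.-integrable setT (EFin \o (fun v => (v - x) * normal_pdf x s v)) /\
  \int[mu]_v ((v - x) * normal_pdf x s v) = 0.
Proof.
move=> s0.
have [||i1 _] := @integrable_pdf_dominated s x (fun v => v - x) (2 * s) s0.
- exact: measurable_funB.
- by move=> v; have [] := expR_quarter_bounds (v - x) s0.
split=> //; set M := \int[mu]_v _.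
have key : 1 + M * (M / s ^+ 2) - M ^+ 2 / (s ^+ 2 *+ 2) <= 1.
  rewrite -[leRHS](Rintegral_normal_pdf s (x + M)).
  have -> : 1 + M * (M / s ^+ 2) - M ^+ 2 / (s ^+ 2 *+ 2) =
     \int[mu]_v ((1 - M ^+ 2 / (s ^+ 2 *+ 2)) * normal_pdf x s v +
        (M / s ^+ 2) * ((v - x) * normal_pdf x s v)).
    rewrite RintegralD//; last 2 first.
    - by apply: integrableRZ; exact: integrable_normal_pdfR.
    - exact: integrableRZ.
    rewrite !RintegralZl//; last exact: integrable_normal_pdfR.
    rewrite Rintegral_normal_pdf -/M; ring.
  apply: le_Rintegral => //.
  - apply: integrableRD; apply: integrableRZ => //.
    exact: integrable_normal_pdfR.
  - exact: integrable_normal_pdfR.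
  - move=> v _; rewrite normal_pdf_shift//.
    set p := normal_pdf x s v; set q := M ^+ 2 / _; set r := M / _.
    have -> : (1 - q) * p + r * ((v - x) * p) = p * (1 + ((v - x) * r - q)).
      by ring.
    by rewrite ler_wpM2l ?normal_pdf_ge0// expR_ge1Dx.
apply/eqP; rewrite -sqrf_eq0; apply/eqP/le_anti; rewrite sqr_ge0 andbT.
have s2 : 0 < (s ^+ 2)^-1 by rewrite invr_gt0 exprn_gt0.
have : M ^+ 2 * ((s ^+ 2)^-1 / 2) <= 0.
  have E : 1 + M * (M / s ^+ 2) - M ^+ 2 / (s ^+ 2 *+ 2) =
    1 + M ^+ 2 * ((s ^+ 2)^-1 / 2) by field; rewrite gt_eqF.
  by move: key; rewrite E; lra.
by rewrite pmulr_lle0// divr_gt0.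
Qed.

(** Multiplying the deviation by t and comparing masses gives
    (q/2)(1 - t^-2) <= t - 1 for every t > 0, where q = V/s^2 and V is the second
    moment. Equality at t = 1 forces q = 1. *)
Lemma normal_pdf_variance s x : 0 < s ->
  mu.-integrable setT (EFin \o (fun v => (v - x) ^+ 2 * normal_pdf x s v)) /\
  \int[mu]_v ((v - x) ^+ 2 * normal_pdf x s v) = s ^+ 2.
Proof.
move=> s0.
have [||i2 _] := @integrable_pdf_dominated s x (fun v => (v - x) ^+ 2)
  (4 * s ^+ 2) s0.
- by apply: measurable_funX; exact: measurable_funB.
- move=> v; rewrite ger0_norm ?sqr_ge0//.
  by have [] := expR_quarter_bounds (v - x) s0.
split=> //; set V := \int[mu]_v _.
have V0 : 0 <= V.
  by apply: Rintegral_ge0 => v _; rewrite mulr_ge0 ?sqr_ge0// normal_pdf_ge0.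
have key t : 0 < t -> 1 + V * ((1 / s ^+ 2 - 1 / (s * t) ^+ 2) / 2) <= t.
  move=> t0; have st0 : 0 < s * t by exact: mulr_gt0.
  rewrite -[leRHS]mulr1 -[X in _ <= _ * X](Rintegral_normal_pdf (s * t) x).
  rewrite -RintegralZl//; last exact: integrable_normal_pdfR.
  set c := (1 / s ^+ 2 - 1 / (s * t) ^+ 2) / 2.
  have -> : 1 + V * c = \int[mu]_v (normal_pdf x s v +
        c * ((v - x) ^+ 2 * normal_pdf x s v)).
    rewrite RintegralD//; last 2 first.
    - exact: integrable_normal_pdfR.
    - exact: integrableRZ.
    by rewrite RintegralZl// Rintegral_normal_pdf -/V; ring.
  apply: le_Rintegral => //.
  - apply: integrableRD => //=.
    + exact: integrable_normal_pdfR.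
    + exact: integrableRZ.
  - by apply: integrableRZ; exact: integrable_normal_pdfR.
  - move=> v _; rewrite (normal_pdf_scale x v s0 st0).
    have -> : (v - x) ^+ 2 * (1 / s ^+ 2 - 1 / (s * t) ^+ 2) / 2 =
      (v - x) ^+ 2 * c by rewrite /c mulrA.
    set p := normal_pdf x s v; set e := expR _.
    have -> : t * (p * (s / (s * t)) * e) = p * e.
      by field; rewrite !gt_eqF.
    have -> : p + c * ((v - x) ^+ 2 * p) = p * (1 + (v - x) ^+ 2 * c) by ring.
    by rewrite ler_wpM2l ?normal_pdf_ge0// expR_ge1Dx.
have s2 : 0 < s ^+ 2 by rewrite exprn_gt0.
pose q := V / s ^+ 2; have Vq : V = q * s ^+ 2 by rewrite /q divfK// gt_eqF.
have q0 : 0 <= q by rewrite divr_ge0// ltW.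
(* With t = (1 + q)/2 the inequality becomes (t - 1)^2 <= 0. *)
have t0 : 0 < (1 + q) / 2 by rewrite divr_gt0// ltr_pwDl.
have := key _ t0; set t := (1 + q) / 2 in t0 *.
have tq : q = 2 * t - 1 by rewrite /t; field.
have -> : V * ((1 / s ^+ 2 - 1 / (s * t) ^+ 2) / 2) =
   (q / 2 * (t ^+ 2 - 1)) / t ^+ 2.
  by rewrite Vq; field; rewrite !gt_eqF.
rewrite -lerBrDl ler_pdivrMr ?exprn_gt0//= => h.
have : (t - 1) ^+ 2 <= 0.
  move: h; rewrite tq.
  have -> : (2 * t - 1) / 2 * (t ^+ 2 - 1) =
    (t - 1) * t ^+ 2 + (t - 1) ^+ 2 / 2 by field.
  lra.
rewrite le_eqVlt ltNge sqr_ge0 orbF sqrf_eq0 subr_eq0 => /eqP t1.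
by rewrite Vq tq t1; ring.
Qed.

Lemma normal_pdf_third_moment s x : 0 < s ->
  mu.-integrable setT (EFin \o (fun v => `|v - x| ^+ 3 * normal_pdf x s v)) /\
  \int[mu]_v (`|v - x| ^+ 3 * normal_pdf x s v) <= 64 * s ^+ 3.
Proof.
move=> s0.
have [||i3 h3] := @integrable_pdf_dominated s x (fun v => `|v - x| ^+ 3)
  (32 * s ^+ 3) s0.
- by apply: measurable_funX; apply: measurableT_comp => //; exact: measurable_funB.
- move=> v; rewrite ger0_norm ?exprn_ge0//.
  by have [] := expR_quarter_bounds (v - x) s0.
split=> //; apply: le_trans (ler_norm _) _; apply: (le_trans h3); lra.
Qed.

(** Completing the square in y: two successive Gaussian steps through y have the
    density of the combined step times a normal density in y, that of the
    midpoint given the two ends. *)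
Lemma normal_pdf_convolution a b x y v : 0 < a -> 0 < b ->
  normal_pdf x a y * normal_pdf y b v =
  normal_pdf x (Num.sqrt (a ^+ 2 + b ^+ 2)) v *
  normal_pdf ((b ^+ 2 * x + a ^+ 2 * v) / (a ^+ 2 + b ^+ 2))
    (a * b / Num.sqrt (a ^+ 2 + b ^+ 2)) y.
Proof.
move=> a0 b0.
have c20 : 0 < a ^+ 2 + b ^+ 2 by rewrite addr_gt0// exprn_gt0.
have c0 : 0 < Num.sqrt (a ^+ 2 + b ^+ 2) by rewrite sqrtr_gt0.
set c := Num.sqrt _ in c0 *; have cE : c ^+ 2 = a ^+ 2 + b ^+ 2.
  by rewrite /c sqr_sqrtr// ltW.
have e0 : 0 < a * b / c by rewrite divr_gt0// mulr_gt0.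
rewrite !normal_pdf_expE//.
rewrite mulrACA [RHS]mulrACA -!expRD; congr (_ * expR _).
  rewrite (normal_peak_scale a0 c0) (normal_peak_scale b0 e0).
  by field; rewrite !gt_eqF.
rewrite expr_div_n cE exprMn.
by field; rewrite !gt_eqF.
Qed.

End gaussian_density.

(** * Gaussian averaging *)

Definition unit_fun {R : realType} (f : R -> R) :=
  measurable_fun setT f /\ forall x, 0 <= f x <= 1.

(** The point x enters as the mean of the density, which makes [normal_pdf] the
    transition kernel of a semigroup. *)
Definition gavg {R : realType} (s : R) (f : R -> R) (x : R) : R :=
  \int[@lebesgue_measure R]_v (f v * normal_pdf x s v).

Section gaussian_average.
Context {R : realType}.
Local Notation mu := (@lebesgue_measure R).
Implicit Types (s a b x v : R) (f g : R -> R).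

Lemma integrable_bounded_pdf f (M : R) s x : measurable_fun setT f ->
  (forall v, `|f v| <= M) ->
  mu.-integrable setT (EFin \o (fun v => f v * normal_pdf x s v)).
Proof.
move=> mf fM.
apply: (le_integrable _ _ _ (integrableRZ M (integrable_normal_pdfR s x))) => //.
  apply/measurable_EFinP/measurable_funM => //; exact: measurable_normal_pdf.
move=> v _ /=; rewrite lee_fin !normrM ler_wpM2r//.
by rewrite (le_trans (fM v))// ler_norm.
Qed.

Lemma normr_gavg_le f M s x : measurable_fun setT f ->
  (forall v, `|f v| <= M) -> `|gavg s f x| <= M.
Proof.
move=> mf fM; have intf := integrable_bounded_pdf s x mf fM.
rewrite (le_trans (le_normr_Rintegral _ intf))//.
rewrite -[leRHS]mulr1 -[X in _ <= _ * X](Rintegral_normal_pdf s x).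
rewrite -RintegralZl//; last exact: integrable_normal_pdfR.
apply: le_Rintegral => //.
- exact: integrable_norm.
- by apply: integrableRZ; exact: integrable_normal_pdfR.
- move=> v _; rewrite normrM (ger0_norm (normal_pdf_ge0 _ _ _)).
  by rewrite ler_wpM2r ?normal_pdf_ge0.
Qed.

Lemma unit_fun_norm f : unit_fun f -> forall x, `|f x| <= 1.
Proof. by move=> [_ f01] x; have /andP[f0 f1] := f01 x; rewrite ger0_norm. Qed.

Lemma gavg_EFin s f x : unit_fun f ->
  (gavg s f x)%:E = (\int[mu]_v (f v * normal_pdf x s v)%:E)%E.
Proof.
move=> uf; rewrite /gavg /Rintegral fineK//; apply: integrable_fin_num => //.
exact: (integrable_bounded_pdf s x uf.1 (unit_fun_norm uf)).
Qed.

Lemma gavg_sub_le s f g (e : R) x : unit_fun f -> unit_fun g ->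
  (forall y, `|f y - g y| <= e) -> `|gavg s f x - gavg s g x| <= e.
Proof.
move=> uf ug fge.
rewrite /gavg -RintegralB//; last 2 first.
- exact: (integrable_bounded_pdf s x uf.1 (unit_fun_norm uf)).
- exact: (integrable_bounded_pdf s x ug.1 (unit_fun_norm ug)).
under eq_Rintegral do rewrite -mulrBl.
apply: (@normr_gavg_le (fun v => f v - g v)) => //.
by apply: measurable_funB; [exact: uf.1|exact: ug.1].
Qed.

Lemma measurable_pdf_kernel s :
  measurable_fun setT (fun z : R * R => normal_pdf z.1 s z.2).
Proof.
have [->|s0] := eqVneq s 0.
  rewrite /normal_pdf eqxx; apply: measurableT_comp => //.
rewrite (_ : (fun _ => _) = (fun z : R * R =>
  normal_peak s * expR (- (z.2 - z.1) ^+ 2 / (s ^+ 2 *+ 2)))); last first.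
  by apply/funext => z; rewrite normal_pdfE.
apply: measurable_funM => //; apply: measurableT_comp => //.
apply: measurable_funM => //; apply: measurableT_comp => //.
by apply: measurable_funX; exact: measurable_funB.
Qed.

Lemma unit_fun_gavg s f : unit_fun f -> unit_fun (gavg s f).
Proof.
move=> uf; split; last first.
  move=> x; have := normr_gavg_le s x uf.1 (unit_fun_norm uf).
  rewrite ger0_norm; last first.
    apply: Rintegral_ge0 => v _; rewrite mulr_ge0 ?normal_pdf_ge0//.
    by have /andP[] := uf.2 v.
  move=> ->; rewrite andbT; apply: Rintegral_ge0 => v _.
  rewrite mulr_ge0 ?normal_pdf_ge0//; by have /andP[] := uf.2 v.
apply/measurable_EFinP.
rewrite (_ : EFin \o _ = fubini_F mu (fun z : R * R =>
  (f z.2 * normal_pdf z.1 s z.2)%:E)); last first.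
  by apply/funext => x /=; rewrite gavg_EFin.
apply: measurable_fun_fubini_tonelli_F.
- apply/measurable_EFinP/measurable_funM; last exact: measurable_pdf_kernel.
  by apply: measurableT_comp => //; exact: uf.1.
- move=> z; rewrite lee_fin mulr_ge0 ?normal_pdf_ge0//.
  by have /andP[] := uf.2 z.2.
Qed.

(** Tonelli's theorem and [normal_pdf_convolution]; the remaining density in y
    has mass 1. *)
Lemma gavg_semigroup a b f x : 0 < a -> 0 < b -> unit_fun f ->
  gavg a (gavg b f) x = gavg (Num.sqrt (a ^+ 2 + b ^+ 2)) f x.
Proof.
move=> a0 b0 uf; apply: EFin_inj.
have f0 v : 0 <= f v by have /andP[] := uf.2 v.
rewrite gavg_EFin; last exact: unit_fun_gavg.
rewrite [RHS](gavg_EFin _ x uf).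
transitivity (\int[mu]_y \int[mu]_v
    (f v * (normal_pdf x a y * normal_pdf y b v))%:E)%E.
  apply: eq_integral => y _; rewrite mulrC EFinM gavg_EFin//.
  rewrite -ge0_integralZl//.
  - by apply: eq_integral => v _; rewrite -EFinM; congr EFin; ring.
  - apply/measurable_EFinP/measurable_funM; first exact: uf.1.
    exact: measurable_normal_pdf.
  - by move=> v _; rewrite lee_fin mulr_ge0 ?normal_pdf_ge0.
  - by rewrite lee_fin normal_pdf_ge0.
rewrite (@fubini_tonelli _ _ _ _ _ mu mu (fun z : R * R =>
  (f z.2 * (normal_pdf x a z.1 * normal_pdf z.1 b z.2))%:E)); last 2 first.
- apply/measurable_EFinP/measurable_funM.
    by apply: measurableT_comp => //; exact: uf.1.
  apply: measurable_funM; last exact: measurable_pdf_kernel.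
  by apply: measurableT_comp => //; exact: measurable_normal_pdf.
- by move=> z; rewrite lee_fin !mulr_ge0 ?normal_pdf_ge0.
apply: eq_integral => v _ /=.
under eq_integral do rewrite normal_pdf_convolution// mulrA EFinM.
rewrite ge0_integralZl//.
- by rewrite integral_normal_pdf mule1.
- by apply/measurable_EFinP; exact: measurable_normal_pdf.
- by move=> y _; rewrite lee_fin normal_pdf_ge0.
- by rewrite lee_fin mulr_ge0 ?normal_pdf_ge0.
Qed.

End gaussian_average.

(** * One step of Lindeberg's method *)

(** Error of a second-order Taylor expansion of a function with three bounded
    derivatives: cubic in small increments, quadratic in large ones, so that it
    is integrable as soon as the increment has a second moment. *)
Definition mincube {R : realType} (u : R) : R := Num.min (u ^+ 2) (`|u| ^+ 3).

(** The functions h1 and h2 stand for the first two derivatives of f. Only the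
    Taylor bound, uniform in the base point, is recorded: it can be integrated,
    so the class is stable under averaging ([smooth2_avg]), with the averages of
    h1 and h2 in the place of the derivatives. *)
Record smooth2 {R : realType} (K M : R) (f h1 h2 : R -> R) : Prop := Smooth2 {
  smooth2_cts : [/\ continuous f, continuous h1 & continuous h2];
  smooth2_unit : forall x, 0 <= f x <= 1;
  smooth2_bound : forall x, `|h1 x| <= M /\ `|h2 x| <= M;
  smooth2_taylor : forall x u,
    `|f (x + u) - (f x + h1 x * u + h2 x * (u ^+ 2 / 2))| <= K * mincube u }.

Section lindeberg.
Context d (T : measurableType d) (R : realType) (P : probability T R).
Implicit Types (f h : R -> R) (K M : R).

Lemma smooth2_unit_fun K M f (h1 h2 : R -> R) : smooth2 K M f h1 h2 -> unit_fun f.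
Proof.
move=> [[cf _ _] f01 _ _]; split=> //; exact: continuous_measurable_fun.
Qed.

Lemma smooth2_bounded_cts K M f (h1 h2 : R -> R) : smooth2 K M f h1 h2 ->
  [/\ bounded_cts f, bounded_cts h1 & bounded_cts h2].
Proof.
move=> S; have uf := smooth2_unit_fun S; case: S => -[cf c1 c2] _ hM _.
split; split=> //; first by exists 1; exact: unit_fun_norm.
  by exists M => x; exact: (hM x).1.
by exists M => x; exact: (hM x).2.
Qed.

Lemma smooth2_avg (Y : T -> R) K M f (h1 h2 : R -> R) : measurable_fun setT Y ->
  smooth2 K M f h1 h2 -> smooth2 K M (avg P Y f) (avg P Y h1) (avg P Y h2).
Proof.
move=> mY S; have [bf b1 b2] := smooth2_bounded_cts S.
have uf := smooth2_unit_fun S.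
split.
- by split; exact: continuous_avg.
- move=> x; apply/andP; split.
    by apply: Rintegral_ge0 => w _; have /andP[] := uf.2 (x + Y w).
  rewrite (le_trans (ler_norm _))// normr_avg_le//; first exact: bf.1.
  exact: unit_fun_norm.
- move=> x; split; apply: normr_avg_le => //; try exact: b1.1; try exact: b2.1.
    by move=> y; exact: (smooth2_bound S y).1.
  by move=> y; exact: (smooth2_bound S y).2.
move=> x u.
have jf y := integrable_shift P y mY bf.
have j1 := integrable_shift P x mY b1.
have j2 := integrable_shift P x mY b2.
have j1u := integrableRZ u j1.
have j2u := integrableRZ (u ^+ 2 / 2) j2.
have -> : avg P Y f (x + u) -
    (avg P Y f x + avg P Y h1 x * u + avg P Y h2 x * (u ^+ 2 / 2)) =
  \int[P]_w (f (x + u + Y w) -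
    (f (x + Y w) + u * h1 (x + Y w) + (u ^+ 2 / 2) * h2 (x + Y w))).
  rewrite RintegralB//; last exact: integrableRD (integrableRD (jf x) j1u) j2u.
  rewrite RintegralD//; last exact: integrableRD (jf x) j1u.
  rewrite RintegralD// !RintegralZl// /avg; congr (_ - _); ring.
have int_rem := integrableRB (jf (x + u)) (integrableRD (integrableRD (jf x) j1u) j2u).
rewrite (le_trans (le_normr_Rintegral _ _))//.
rewrite -[leRHS](Rintegral_prob_cst P); apply: le_Rintegral => //.
- exact: integrable_norm.
- by apply: (@integrable_bounded _ _ _ _ _ `|K * mincube u|).
- move=> w _; have := smooth2_taylor S (x + Y w) u.
  by rewrite [x + Y w + u]addrAC [u * _]mulrC [_ / 2 * _]mulrC.
Qed.

Lemma smooth2_iter_avg (Y : T -> R) K M f (h1 h2 : R -> R) z : measurable_fun setT Y ->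
  smooth2 K M f h1 h2 -> smooth2 K M (iter z (avg P Y) f)
    (iter z (avg P Y) h1) (iter z (avg P Y) h2).
Proof. by move=> mY S; elim: z => //= z IH; exact: smooth2_avg. Qed.

Section one_step.
Variables (D : T -> R) (v : R).
Hypothesis mD : measurable_fun setT D.
Hypothesis iD : P.-integrable setT (EFin \o D).
Hypothesis D0 : \int[P]_w D w = 0.
Hypothesis iD2 : P.-integrable setT (EFin \o (fun w => D w ^+ 2)).
Hypothesis D2 : \int[P]_w (D w ^+ 2) = v.

(** The expectation of [mincube] at e D, divided by e^2. *)
Definition trunc_moment (e : R) : R :=
  \int[P]_w Num.min (D w ^+ 2) (e * `|D w| ^+ 3).

Lemma measurable_trunc e :
  measurable_fun setT (fun w => Num.min (D w ^+ 2) (e * `|D w| ^+ 3)).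
Proof.
apply: measurable_minr; first exact: measurable_funX.
apply: measurable_funM => //; apply: measurable_funX.
exact: measurableT_comp.
Qed.

Lemma trunc_bound e w : 0 <= e ->
  `|Num.min (D w ^+ 2) (e * `|D w| ^+ 3)| <= D w ^+ 2.
Proof.
move=> e0; rewrite ger0_norm; first by rewrite ge_min lexx.
by rewrite le_min sqr_ge0 mulr_ge0// exprn_ge0.
Qed.

Lemma integrable_trunc e : 0 <= e ->
  P.-integrable setT (EFin \o (fun w => Num.min (D w ^+ 2) (e * `|D w| ^+ 3))).
Proof.
move=> e0; apply: (le_integrable _ _ _ iD2) => //.
  exact/measurable_EFinP/measurable_trunc.
move=> w _ /=; rewrite lee_fin (le_trans (trunc_bound w e0))//.
exact: ler_norm.
Qed.

Lemma mincube_scale (e u : R) : 0 <= e ->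
  mincube (e * u) = e ^+ 2 * Num.min (u ^+ 2) (e * `|u| ^+ 3).
Proof.
move=> e0; rewrite /mincube minr_pMr ?sqr_ge0// exprMn normrM ger0_norm//.
by congr (Num.min _ _); ring.
Qed.

(** Dominated convergence, with D^2 as dominating function. *)
Lemma cvg_trunc_moment (e_ : nat -> R) : (forall n, 0 <= e_ n) ->
  e_ n @[n --> \oo] --> 0 -> trunc_moment (e_ n) @[n --> \oo] --> 0.
Proof.
move=> e0 ecvg.
have [|||||_ _] := @dominated_convergence _ T R P setT measurableT
  (fun n w => (Num.min (D w ^+ 2) (e_ n * `|D w| ^+ 3))%:E) (cst 0%E)
  (fun w => (D w ^+ 2)%:E).
- by move=> n; exact/measurable_EFinP/measurable_trunc.
- exact: measurable_cst.
- apply: aeW => w _; apply: cvg_EFin; first exact: nearW.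
  apply: (@squeeze_cvgr _ _ _ _ (cst 0) (fun n => e_ n * `|D w| ^+ 3)).
  + apply: nearW => n; rewrite ge_min lexx orbT andbT.
    by rewrite le_min sqr_ge0 mulr_ge0// exprn_ge0.
  + exact: cvg_cst.
  + rewrite -[X in _ --> X](mul0r (`|D w| ^+ 3)).
    by apply: cvgM => //; exact: cvg_cst.
- exact: iD2.
- by apply: aeW => w n _ /=; rewrite lee_fin; exact: trunc_bound.
rewrite integral0 => h; apply: fine_cvg; exact: h.
Qed.

(** Integrating the Taylor expansion at x: the linear term vanishes because D is
    centred. *)
Lemma avg_taylor K M f (h1 h2 : R -> R) e x : 0 <= e -> smooth2 K M f h1 h2 ->
  `|avg P (fun w => e * D w) f x - (f x + h2 x * (e ^+ 2 * v / 2))| <=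
    K * (e ^+ 2 * trunc_moment e).
Proof.
move=> e0 S; have [bf b1 b2] := smooth2_bounded_cts S.
have meD : measurable_fun setT (fun w => e * D w) by exact: measurable_funM.
have jf := integrable_shift P x meD bf.
have jc : P.-integrable setT (EFin \o cst (f x)).
  by apply: (@integrable_bounded _ _ _ _ _ `|f x|).
have j1 := integrableRZ (h1 x * e) iD.
have j2 := integrableRZ (h2 x * (e ^+ 2 / 2)) iD2.
have -> : avg P (fun w => e * D w) f x - (f x + h2 x * (e ^+ 2 * v / 2)) =
  \int[P]_w (f (x + e * D w) - (f x + h1 x * e * D w +
     h2 x * (e ^+ 2 / 2) * D w ^+ 2)).
  rewrite RintegralB//; last exact: integrableRD (integrableRD jc j1) j2.
  rewrite RintegralD//; last exact: integrableRD jc j1.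
  rewrite (@RintegralD _ _ _ _ _ (fun=> f x))// !RintegralZl// Rintegral_prob_cst.
  rewrite D0 D2 /avg; congr (_ - _); ring.
have int_rem := integrableRB jf (integrableRD (integrableRD jc j1) j2).
rewrite (le_trans (le_normr_Rintegral _ _))//.
have jt := integrableRZ (e ^+ 2) (integrable_trunc e0).
rewrite -RintegralZl//; last exact: integrable_trunc.
rewrite -RintegralZl//.
apply: le_Rintegral => //.
- exact: integrable_norm.
- exact: (integrableRZ K jt).
- move=> w _; have := smooth2_taylor S x (e * D w).
  rewrite (mincube_scale (D w) e0) => /(le_trans _); apply.
  rewrite le_eqVlt; apply/orP; left; apply/eqP; congr `|_|; ring.
Qed.

End one_step.

Lemma gavg_taylor K M f (h1 h2 : R -> R) t x : 0 <= K -> 0 < t -> smooth2 K M f h1 h2 ->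
  `|gavg t f x - (f x + h2 x * (t ^+ 2 / 2))| <= K * (64 * t ^+ 3).
Proof.
move=> K0 t0 S; have uf := smooth2_unit_fun S.
have [i1 m1] := normal_pdf_mean0 x t0.
have [i2 m2] := normal_pdf_variance x t0.
have [i3 m3] := normal_pdf_third_moment x t0.
have jf := integrable_bounded_pdf t x uf.1 (unit_fun_norm uf).
have jp := integrable_normal_pdfR t x.
have jc := integrableRZ (f x) jp.
have j1 := integrableRZ (h1 x) i1.
have j2 := integrableRZ (h2 x / 2) i2.
have -> : gavg t f x - (f x + h2 x * (t ^+ 2 / 2)) =
  \int[lebesgue_measure]_y (f y * normal_pdf x t y -
    (f x * normal_pdf x t y + h1 x * ((y - x) * normal_pdf x t y) +
     h2 x / 2 * ((y - x) ^+ 2 * normal_pdf x t y))).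
  rewrite RintegralB//; last exact: integrableRD (integrableRD jc j1) j2.
  rewrite RintegralD//; last exact: integrableRD jc j1.
  rewrite RintegralD// !RintegralZl// m1 m2 Rintegral_normal_pdf /gavg.
  by congr (_ - _); ring.
have int_rem := integrableRB jf (integrableRD (integrableRD jc j1) j2).
rewrite (le_trans (le_normr_Rintegral _ _))//.
apply: (@le_trans _ _ (K * \int[lebesgue_measure]_y
  (`|y - x| ^+ 3 * normal_pdf x t y))); last by rewrite ler_wpM2l.
rewrite -RintegralZl//; apply: le_Rintegral => //.
- exact: integrable_norm.
- exact: (integrableRZ K i3).
- move=> y _; have := smooth2_taylor S x (y - x); rewrite [x + _]addrC subrK => h.
  set p := normal_pdf x t y; have p0 : 0 <= p by exact: normal_pdf_ge0.
  rewrite [leRHS]mulrA [X in `|X|](_ : _ = (f y - (f x + h1 x * (y - x) +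
    h2 x * ((y - x) ^+ 2 / 2))) * p); last by ring.
  rewrite normrM (ger0_norm p0) ler_wpM2r// (le_trans h)// ler_wpM2l//.
  by rewrite /mincube ge_min lexx orbT.
Qed.

End lindeberg.

(** * The central limit theorem on smooth functions *)

Section trotter.
Context d (T : measurableType d) (R : realType) (P : probability T R).
Variables (D : T -> R) (v : R).
Hypothesis mD : measurable_fun setT D.
Hypothesis iD : P.-integrable setT (EFin \o D).
Hypothesis D0 : \int[P]_w D w = 0.
Hypothesis iD2 : P.-integrable setT (EFin \o (fun w => D w ^+ 2)).
Hypothesis D2 : \int[P]_w (D w ^+ 2) = v.
Variables (K M : R).
Hypothesis K0 : 0 <= K.

Local Notation Avg e := (avg P (fun w => e * D w)).

Definition step_error (e t : R) : R :=
  K * (e ^+ 2 * trunc_moment P D e) + K * (64 * t ^+ 3) +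
  M * (`|e ^+ 2 * v - t ^+ 2| / 2).

Lemma avg_gavg_step (f h1 h2 : R -> R) e t x : 0 <= e -> 0 < t ->
  smooth2 K M f h1 h2 -> `|Avg e f x - gavg t f x| <= step_error e t.
Proof.
move=> e0 t0 S.
have a1 := avg_taylor mD iD D0 iD2 D2 x e0 S.
have a2 := gavg_taylor x K0 t0 S.
have a3 : `|h2 x * ((e ^+ 2 * v - t ^+ 2) / 2)| <=
    M * (`|e ^+ 2 * v - t ^+ 2| / 2).
  rewrite normrM (normrM _ 2^-1) [`|2^-1|]ger0_norm ?invr_ge0//.
  by rewrite ler_wpM2r ?divr_ge0//; exact: (smooth2_bound S x).2.
have -> : Avg e f x - gavg t f x =
  (Avg e f x - (f x + h2 x * (e ^+ 2 * v / 2))) -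
  (gavg t f x - (f x + h2 x * (t ^+ 2 / 2))) +
  h2 x * ((e ^+ 2 * v - t ^+ 2) / 2) by field.
rewrite (le_trans (ler_normD _ _))// lerD// (le_trans (ler_normB _ _))//.
exact: lerD.
Qed.

(** Telescoping: A^(z+1) f - B^(z+1) f = (A - B) A^z f + B (A^z f - B^z f). The
    first term is one [step_error] because A^z f satisfies the same Taylor bound
    as f; the second is controlled by the induction hypothesis because the
    Gaussian average B is a contraction. The semigroup property gives B^z in
    closed form. *)
Lemma trotter (f h1 h2 : R -> R) e t z x : 0 <= e -> 0 < t ->
  smooth2 K M f h1 h2 ->
  `|iter z.+1 (Avg e) f x - gavg (Num.sqrt z.+1%:R * t) f x| <=
    z.+1%:R * step_error e t.
Proof.
move=> e0 t0 S; have mY : measurable_fun setT (fun w => e * D w).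
  exact: measurable_funM.
have uf := smooth2_unit_fun S.
elim: z x => [|z IH] x.
  by rewrite sqrtr1 !mul1r; exact: (avg_gavg_step x e0 t0 S).
set g := iter z.+1 (Avg e) f; have Sg := smooth2_iter_avg P z.+1 mY S.
rewrite [iter z.+2 _ _]/(Avg e g).
have z0 : 0 < Num.sqrt z.+1%:R * t by rewrite mulr_gt0// sqrtr_gt0.
have -> : Num.sqrt z.+2%:R * t =
    Num.sqrt (t ^+ 2 + (Num.sqrt z.+1%:R * t) ^+ 2).
  rewrite [(_ * t) ^+ 2]exprMn sqr_sqrtr ?ler0n//.
  rewrite (_ : t ^+ 2 + _ = z.+2%:R * t ^+ 2).
    by rewrite [RHS]sqrtrM ?ler0n// sqrtr_sqr gtr0_norm.
  by rewrite [z.+2%:R]mulrS mulrDl mul1r.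
rewrite -(gavg_semigroup x t0 z0 uf).
rewrite -(subrKA (gavg t g x)) (le_trans (ler_normD _ _))//.
rewrite [z.+2%:R]mulrS mulrDl mul1r lerD//.
  exact: (avg_gavg_step x e0 t0 Sg).
apply: gavg_sub_le => //; last exact: unit_fun_gavg.
exact: smooth2_unit_fun Sg.
Qed.

(** Each of the z_n Gaussian steps is given variance v * c / z_n rather than
    v * e_n^2, so that together they have variance v * c exactly; the discrepancy
    of the variances is the last term of [step_error]. *)
Lemma clt_smooth (f h1 h2 : R -> R) (e_ : nat -> R) (z_ : nat -> nat) (c : R) :
  smooth2 K M f h1 h2 -> 0 < v -> 0 < c -> (forall n, 0 <= e_ n) ->
  e_ n @[n --> \oo] --> 0 -> (z_ n)%:R * e_ n ^+ 2 @[n --> \oo] --> c ->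
  iter (z_ n) (Avg (e_ n)) f 0 @[n --> \oo] --> gavg (Num.sqrt (v * c)) f 0.
Proof.
move=> S v0 c0 e0 ecvg zcvg.
have vc0 : 0 < v * c by exact: mulr_gt0.
have zbig : \forall n \near \oo, c / 2 < (z_ n)%:R * e_ n ^+ 2.
  by apply: (cvgr_gt _ zcvg); rewrite ltr_pdivrMr// mulr_natr mulr2n ltrDr.
have zpos : \forall n \near \oo, (0 < z_ n)%N.
  apply: filterS zbig => n; rewrite lt0n; apply: contraTneq => ->.
  by rewrite mul0r -leNgt divr_ge0// ltW.
have e2cvg : e_ n ^+ 2 @[n --> \oo] --> 0.
  have h : (e_ n * e_ n) @[n --> \oo] --> (0 * 0 : R) by exact: (cvgM ecvg ecvg).
  by move: h; rewrite mul0r.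
have zinv : (z_ n)%:R^-1 @[n --> \oo] --> (0 : R).
  apply: (@squeeze_cvgr _ _ _ _ (cst 0) (fun n => (2 / c) * e_ n ^+ 2)).
  - near=> n; rewrite invr_ge0 ler0n/=.
    have zn : 0 < (z_ n)%:R :> R by rewrite ltr0n; near: n.
    have : c / 2 < (z_ n)%:R * e_ n ^+ 2 by near: n.
    rewrite -[leLHS]mul1r ler_pdivrMr// => h.
    have := ltW h; rewrite -(ler_pM2l (_ : 0 < 2 / c)) ?divr_gt0//.
    rewrite (_ : 2 / c * (c / 2) = 1); first by rewrite mulrCA mulrC.
    by field; rewrite gt_eqF.
  - exact: cvg_cst.
  - rewrite -[X in _ --> X](mulr0 (2 / c)).
    by apply: cvgM => //; exact: cvg_cst.
pose t_ n := Num.sqrt (v * c * (z_ n)%:R^-1).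
have tcvg : t_ n @[n --> \oo] --> 0.
  rewrite -[X in _ --> X]sqrtr0 -[X in Num.sqrt X](mulr0 (v * c)).
  apply: continuous_cvg; first exact: sqrt_continuous.
  by apply: cvgM => //; exact: cvg_cst.
pose B n := K * ((z_ n)%:R * e_ n ^+ 2 * trunc_moment P D (e_ n)) +
   K * (64 * (v * c * t_ n)) + M * (`|(z_ n)%:R * e_ n ^+ 2 * v - v * c| / 2).
have Bcvg : B n @[n --> \oo] --> 0.
  have -> : 0 = K * (c * 0) + K * (64 * (v * c * 0)) + M * (`|c * v - v * c| / 2).
    by rewrite [c * v]mulrC subrr normr0 !(mulr0, mul0r) !addr0.
  apply: cvgD; first apply: cvgD.
  - apply: cvgM; first exact: cvg_cst.
    by apply: cvgM => //; exact: cvg_trunc_moment.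
  - do 3 (apply: cvgM; first exact: cvg_cst).
    exact: tcvg.
  - apply: cvgM; first exact: cvg_cst.
    apply: cvgM; last exact: cvg_cst.
    apply: cvg_norm; apply: cvgB; last exact: cvg_cst.
    by apply: cvgM => //; exact: cvg_cst.
apply/cvgrPdist_le => eps eps0.
have Bsmall : \forall n \near \oo, B n < eps by apply: (cvgr_lt _ Bcvg).
near=> n.
have zn : (0 < z_ n)%N by near: n.
have znR : 0 < (z_ n)%:R :> R by rewrite ltr0n.
have tn0 : 0 < t_ n by rewrite sqrtr_gt0 mulr_gt0// invr_gt0.
have := trotter (z_ n).-1 0 (e0 n) tn0 S; rewrite prednK//.
have -> : Num.sqrt (z_ n)%:R * t_ n = Num.sqrt (v * c).
  by rewrite -sqrtrM ?ler0n// mulrCA mulfV ?mulr1// gt_eqF.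
rewrite distrC => /le_trans; apply.
apply: (@le_trans _ _ (B n)); last first.
  by apply: ltW; near: n; exact: Bsmall.
rewrite le_eqVlt; apply/orP; left; apply/eqP.
have t2 : (z_ n)%:R * t_ n ^+ 2 = v * c.
  rewrite sqr_sqrtr; first by rewrite mulrCA mulfV ?mulr1// gt_eqF.
  by rewrite ltW// mulr_gt0// invr_gt0.
rewrite /step_error /B !mulrDr; congr (_ + _ + _).
- ring.
- by rewrite -t2; ring.
- have -> : (z_ n)%:R * e_ n ^+ 2 * v - v * c =
    (z_ n)%:R * (e_ n ^+ 2 * v - t_ n ^+ 2) by rewrite -t2; ring.
  by rewrite normrM (ger0_norm (ltW znR)); ring.
Unshelve. all: end_near. Qed.

End trotter.

(** * Smooth ramps *)

Section ramp.
Context {R : realType}.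
Implicit Types (x u a b l : R).

Definition pos_part x : R := Num.max x 0.

(** Distribution function of the quadratic B-spline with knots 0, 1, 2, 3: a
    third difference of x |-> (x_+)^3 / 6, hence twice differentiable with
    Lipschitz second derivative. The next two functions are its derivatives. *)
Definition spline x : R :=
  (pos_part x ^+ 3 - 3 * pos_part (x - 1) ^+ 3 + 3 * pos_part (x - 2) ^+ 3 - pos_part (x - 3) ^+ 3) / 6.
Definition spline1 x : R :=
  (pos_part x ^+ 2 - 3 * pos_part (x - 1) ^+ 2 + 3 * pos_part (x - 2) ^+ 2 - pos_part (x - 3) ^+ 2) / 2.
Definition spline2 x : R :=
  pos_part x - 3 * pos_part (x - 1) + 3 * pos_part (x - 2) - pos_part (x - 3).

Lemma pos_ge0E x : 0 <= x -> pos_part x = x.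
Proof. by move=> x0; rewrite /pos_part max_l. Qed.

Lemma pos_le0E x : x <= 0 -> pos_part x = 0.
Proof. by move=> x0; rewrite /pos_part max_r. Qed.

(** The second derivative 6 x_+ of (x_+)^3 is 6-Lipschitz. *)
Lemma pos_cube_taylor x u :
  `|pos_part (x + u) ^+ 3 - (pos_part x ^+ 3 + 3 * pos_part x ^+ 2 * u + 3 * pos_part x * u ^+ 2)|
    <= `|u| ^+ 3.
Proof.
have [x0|/ltW x0] := lerP 0 x; have [xu0|/ltW xu0] := lerP 0 (x + u).
- rewrite !pos_ge0E// (_ : _ - _ = u ^+ 3); last by ring.
  by rewrite normrX.
- rewrite (pos_ge0E x0) (pos_le0E xu0) expr0n/= sub0r normrN.
  have u0 : u <= 0 by lra.
  rewrite (ler0_norm u0); set w := - u; have uE : u = - w by rewrite /w opprK.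
  have wx : 0 <= w - x by rewrite /w; lra.
  rewrite (_ : _ + _ = x * (x ^+ 2 - 3 * x * w + 3 * w ^+ 2)); last first.
    by rewrite uE; ring.
  rewrite ger0_norm; last first.
    by rewrite mulr_ge0//; have := sqr_ge0 (x - w * (3 / 2)); have := sqr_ge0 w; nra.
  by have := exprn_ge0 3 wx; rewrite (_ : (w - x) ^+ 3 =
    w ^+ 3 - x * (x ^+ 2 - 3 * x * w + 3 * w ^+ 2)) ?subr_ge0//; ring.
- rewrite (pos_le0E x0) (pos_ge0E xu0) !(mulr0,expr0n,mul0r,addr0)/= subr0.
  rewrite normrX lerXn2r ?nnegrE//.
  by rewrite !ger0_norm//; lra.
- rewrite (pos_le0E x0) (pos_le0E xu0) !(mulr0,expr0n,mul0r,addr0)/= subr0 normr0.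
  exact: exprn_ge0.
Qed.

Lemma spline_taylor3 x u :
  `|spline (x + u) - (spline x + spline1 x * u + spline2 x * (u ^+ 2 / 2))|
    <= 4 / 3 * `|u| ^+ 3.
Proof.
have h0 := pos_cube_taylor x u.
have h1 := pos_cube_taylor (x - 1) u.
have h2 := pos_cube_taylor (x - 2) u.
have h3 := pos_cube_taylor (x - 3) u.
rewrite /spline /spline1 /spline2.
rewrite (_ : x + u - 1 = x - 1 + u) 1?addrAC//.
rewrite (_ : x + u - 2 = x - 2 + u) 1?addrAC//.
rewrite (_ : x + u - 3 = x - 3 + u) 1?addrAC//.
move: h0 h1 h2 h3; set r0 := _ - _; set r1 := _ - _; set r2 := _ - _.
set r3 := _ - _ => h0 h1 h2 h3.
rewrite [X in `|X|](_ : _ = (r0 - 3 * r1 + 3 * r2 - r3) / 6); last first.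
  by rewrite /r0 /r1 /r2 /r3; field.
move: h0 h1 h2 h3; rewrite !ler_norml => /andP[? ?] /andP[? ?] /andP[? ?] /andP[? ?].
by apply/andP; split; lra.
Qed.

Lemma spline_le0 x : x <= 0 -> spline x = 0.
Proof.
by move=> x0; rewrite /spline !pos_le0E; lra.
Qed.

Lemma spline_ge3 x : 3 <= x -> spline x = 1.
Proof.
by move=> x0; rewrite /spline !pos_ge0E; lra.
Qed.

Lemma spline_unit x : 0 <= spline x <= 1.
Proof.
have [x0|x0] := lerP x 0; first by rewrite spline_le0// lexx ler01.
have [x3|x3] := lerP 3 x; first by rewrite spline_ge3// lexx ler01.
have cub (t : R) : 0 <= t -> 0 <= t ^+ 3 by move=> ?; exact: exprn_ge0.
have [x1|x1] := lerP x 1.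
  rewrite /spline (pos_ge0E (ltW x0)) !(pos_le0E (_ : x - _ <= 0)); try lra.
  have y0 := cub x (ltW x0).
  have y1 : x ^+ 3 <= 1 by rewrite exprn_ile1// ltW.
  by apply/andP; split; rewrite !expr0n/=; lra.
have [x2|x2] := lerP x 2.
  rewrite /spline (pos_ge0E (ltW x0)) (pos_ge0E (_ : 0 <= x - 1)); last lra.
  rewrite !(pos_le0E (_ : x - _ <= 0)); try lra.
  rewrite expr0n/=; set t := x - 1; have -> : x = 1 + t by rewrite /t; ring.
  have t0 : 0 <= t by rewrite /t; lra.
  have t1 : t <= 1 by rewrite /t; lra.
  have h1 := mulr_ge0 t0 (_ : 0 <= 1 - t); have {}h1 : 0 <= t * (1 - t) by apply: h1; lra.
  have h2 := mulr_ge0 h1 t0.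
  have -> : ((1 + t) ^+ 3 - 3 * t ^+ 3 + 3 * 0 - 0) / 6 =
    (1 + 3 * t + t ^+ 2 + 2 * (t * (1 - t) * t)) / 6 by field.
  have := sqr_ge0 t; have : t ^+ 2 = t - t * (1 - t) by ring.
  have : t * (1 - t) * t <= t * (1 - t) by rewrite ler_piMr.
  by move=> *; apply/andP; split; lra.
rewrite /spline (pos_le0E (_ : x - 3 <= 0)); last lra.
rewrite !pos_ge0E; try lra.
set t := 3 - x; have -> : x = 3 - t by rewrite /t; ring.
rewrite expr0n/=.
have -> : ((3 - t) ^+ 3 - 3 * (3 - t - 1) ^+ 3 + 3 * (3 - t - 2) ^+ 3 - 0) / 6 =
  1 - t ^+ 3 / 6 by field.
have t0 : 0 <= t by rewrite /t; lra.
have y0 := cub t t0.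
have y1 : t ^+ 3 <= 1 by rewrite exprn_ile1// /t; lra.
by apply/andP; split; lra.
Qed.

Lemma spline12_bound x : `|spline1 x| <= 18 /\ `|spline2 x| <= 18.
Proof.
have [x3|x3] := lerP 3 x.
  rewrite /spline1 /spline2 !pos_ge0E; try lra.
  rewrite [X in `|X| <= _ /\ _](_ : _ = 0); last by field.
  by rewrite [X in _ /\ `|X| <= _](_ : _ = 0) ?normr0//; ring.
have h (c : R) : 0 <= c -> 0 <= pos_part (x - c) <= 3.
  move=> c0; rewrite /pos_part le_max lexx orbT/= ge_max; apply/andP; split; lra.
have s (t : R) : 0 <= t <= 3 -> 0 <= t ^+ 2 <= 9.
  by move=> /andP[? ?]; rewrite sqr_ge0/=; nra.
have p0 := h 0 (lexx _); rewrite subr0 in p0.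
have p1 := h 1 ler01; have p2 := h 2 (ler0n _ _); have p3 := h 3 (ler0n _ _).
have := s _ p0; have := s _ p1; have := s _ p2; have := s _ p3.
move: p0 p1 p2 p3 => /andP[? ?] /andP[? ?] /andP[? ?] /andP[? ?].
move=> /andP[? ?] /andP[? ?] /andP[? ?] /andP[? ?].
by rewrite /spline1 /spline2 !ler_norml; split; apply/andP; split; lra.
Qed.

Lemma continuous_pos_part : continuous pos_part.
Proof.
move=> x; rewrite /pos_part; apply: continuous_max; first exact: cvg_id.
exact: cvg_cst.
Qed.

Lemma continuous_pos_part_shift (c : R) n : continuous (fun x => pos_part (x - c) ^+ n).
Proof.
move=> x; apply: (@continuous_comp _ _ _ (fun x => pos_part (x - c)) (fun y => y ^+ n)).
  apply: (@continuous_comp _ _ _ (fun x => x - c) pos_part).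
    by apply: cvgB; [exact: cvg_id|exact: cvg_cst].
  exact: continuous_pos_part.
exact: exprn_continuous.
Qed.

Lemma continuous_spline n (c : R) : continuous (fun x =>
  (pos_part x ^+ n - 3 * pos_part (x - 1) ^+ n + 3 * pos_part (x - 2) ^+ n - pos_part (x - 3) ^+ n) / c).
Proof.
have e : (fun x => pos_part x ^+ n) = (fun x => pos_part (x - 0) ^+ n).
  by apply/funext => x; rewrite subr0.
have c0 : continuous (fun x => pos_part x ^+ n) by rewrite e; exact: continuous_pos_part_shift.
move=> x; apply: cvgM; last exact: cvg_cst.
apply: cvgB; last exact: continuous_pos_part_shift.
apply: cvgD; last by apply: cvgM; [exact: cvg_cst|exact: continuous_pos_part_shift].
apply: cvgB; first exact: c0.
by apply: cvgM; [exact: cvg_cst|exact: continuous_pos_part_shift].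
Qed.

Lemma smooth2_spline : smooth2 28 18 spline spline1 spline2.
Proof.
split.
- split; [exact: continuous_spline|exact: continuous_spline|].
  rewrite (_ : spline2 = (fun x => (pos_part x ^+ 1 - 3 * pos_part (x - 1) ^+ 1 +
    3 * pos_part (x - 2) ^+ 1 - pos_part (x - 3) ^+ 1) / 1)); first exact: continuous_spline.
  by apply/funext => x; rewrite divr1 !expr1.
- exact: spline_unit.
- exact: spline12_bound.
- move=> x u; rewrite /mincube.
  have h3 := spline_taylor3 x u; have u0 := normr_ge0 u.
  have q0 : 0 <= `|u| ^+ 2 by exact: sqr_ge0.
  have c0 : 0 <= `|u| ^+ 3 by exact: exprn_ge0.
  rewrite -[X in Num.min X _]real_normK ?num_real//.
  (* The cubic bound serves for |u| <= 1. For |u| >= 1 each term of the expansion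
     is bounded separately: 1 + 18 |u| + 18 u^2 / 2 <= 28 u^2. *)
  have [u1|/ltW u1] := lerP `|u| 1.
    rewrite min_r; first by apply: (le_trans h3); lra.
    by rewrite exprSr ler_piMr.
  rewrite min_l; last by rewrite [leRHS]exprSr ler_peMr.
  have /andP[a0 a1] := spline_unit (x + u); have /andP[b0 b1] := spline_unit x.
  have [h1 h2] := spline12_bound x.
  have k1 : `|spline1 x * u| <= 18 * `|u| by rewrite normrM ler_wpM2r.
  have k2 : `|spline2 x * (u ^+ 2 / 2)| <= 18 * (`|u| ^+ 2 / 2).
    rewrite normrM -[u ^+ 2]real_normK ?num_real//.
    by rewrite (ger0_norm (_ : 0 <= `|u| ^+ 2 / 2)) ?divr_ge0// ler_wpM2r ?divr_ge0.
  have uu : `|u| <= `|u| ^+ 2 by rewrite expr2 ler_peMr.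
  move: k1 k2; rewrite !ler_norml => /andP[? ?] /andP[? ?].
  by apply/andP; split; lra.
Qed.

(** A smooth function equal to 0 before a and to 1 after b. *)
Definition ramp a b x : R := spline (3 / (b - a) * (x - a)).

Lemma ramp_le a b x : a < b -> x <= a -> ramp a b x = 0.
Proof.
move=> ab xa; apply: spline_le0; rewrite mulr_ge0_le0 ?subr_le0//.
by rewrite divr_ge0// subr_ge0 ltW.
Qed.

Lemma ramp_ge a b x : a < b -> b <= x -> ramp a b x = 1.
Proof.
move=> ab bx; apply: spline_ge3; have ba : 0 < b - a by rewrite subr_gt0.
by rewrite mulrAC ler_pdivlMr// ler_pM2l// lerD2r.
Qed.

Lemma smooth2_ramp a b : a < b -> exists K M h1 h2,
  0 <= K /\ smooth2 K M (ramp a b) h1 h2.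
Proof.
move=> ab; set l := 3 / (b - a).
have l0 : 0 <= l by rewrite divr_ge0// subr_ge0 ltW.
exists ((l ^+ 2 + l ^+ 3) * 28), ((l + l ^+ 2) * 18).
exists (fun x => l * spline1 (l * (x - a))), (fun x => l ^+ 2 * spline2 (l * (x - a))).
have [[c0 c1 c2] u b12 ta] := smooth2_spline.
have l2 : 0 <= l ^+ 2 by exact: sqr_ge0.
have l3 : 0 <= l ^+ 3 by exact: exprn_ge0.
have cl : continuous (fun x => l * (x - a)).
  move=> x; apply: cvgM; first exact: cvg_cst.
  by apply: cvgB; [exact: cvg_id|exact: cvg_cst].
split; first by rewrite mulr_ge0// addr_ge0.
split.
- split=> x; first exact: (continuous_comp (cl x) (c0 _)).
    apply: cvgM; first exact: cvg_cst.
    exact: (continuous_comp (cl x) (c1 _)).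
  apply: cvgM; first exact: cvg_cst.
  exact: (continuous_comp (cl x) (c2 _)).
- by move=> x; exact: u.
- move=> x; have [k1 k2] := b12 (l * (x - a)).
  split; rewrite normrM ?(ger0_norm l0) ?(ger0_norm l2).
    by rewrite ler_pM// lerDl.
  by rewrite ler_pM// lerDr.
- move=> x y; have := ta (l * (x - a)) (l * y); rewrite /ramp -/l.
  rewrite (_ : l * (x + y - a) = l * (x - a) + l * y); last by ring.
  rewrite (_ : l * _ * y = spline1 (l * (x - a)) * (l * y)); last by ring.
  rewrite (_ : l ^+ 2 * _ * (y ^+ 2 / 2) =
    spline2 (l * (x - a)) * ((l * y) ^+ 2 / 2)); last by field.
  move=> /le_trans; apply.
  rewrite [leRHS](_ : _ = 28 * ((l ^+ 2 + l ^+ 3) * mincube y)); last by ring.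
  rewrite ler_wpM2l//.
  rewrite /mincube [(l * y) ^+ 2]exprMn normrM (ger0_norm l0) [(l * _) ^+ 3]exprMn.
  have q0 := sqr_ge0 y; have q3 := exprn_ge0 3 (normr_ge0 y).
  have [h|/ltW h] := lerP (y ^+ 2) (`|y| ^+ 3).
    by rewrite ge_min; apply/orP; left; rewrite ler_wpM2r// lerDl.
  by rewrite ge_min; apply/orP; right; rewrite ler_wpM2r// lerDr.
Qed.

End ramp.

(** * Weak convergence and tails *)

Section tails.
Context {R : realType}.
Local Notation mR := (measurableTypeR R).
Implicit Types (mu : {measure set mR -> \bar R}) (f : R -> R).

(** Near-covering form of the compactness of [-L, L], applied to the filter of
    radii tending to 0. *)
Lemma heine f (L e : R) : continuous f -> 0 < e ->
  exists2 r, 0 < r & forall x y, -L <= x <= L -> `|y - x| < r -> `|f y - f x| <= e.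
Proof.
move=> cf e0.
have /compact_near_coveringP H := @segment_compact R (- L) L.
have : \forall r \near (0 : R)^'+, `[-L, L] `<=`
    (fun x => forall y, `|y - x| < r -> `|f y - f x| <= e).
  apply: (H R (0^'+) (fun r x => forall y, `|y - x| < r -> `|f y - f x| <= e)).
  move=> x _.
  have e2 : 0 < e / 2 by rewrite divr_gt0.
  have /cvgrPdist_le /(_ _ e2) [r /= r0 hr] := cf x.
  exists ([set x' | `|x - x'| < r / 2], [set t | t < r / 2]); last first.
    move=> [x' t] /= [xx' tr] y yx'.
    have h1 := hr x' _; have h2 := hr y _.
    rewrite -(subrKA (f x)) (le_trans (ler_normD _ _))// [e]splitr.
    rewrite lerD//; last by apply: h1 => /=; rewrite (lt_le_trans xx')//; lra.
    rewrite distrC; apply: h2 => /=.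
    rewrite -(subrKA x') (le_lt_trans (ler_normD _ _))// [r]splitr ltrD//.
    by rewrite distrC (lt_trans yx').
  split => /=.
    by exists (r / 2) => //=; rewrite divr_gt0.
  by apply: nbhs_right_lt; rewrite divr_gt0.
move=> near_r.
have [r [r0 hr]] : exists r : R, 0 < r /\ `[-L, L] `<=`
    (fun x => forall y, `|y - x| < r -> `|f y - f x| <= e).
  near (0 : R)^'+ => r; exists r; split; first by near: r; exact: nbhs_right_gt.
  by near: r.
exists r => // x y xL; apply: hr => /=.
by rewrite in_itv.
Unshelve. all: end_near. Qed.

Definition tail mu (x : R) : R := fine (mu `]x, +oo[%classic).

Lemma integrable_mass1 mu f (M : R) (D : set mR) : mu setT = 1%E ->
  measurable D -> continuous f -> (forall x, `|f x| <= M) ->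
  mu.-integrable D (EFin \o f).
Proof.
move=> mu1 mD cf fM.
have mf : measurable_fun (setT : set mR) f by exact: continuous_measurable_fun.
apply: (integrableS measurableT) => //.
apply: measurable_bounded_integrable => //; first by rewrite mu1 ltry.
exists M; split; first exact: num_real.
by move=> y My w _; exact: le_trans (fM w) (ltW My).
Qed.

Lemma fin_num_mass1 mu (D : set mR) : mu setT = 1%E -> measurable D ->
  mu D \is a fin_num.
Proof.
move=> mu1 mD; rewrite ge0_fin_numE//.
by rewrite (@le_lt_trans _ _ 1%E) ?ltry// -mu1 le_measure ?inE.
Qed.

Lemma tail_itv mu (a b : R) : mu setT = 1%E -> a <= b ->
  fine (mu `]a, b]%classic) = tail mu a - tail mu b.
Proof.
move=> mu1 ab; rewrite /tail.
have -> : `]a, +oo[%classic = `]a, b]%classic `|` `]b, +oo[%classic :> set mR.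
  by rewrite -itv_bndbnd_setU ?bnd_simp.
rewrite measureU//; last first.
  by apply/seteqP; split => // x /= []; rewrite !in_itv/= andbT => /andP[_] xb;
    rewrite ltNge xb.
by rewrite fineD ?fin_num_mass1// addrK.
Qed.

Lemma tail_le mu (a b : R) : mu setT = 1%E -> a <= b -> tail mu b <= tail mu a.
Proof. by move=> mu1 ab; rewrite -subr_ge0 -tail_itv// fine_ge0. Qed.

Section riemann_sum.
Variables (mu : {measure set mR -> \bar R}) (f : R -> R) (M delta : R).
Variables (x_ : nat -> R).
Hypothesis mu1 : mu setT = 1%E.
Hypothesis cf : continuous f.
Hypothesis fM : forall x, `|f x| <= M.
Hypothesis x_nd : forall i, x_ i <= x_ i.+1.

(** Riemann-Stieltjes sum of f along the grid x_. *)
Definition tail_sum J : R :=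
  \sum_(i < J) f (x_ i) * (tail mu (x_ i) - tail mu (x_ i.+1)).

Let integrable_f D : measurable D -> mu.-integrable D (EFin \o f).
Proof. by move=> mD; exact: (@integrable_mass1 mu f M). Qed.

Lemma tail_sum_itv J :
  (forall i y, (i < J)%N -> x_ i < y <= x_ i.+1 -> `|f y - f (x_ i)| <= delta) ->
  `|\int[mu]_(y in `]x_ 0%N, x_ J]) f y - tail_sum J| <=
    delta * (tail mu (x_ 0%N) - tail mu (x_ J)).
Proof.
elim: J => [|J IH] h.
  rewrite /tail_sum big_ord0 set_itvoc0 Rintegral_set0.
  by rewrite !subrr normr0 mulr0.
have x0J : x_ 0%N <= x_ J by elim: {IH h} J => // J IH; exact: le_trans IH _.
have {}IH := IH (fun i y iJ => h i y (ltnW iJ)).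
have -> : `]x_ 0%N, x_ J.+1]%classic =
    `]x_ 0%N, x_ J]%classic `|` `]x_ J, x_ J.+1]%classic :> set mR.
  by rewrite -itv_bndbnd_setU ?bnd_simp.
rewrite Rintegral_setU//; last 2 first.
- by apply: integrable_f; exact: measurableU.
- apply/disj_setPS => x /= []; rewrite !in_itv/= => /andP[_ xJ] /andP[].
  by rewrite ltNge xJ.
rewrite /tail_sum big_ord_recr/= -/(tail_sum J).
set S := tail_sum J in IH *; set A := Rintegral _ _ _ in IH *.
set B := \int[mu]_(y in _) _.
have hB : `|B - f (x_ J) * (tail mu (x_ J) - tail mu (x_ J.+1))| <=
    delta * (tail mu (x_ J) - tail mu (x_ J.+1)).
  rewrite -tail_itv// -!Rintegral_cst// /B -RintegralB//; last 2 first.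
  - exact: integrable_f.
  - by apply: (@integrable_mass1 mu (fun=> f (x_ J)) M) => // x; exact: cvg_cst.
  rewrite (le_trans (le_normr_Rintegral _ _))//.
    apply: (@integrableB _ _ _ mu _ _ (EFin \o f) (EFin \o (fun=> f (x_ J)))) => //.
      exact: integrable_f.
    by apply: (@integrable_mass1 mu (fun=> f (x_ J)) M) => // x; exact: cvg_cst.
  apply: le_Rintegral => //.
  - apply: (@integrable_norm _ _ _ mu _ (fun y => f y - f (x_ J))).
    apply: (@integrableB _ _ _ mu _ _ (EFin \o f) (EFin \o (fun=> f (x_ J)))) => //.
      exact: integrable_f.
    by apply: (@integrable_mass1 mu (fun=> f (x_ J)) M) => // x; exact: cvg_cst.
  - by apply: (@integrable_mass1 mu (fun=> delta) `|delta|) => // x; exact: cvg_cst.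
  - by move=> y /=; rewrite in_itv/= => yJ; exact: h.
have -> : A + B - (S + f (x_ J) * (tail mu (x_ J) - tail mu (x_ J.+1))) =
  (A - S) + (B - f (x_ J) * (tail mu (x_ J) - tail mu (x_ J.+1))) by ring.
rewrite (le_trans (ler_normD _ _))//.
have -> : delta * (tail mu (x_ 0%N) - tail mu (x_ J.+1)) =
  delta * (tail mu (x_ 0%N) - tail mu (x_ J)) +
  delta * (tail mu (x_ J) - tail mu (x_ J.+1)) by ring.
exact: lerD.
Qed.

(** On the grid, f is replaced by a step function at distance at most delta; off
    the grid, it is bounded by M. *)
Lemma tail_sum_approx J : 0 <= delta ->
  (forall i y, (i < J)%N -> x_ i < y <= x_ i.+1 -> `|f y - f (x_ i)| <= delta) ->
  `|\int[mu]_y f y - tail_sum J| <=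
    delta + M * (1 - (tail mu (x_ 0%N) - tail mu (x_ J))).
Proof.
move=> d0 h; have hJ := tail_sum_itv h.
have x0J : x_ 0%N <= x_ J by elim: {h hJ} J => // J IH; exact: le_trans IH _.
have mass : 0 <= tail mu (x_ 0%N) - tail mu (x_ J) <= 1.
  rewrite -tail_itv// fine_ge0//= -lee_fin fineK ?fin_num_mass1//.
  by rewrite -mu1 le_measure ?inE.
set D := `]x_ 0%N, x_ J]%classic : set mR; have mD : measurable D by exact: measurable_itv.
have -> : \int[mu]_y f y = \int[mu]_(y in D) f y + \int[mu]_(y in ~` D) f y.
  rewrite -Rintegral_setU ?setUv//; first exact: measurableC.
  - exact: integrable_f.
  - by apply/disj_setPS => x /= [].
have hC : `|\int[mu]_(y in ~` D) f y| <= M * (1 - (tail mu (x_ 0%N) - tail mu (x_ J))).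
  have mC : measurable (~` D) by exact: measurableC.
  have -> : 1 - (tail mu (x_ 0%N) - tail mu (x_ J)) = fine (mu (~` D)).
    rewrite -tail_itv// -/D.
    have : (mu D + mu (~` D))%E = 1%E.
      by rewrite -mu1 -measureU ?setUv// setICr.
    rewrite -[mu D]fineK ?fin_num_mass1// -[mu (~` D)]fineK ?fin_num_mass1//.
    by rewrite -EFinD => -[<-]/=; ring.
  rewrite -Rintegral_cst// (le_trans (le_normr_Rintegral _ _))//; first exact: integrable_f.
  apply: le_Rintegral => //.
  - by apply: integrable_norm; exact: integrable_f.
  - by apply: (@integrable_mass1 mu (fun=> M) `|M|) => // x; exact: cvg_cst.
rewrite addrAC (le_trans (ler_normD _ _))// lerD// (le_trans hJ)//.
by have /andP[_ m1] := mass; rewrite ler_piMr.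
Qed.

End riemann_sum.

Lemma cvg_mass_itv (nu : {measure set mR -> \bar R}) (e : R) :
  nu setT = 1%E -> 0 < e ->
  exists2 L : R, 0 < L & 1 - (tail nu (- L) - tail nu L) <= e.
Proof.
move=> nu1 e0.
pose F (n : nat) : set mR := `]- n%:R, n%:R]%classic.
have : nu (F n) @[n --> \oo] --> nu (\bigcup_n F n).
  have mF i : measurable (F i) by exact: measurable_itv.
  apply: nondecreasing_cvg_mu => //; first exact: bigcup_measurable.
  move=> i j ij; apply/subsetPset => x /=; rewrite /F/= !in_itv/= => /andP[xi xj].
  have ijR : (i%:R : R) <= j%:R by rewrite ler_nat.
  by apply/andP; split; [apply: le_lt_trans xi; rewrite lerN2|exact: le_trans ijR].
have -> : \bigcup_n F n = setT.
  apply/seteqP; split => // x _.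
  exists (Num.truncn `|x|).+1 => //=; rewrite /F/= in_itv/=.
  have /ltW xt := truncnS_gt `|x|; have xt' := truncnS_gt `|x|.
  rewrite (le_trans (ler_norm _) xt) andbT ltrNl.
  by rewrite (le_lt_trans (ler_norm _))// normrN.
rewrite nu1 => /fine_cvgP[_] /= /cvgrPdist_le /(_ e e0)[N _ hN].
exists N.+1%:R => //.
have := hN N.+1 (leqnSn N); rewrite /= tail_itv//; last first.
  by rewrite (@le_trans _ _ 0) ?oppr_le0.
by move=> /(le_trans (ler_norm _)).
Qed.

(** A bounded continuous function is integrated up to a small error by a
    Riemann-Stieltjes sum over a large interval, and such a sum only involves
    finitely many tails. The mass that mu_n leaves outside of the interval is
    itself a combination of tails, which gives tightness. *)
Lemma weakly_cvg_tail (mu_ : nat -> {measure set mR -> \bar R})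
    (nu : {measure set mR -> \bar R}) :
  (forall n, mu_ n setT = 1%E) -> nu setT = 1%E ->
  (forall x, tail (mu_ n) x @[n --> \oo] --> tail nu x) ->
  weakly_cvg mu_ nu.
Proof.
move=> mu1 nu1 tl f cf [M fM].
have intE (mu : {measure set mR -> \bar R}) : mu setT = 1%E ->
    (\int[mu]_x (f x)%:E)%E = (\int[mu]_x f x)%:E.
  move=> m1; rewrite /Rintegral fineK//; apply: integrable_fin_num => //.
  exact: (@integrable_mass1 mu f M).
rewrite intE//; under eq_cvg do rewrite intE//.
apply: cvg_EFin; first exact: nearW.
have M0 : 0 <= M by exact: le_trans (fM 0).
apply/cvgrPdist_le => e e0.
(* Mass allowed outside of the interval: M times it stays below e / 8. *)
pose d := e / (8 * (M + 1)).
have M1 : 0 < M + 1 by rewrite ltr_wpDl.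
have d0 : 0 < d by rewrite divr_gt0// mulr_gt0.
have [L L0 hL] := cvg_mass_itv nu1 d0.
have e8 : 0 < e / 8 by rewrite divr_gt0.
have [r r0 hr] := heine L cf e8.
pose J := (Num.truncn (2 * L / r)).+1.
pose x_ i : R := - L + (2 * L / J%:R) * i%:R.
have J0 : 0 < J%:R :> R by rewrite ltr0n.
have h0 : 0 < 2 * L / J%:R by rewrite divr_gt0// mulr_gt0.
have hJr : 2 * L / J%:R < r.
  by rewrite ltr_pdivrMr// [r * _]mulrC -ltr_pdivrMr//; exact: truncnS_gt.
have xS i : x_ i.+1 = x_ i + 2 * L / J%:R.
  by rewrite /x_ -[i.+1%:R]natr1 mulrDr mulr1 addrA.
have x_nd i : x_ i <= x_ i.+1 by rewrite xS lerDl ltW.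
have x0 : x_ 0%N = - L by rewrite /x_ mulr0 addr0.
have xJ : x_ J = L by rewrite /x_ divfK ?gt_eqF//; ring.
have cell i y : (i < J)%N -> x_ i < y <= x_ i.+1 -> `|f y - f (x_ i)| <= e / 8.
  move=> iJ /andP[y1 y2]; apply: hr.
    apply/andP; split; first by rewrite lerDl mulr_ge0// ltW.
    rewrite -xJ lerD2l ler_wpM2l ?(ltW h0)//.
    by rewrite ler_nat ltnW.
  by rewrite ger0_norm; move: y2; rewrite xS; lra.
have Anu := tail_sum_approx nu1 cf fM x_nd (ltW e8) cell.
have Amu n := tail_sum_approx (mu1 n) cf fM x_nd (ltW e8) cell.
rewrite x0 xJ in Anu Amu.
have Scvg : tail_sum (mu_ n) f x_ J @[n --> \oo] --> tail_sum nu f x_ J.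
  rewrite /tail_sum; apply: cvg_big => //; first exact: add_continuous.
  move=> i _; apply: cvgM; first exact: cvg_cst.
  by apply: cvgB; exact: tl.
have Mcvg : 1 - (tail (mu_ n) (- L) - tail (mu_ n) L) @[n --> \oo] -->
    1 - (tail nu (- L) - tail nu L).
  by apply: cvgB; [exact: cvg_cst|apply: cvgB; exact: tl].
move/cvgrPdist_le : Scvg => /(_ _ e8) Scvg.
move/cvgrPdist_le : Mcvg => /(_ _ d0) Mcvg.
near=> n.
have A := Amu n.
have B : `|tail_sum nu f x_ J - tail_sum (mu_ n) f x_ J| <= e / 8 by near: n.
have C : 1 - (tail (mu_ n) (- L) - tail (mu_ n) L) <= d + d.
  have : `|(1 - (tail nu (- L) - tail nu L)) -
    (1 - (tail (mu_ n) (- L) - tail (mu_ n) L))| <= d by near: n.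
  by rewrite ler_norml => /andP[]; move: hL; lra.
have Md : M * d <= e / 8.
  have : (M + 1) * d = e / 8 by rewrite /d; field; rewrite gt_eqF.
  by move=> <-; rewrite ler_wpM2r ?(ltW d0)// lerDl.
have MC := ler_wpM2l M0 C; have ML := ler_wpM2l M0 hL.
move: A B Anu; rewrite /= !ler_norml => /andP[A1 A2] /andP[B1 B2] /andP[C1 C2].
by apply/andP; split; lra.
Unshelve. all: end_near. Qed.

End tails.

(** * Tails of the normal law *)

Section normal_tails.
Context {R : realType}.
Local Notation mR := (measurableTypeR R).
Local Notation mu := (@lebesgue_measure R).
Variable s : R.
Hypothesis s0 : 0 < s.
Local Notation nu := (normal_prob (0 : R) s).

Lemma normal_tailE (a : R) :
  tail nu a = \int[mu]_x (normal_pdf 0 s \_ `]a, +oo[) x.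
Proof. by rewrite -Rintegral_mkcond. Qed.

Lemma continuous_ramp (a b : R) : a < b -> continuous (ramp a b).
Proof.
by move=> ab; have [K [M [h1 [h2 [_ S]]]]] := smooth2_ramp ab; have [] := smooth2_cts S.
Qed.

Lemma unit_fun_ramp (a b : R) : a < b -> unit_fun (ramp a b).
Proof.
by move=> ab; have [K [M [h1 [h2 [_ S]]]]] := smooth2_ramp ab; exact: smooth2_unit_fun S.
Qed.

Lemma ramp_indic (a b : R) x : a < b ->
  (\1_`]b, +oo[ x : R) <= ramp a b x <= \1_`]a, +oo[ x.
Proof.
move=> ab; rewrite !indicE !mem_setE !in_itv/= !andbT.
have /andP[r0 r1] := (unit_fun_ramp ab).2 x; apply/andP; split.
  by have [bx|//] := ltrP b x; rewrite (ramp_ge ab (ltW bx)).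
by have [//|xa] := ltrP a x; rewrite (ramp_le ab xa).
Qed.

Lemma gavg_ramp_tail (a b : R) : a < b ->
  tail nu b <= gavg s (ramp a b) 0 <= tail nu a.
Proof.
move=> ab; rewrite !normal_tailE /gavg.
have uf := unit_fun_ramp ab.
have ir := integrable_bounded_pdf s 0 uf.1 (unit_fun_norm uf).
have ip c : mu.-integrable setT (EFin \o (normal_pdf 0 s \_ `]c, +oo[)).
  rewrite -restrict_EFin; apply/integrable_restrict => //.
  by rewrite setTI; apply: (integrableS measurableT) => //; exact: integrable_normal_pdfR.
have E c x : (normal_pdf 0 s \_ `]c, +oo[) x = \1_`]c, +oo[ x * normal_pdf 0 s x.
  by rewrite patchE indicE; case: ifP; rewrite ?mul1r ?mul0r.
apply/andP; split; apply: le_Rintegral => // x _; rewrite E ler_wpM2r ?normal_pdf_ge0//.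
  by have /andP[] := ramp_indic x ab.
by have /andP[] := ramp_indic x ab.
Qed.

Lemma normal_tail_lipschitz (a b : R) : a <= b ->
  tail nu a - tail nu b <= normal_peak s * (b - a).
Proof.
move=> ab; rewrite -tail_itv//; last exact: probability_setT.
have -> : normal_peak s * (b - a) = \int[mu]_(x in `]a, b]) normal_peak s.
  rewrite Rintegral_cst// [X in fine X]lebesgue_measure_itv/= lte_fin.
  by have [|/(conj ab)/andP/le_anti ->] := ltrP a b; rewrite ?subrr ?mulr0.
apply: le_Rintegral => //.
- by apply: (integrableS measurableT) => //; exact: integrable_normal_pdfR.
- apply: measurable_bounded_integrable => //.
    by rewrite [X in (X < _)%E]lebesgue_measure_itv/=; case: ifP; rewrite ?ltry// -EFinB ltry.
  exists (normal_peak s); split; first exact: num_real.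
  by move=> y My w _; rewrite /= ger0_norm ?normal_peak_ge0// ltW.
- by move=> x _; apply: normal_pdf_ub; rewrite gt_eqF.
Qed.

(** Ramps over a short interval just before and just after x bound the tail at x
    from both sides. As the normal density is bounded, its tail varies little
    between the ends of the ramps. Restricting the hypothesis to rational ends
    makes it a countable family of conditions. *)
Lemma weakly_cvg_sandwich (mu_ : nat -> {measure set mR -> \bar R}) :
  (forall n, mu_ n setT = 1%E) ->
  (forall p q : rat, p < q -> exists2 theta : nat -> R,
     theta n @[n --> \oo] --> gavg s (ramp (ratr p) (ratr q)) 0 &
     forall n, tail (mu_ n) (ratr q) <= theta n <= tail (mu_ n) (ratr p)) ->
  weakly_cvg mu_ nu.
Proof.
move=> mu1 H; apply: weakly_cvg_tail => //; first exact: probability_setT.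
have nu1 : nu setT = 1%E by exact: probability_setT.
move=> x; apply/cvgrPdist_le => e e0.
have pk : 0 < normal_peak s by rewrite normal_peak_gt0// gt_eqF.
pose r := e / (2 * normal_peak s).
have r0 : 0 < r by rewrite divr_gt0// mulr_gt0.
have pr : normal_peak s * r = e / 2 by rewrite /r; field; rewrite gt_eqF.
have xr1 : x - r < x by lra.
have xr2 : x < x + r by lra.
have [q1] := rat_in_itvoo xr1.
rewrite in_itv/= => /andP[a1 a2].
have [q2] := rat_in_itvoo a2; rewrite in_itv/= => /andP[b1 b2].
have [q3] := rat_in_itvoo xr2.
rewrite in_itv/= => /andP[c1 c2].
have [q4] := rat_in_itvoo c2; rewrite in_itv/= => /andP[d1 d2].
have q12 : q1 < q2 by rewrite -(ltr_rat R).
have q34 : q3 < q4 by rewrite -(ltr_rat R).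
have [t1 t1cvg t1b] := H _ _ q12; have [t2 t2cvg t2b] := H _ _ q34.
have e2 : 0 < e / 2 by rewrite divr_gt0.
move/cvgrPdist_le : t1cvg => /(_ _ e2) t1cvg.
move/cvgrPdist_le : t2cvg => /(_ _ e2) t2cvg.
have /andP[_ u1] := gavg_ramp_tail b1.
have /andP[u2 _] := gavg_ramp_tail d1.
have l1 := normal_tail_lipschitz (ltW a2).
have l2 := normal_tail_lipschitz (ltW (lt_trans c1 d1)).
have l1' : normal_peak s * (x - ratr q1) <= e / 2.
  by rewrite -pr ler_wpM2l ?(ltW pk)//; lra.
have l2' : normal_peak s * (ratr q4 - x) <= e / 2.
  by rewrite -pr ler_wpM2l ?(ltW pk)//; lra.
near=> n.
have /andP[v1 _] := t1b n; have /andP[_ v2] := t2b n.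
have w1 := tail_le (mu1 n) (ltW b2); have w2 := tail_le (mu1 n) (ltW c1).
have : `|gavg s (ramp (ratr q1) (ratr q2)) 0 - t1 n| <= e / 2 by near: n.
have : `|gavg s (ramp (ratr q3) (ratr q4)) 0 - t2 n| <= e / 2 by near: n.
rewrite !ler_norml => /andP[A1 A2] /andP[B1 B2].
by apply/andP; split; lra.
Unshelve. all: end_near. Qed.

End normal_tails.

(** * Averaging for counting variables *)

Section nat_fibers.
Context d (T : measurableType d) (R : realType) (P : probability T R).

Lemma measurable_preim_nat (Y : {RV P >-> nat}) (B : set nat) : measurable (Y @^-1` B).
Proof. by rewrite -[X in measurable X]setTI; exact: measurable_funP. Qed.

Lemma setI_preim_bigcup (Y : T -> nat) B :
  B = \bigcup_n (B `&` Y @^-1` [set n]).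
Proof.
apply/seteqP; split => [w Bw|w [n _ []]//]; by exists (Y w).
Qed.

Lemma trivIset_preim (Y : T -> nat) B :
  trivIset setT (fun n => B `&` Y @^-1` [set n]).
Proof. by move=> n n' _ _ [w [[_ /= <-] [_ /= <-]]]. Qed.

End nat_fibers.

(** The operator [avg] for integer-valued variables. Extended real values allow
    unbounded functions such as squares. *)
Definition nat_avg {d} {T : measurableType d} {R : realType} (P : probability T R)
    (Y : T -> nat) (g : nat -> \bar R) (n : nat) : \bar R :=
  (\int[P]_w g (n + Y w)%N)%E.

Section nat_average.
Context d (T : measurableType d) (R : realType) (P : probability T R).
Implicit Types (Y : {RV P >-> nat}) (g : nat -> \bar R).
Local Open Scope ereal_scope.

Lemma measurable_nat_fun (B : set T) Y g n : measurable B ->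
  measurable_fun B (fun w => g (n + Y w)%N).
Proof.
move=> mB; apply: measurable_funTS.
apply: (@measurableT_comp _ _ _ _ _ _ (fun y => g (n + y)%N)) => //.
Qed.

Lemma nat_avg_ge0 (Y : T -> nat) g n : (forall i, 0 <= g i) -> 0 <= nat_avg P Y g n.
Proof. by move=> g0; apply: integral_ge0 => w _. Qed.

Lemma iter_nat_avg_ge0 (Y : T -> nat) g z n : (forall i, 0 <= g i) ->
  0 <= iter z (nat_avg P Y) g n.
Proof. by move=> g0; elim: z n => //= z IH n; exact: nat_avg_ge0. Qed.

(** Both sides are the expectation of g(n + X + Y) for independent X and Y. *)
Lemma nat_avg_comm (X Y : {RV P >-> nat}) g : (forall i, 0 <= g i) ->
  nat_avg P X (nat_avg P Y g) = nat_avg P Y (nat_avg P X g).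
Proof.
move=> g0; apply/funext => n.
rewrite /nat_avg.
transitivity (\int[P]_w' \int[P]_w (fun z : T * T => g (n + X z.1 + Y z.2)%N) (w, w')).
  apply: (@fubini_tonelli _ _ _ _ _ P P (fun z : T * T => g (n + X z.1 + Y z.2)%N)) => //.
  apply: (@measurableT_comp _ _ _ _ _ _ g) => //.
  apply: measurable_fun_addn; last exact: measurableT_comp.
  by apply: measurable_fun_addn => //; exact: measurableT_comp.
by apply: eq_integral => w _; apply: eq_integral => w' _ /=; rewrite addnAC.
Qed.

Lemma iter_nat_avg_comm (X Y : {RV P >-> nat}) g z : (forall i, 0 <= g i) ->
  nat_avg P X (iter z (nat_avg P Y) g) = iter z (nat_avg P Y) (nat_avg P X g).
Proof.
move=> g0; elim: z => //= z IH; rewrite nat_avg_comm ?IH// => i.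
exact: iter_nat_avg_ge0.
Qed.

Lemma integral_nat_split (Y : {RV P >-> nat}) (B : set T) (f : T -> \bar R) :
  measurable B -> measurable_fun B f -> (forall w, B w -> 0 <= f w) ->
  \int[P]_(w in B) f w = \sum_(c <oo) \int[P]_(w in B `&` (Y : T -> nat) @^-1` [set c]) f w.
Proof.
move=> mB mf f0.
have E := setI_preim_bigcup Y B.
rewrite {1}E ge0_integral_bigcup -?E//.
- move=> c; apply: measurableI => //; exact: measurable_preim_nat.
- exact: trivIset_preim.
Qed.

End nat_average.

(** * Second moments *)

Section second_moments.
Context d (T : measurableType d) (R : realType) (P : probability T R).
Implicit Types (X : T -> R) (Y : {RV P >-> nat}).

Lemma integrable_prob_cst (c : R) : P.-integrable setT (EFin \o cst c).
Proof. exact: (@integrable_bounded _ _ _ _ _ `|c|). Qed.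

Lemma square_integrable X : measurable_fun setT X ->
  P.-integrable setT (EFin \o (fun w => X w ^+ 2)) -> P.-integrable setT (EFin \o X).
Proof.
move=> mX iX2; have i1 := integrable_prob_cst 1.
apply: (le_integrable _ _ _ (integrableRD i1 iX2)) => //.
  exact/measurable_EFinP.
move=> w _ /=; rewrite lee_fin [leRHS]ger0_norm ?addr_ge0 ?sqr_ge0//.
have := sqr_ge0 (`|X w| - 1); rewrite -[X w ^+ 2]real_normK ?num_real//.
have := normr_ge0 (X w); nra.
Qed.

Lemma integrable_shift_sq X (c : R) : measurable_fun setT X ->
  P.-integrable setT (EFin \o (fun w => X w ^+ 2)) ->
  P.-integrable setT (EFin \o (fun w => (X w + c) ^+ 2)) /\
  \int[P]_w (X w + c) ^+ 2 = \int[P]_w X w ^+ 2 + 2 * c * \int[P]_w X w + c ^+ 2.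
Proof.
move=> mX iX2; have iX := square_integrable mX iX2.
have ic := integrable_prob_cst (c ^+ 2).
have iX' := integrableRZ (2 * c) iX.
have E : (fun w => (X w + c) ^+ 2) = (fun w => X w ^+ 2 + 2 * c * X w + cst (c ^+ 2) w).
  by apply/funext => w /=; ring.
rewrite E; split; first exact: integrableRD (integrableRD iX2 iX') ic.
rewrite RintegralD//; last exact: integrableRD iX2 iX'.
by rewrite RintegralD// RintegralZl// Rintegral_prob_cst.
Qed.

Lemma EFin_Rintegral (f : T -> R) : P.-integrable setT (EFin \o f) ->
  (\int[P]_w (f w)%:E)%E = (\int[P]_w f w)%:E.
Proof. by move=> jf; rewrite /Rintegral fineK//; exact: integrable_fin_num. Qed.

Lemma ge0_integrableR (f : T -> R) (c : R) : measurable_fun setT f ->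
  (forall w, 0 <= f w) -> (\int[P]_w (f w)%:E)%E = c%:E ->
  P.-integrable setT (EFin \o f) /\ \int[P]_w f w = c.
Proof.
move=> mf f0 fc; split; last by rewrite /Rintegral fc.
apply/integrableP; split; first exact/measurable_EFinP.
under eq_integral do rewrite /= ger0_norm//.
by rewrite fc ltry.
Qed.

Lemma measurable_natR Y : measurable_fun setT (fun w => (Y w)%:R : R).
Proof. exact: (@measurableT_comp _ _ _ _ _ _ (fun n : nat => n%:R : R)). Qed.

Section one_variable.
Variables (Y : {RV P >-> nat}) (mu v : R).
Hypothesis iY2 : P.-integrable setT (EFin \o (fun w => ((Y w)%:R : R) ^+ 2)).
Hypothesis EY : \int[P]_w (Y w)%:R = mu.
Hypothesis VY : \int[P]_w ((Y w)%:R - mu) ^+ 2 = v.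

Lemma integral_shift_sq (c : R) :
  P.-integrable setT (EFin \o (fun w => ((Y w)%:R + c) ^+ 2)) /\
  \int[P]_w ((Y w)%:R + c) ^+ 2 = (mu + c) ^+ 2 + v.
Proof.
have mY := measurable_natR Y.
have [i2 h2] := integrable_shift_sq c mY iY2.
have [_ h3] := integrable_shift_sq (- mu) mY iY2.
by split=> //; rewrite h2; move: h3; rewrite VY EY => ->; ring.
Qed.

Lemma nat_avg_id z n :
  iter z (nat_avg P Y) (fun i => (i%:R : R)%:E) n = (n%:R + z%:R * mu)%:E.
Proof.
have iY := square_integrable (measurable_natR Y) iY2.
elim: z n => [|z IH] n /=; first by rewrite mul0r addr0.
rewrite /nat_avg; under eq_integral do rewrite IH natrD.
have ic := integrable_prob_cst (n%:R + z%:R * mu).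
rewrite (_ : (fun w => _) = EFin \o
  (fun w => (Y w)%:R + cst (n%:R + z%:R * mu) w)); last first.
  by apply/funext => w /=; congr EFin; ring.
rewrite EFin_Rintegral; last exact: integrableRD iY ic.
by rewrite RintegralD// Rintegral_prob_cst EY; congr EFin; rewrite -natr1; ring.
Qed.

(** A sum of z independent copies of Y has mean z mu and variance z v. *)
Lemma nat_avg_sq z c n :
  iter z (nat_avg P Y) (fun i => ((i%:R - c) ^+ 2)%:E) n =
  ((n%:R + z%:R * mu - c) ^+ 2 + z%:R * v)%:E.
Proof.
elim: z n => [|z IH] n /=; first by rewrite !mul0r !addr0.
rewrite /nat_avg; under eq_integral do rewrite IH natrD.
have ic := integrable_prob_cst (z%:R * v).
have [i2 h2] := integral_shift_sq (n%:R + z%:R * mu - c).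
rewrite (_ : (fun w => _) = EFin \o (fun w =>
  ((Y w)%:R + (n%:R + z%:R * mu - c)) ^+ 2 + cst (z%:R * v) w)); last first.
  by apply/funext => w /=; congr EFin; ring.
rewrite EFin_Rintegral; last exact: integrableRD i2 ic.
by rewrite RintegralD// Rintegral_prob_cst h2; congr EFin; rewrite -natr1; ring.
Qed.

End one_variable.
End second_moments.

(** * Almost sure limits *)

Section real_limits.
Context d (T : measurableType d) (R : realType) (P : probability T R).

(** [limn] is a fixed value off the set of convergence. That set is measurable
    because convergence can be tested against the limit superior, as the limit is
    the only possible one. *)
Lemma measurable_limn_real (u_ : nat -> T -> R) :
  (forall n, measurable_fun setT (u_ n)) ->
  measurable_fun setT (fun w => limn (u_ ^~ w) : R).
Proof.
move=> mu.
pose g w : R := fine (limn_esup (fun n => (u_ n w)%:E)).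
have mg : measurable_fun setT g.
  apply: measurableT_comp => //; apply: measurable_fun_limn_esup => n.
  exact/measurable_EFinP.
pose h w := limn_esup (fun n => (`|u_ n w - g w|)%:E).
have mh : measurable_fun setT h.
  apply: measurable_fun_limn_esup => n; apply/measurable_EFinP.
  by apply: measurableT_comp => //; exact: measurable_funB.
have cvgE w : (h w <= 0)%E <-> cvgn (u_ ^~ w).
  split=> [hw|cw].
    have /fine_cvgP[_] : (fun n => (`|u_ n w - g w|)%:E) @ \oo --> 0%E.
      by apply: limn_esup_le_cvg => // n; rewrite lee_fin.
    move=> /= /norm_cvg0P /subr_cvg0 h0; apply/cvg_ex; exists (g w); exact: h0.
  have lE : (u_ n w)%:E @[n --> \oo] --> (limn (u_ ^~ w))%:E.
    by apply: cvg_EFin => //; exact: nearW.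
  have gE : g w = limn (u_ ^~ w) by rewrite /g (cvg_limn_einf_sup lE).2.
  have a0 : (`|u_ n w - g w|)%:E @[n --> \oo] --> 0%E.
    apply: cvg_EFin; first exact: nearW.
    by apply/norm_cvg0P/subr_cvg0; rewrite gE.
  by rewrite /h (cvg_limn_einf_sup a0).2.
have -> : (fun w => limn (u_ ^~ w) : R) = (fun w => if (h w <= 0)%E then g w else point).
  apply/funext => w; case: ifPn => [hw|/negP hw]; last by rewrite dvgP// -cvgE.
  have cw := (cvgE w).1 hw.
  have lE : (u_ n w)%:E @[n --> \oo] --> (limn (u_ ^~ w))%:E.
    by apply: cvg_EFin => //; exact: nearW.
  by rewrite /g (cvg_limn_einf_sup lE).2.
apply: measurable_fun_ifT => //.
exact: measurable_fun_lee.
Qed.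

(** The expected total variation is finite, hence so is the total variation
    itself, almost surely. *)
Lemma ae_cvg_summable_increments (u_ : nat -> T -> R) (b_ : nat -> R) (C : R) :
  (forall n, measurable_fun setT (u_ n)) ->
  (forall k, (\int[P]_w (`|u_ k.+1 w - u_ k w|)%:E <= (b_ k)%:E)%E) ->
  (forall n, \sum_(k < n) b_ k <= C) ->
  {ae P, forall w, cvgn (u_ ^~ w)}.
Proof.
move=> mu ub bC.
pose a k w := `|u_ k.+1 w - u_ k w|.
have ma k : measurable_fun setT (a k).
  by apply: measurableT_comp => //; exact: measurable_funB.
pose S w := (\sum_(0 <= k <oo) (a k w)%:E)%E.
have mS : measurable_fun setT S.
  apply: ge0_emeasurable_sum => k *; first by rewrite lee_fin normr_ge0.
  exact/measurable_EFinP.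
have S0 w : (0 <= S w)%E by apply: nneseries_ge0 => k _ _; rewrite lee_fin normr_ge0.
have intS : (\int[P]_w S w <= C%:E)%E.
  rewrite /S integral_nneseries; [|by []|by move=> n; exact/measurable_EFinP|
    by move=> n w _; rewrite lee_fin normr_ge0].
  apply: lime_le.
    apply: is_cvg_nneseries => n _ _; apply: integral_ge0 => w _.
    by rewrite lee_fin normr_ge0.
  apply: nearW => n; rewrite big_mkord; apply: (@le_trans _ _ (\sum_(k < n) (b_ k)%:E)%E).
    by apply: lee_sum => k _; exact: ub.
  by rewrite sumEFin lee_fin.
have iS : P.-integrable setT S.
  apply/integrableP; split=> //; under eq_integral do rewrite gee0_abs//.
  by rewrite (le_lt_trans intS)// ltry.
apply: filterS (integrable_ae measurableT iS) => w /(_ I) Sfin.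
(* A sequence is the sum of its increments, here an absolutely convergent
   series. *)
have -> : u_ ^~ w = (fun n => u_ 0%N w + series (telescope (u_ ^~ w)) n).
  by apply/funext => n; exact: eq_sum_telescope.
apply: is_cvgD; first exact: is_cvg_cst.
apply: normed_cvg; apply: nondecreasing_is_cvgn.
  by apply: nondecreasing_series => k _ _; exact: normr_ge0.
exists (fine (S w)) => _ [n _ <-].
rewrite -lee_fin fineK// /= /series/= -sumEFin.
apply: (le_trans _ (nneseries_lim_ge n _)); last by move=> k _ _; rewrite lee_fin normr_ge0.
by [].
Qed.

End real_limits.

Section nat_avg_avg.
Context d (T : measurableType d) (R : realType) (P : probability T R).

(** The two kinds of averages agree on functions of n that factor through the
    affine map n |-> x + a n. *)
Lemma iter_nat_avg_avg (Y : {RV P >-> nat}) (f : R -> R) (a x : R) z n :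
  bounded_cts f ->
  iter z (nat_avg P Y) (fun i => (f (x + a * i%:R))%:E) n =
  (iter z (avg P (fun w => a * (Y w)%:R)) f (x + a * n%:R))%:E.
Proof.
move=> bf; elim: z n => // z IH n /=.
have mY : measurable_fun setT (fun w => a * (Y w)%:R).
  by apply: measurable_funM => //; exact: measurable_natR.
rewrite /nat_avg /avg -EFin_Rintegral; last first.
  exact: (integrable_shift P _ mY (bounded_cts_iter_avg P z mY bf)).
apply: eq_integral => w _; rewrite IH; congr (iter z _ f _)%:E.
by rewrite natrD mulrDr addrA.
Qed.

Lemma cvg_Rintegral_bounded (u_ : nat -> T -> R) (u : T -> R) (B : set T) (C : R) :
  measurable B -> (forall n, measurable_fun setT (u_ n)) -> measurable_fun setT u ->
  (forall n w, `|u_ n w| <= C) ->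
  {ae P, forall w, u_ n w @[n --> \oo] --> u w} ->
  \int[P]_(w in B) u_ n w @[n --> \oo] --> \int[P]_(w in B) u w.
Proof.
move=> mB mu_ mu uC uu.
have [|||||iu _] // := @dominated_convergence _ T R P B mB
  (fun n w => (u_ n w)%:E) (fun w => (u w)%:E) (cst C%:E).
- by move=> n; apply/measurable_EFinP; exact: measurable_funTS.
- by apply/measurable_EFinP; exact: measurable_funTS.
- by apply: filterS uu => w uw _; apply: cvg_EFin => //; exact: nearW.
- apply: (integrableS measurableT) => //.
  by apply: (@integrable_bounded _ _ _ _ (cst C) `|C|).
- by apply: aeW => w n _ /=; rewrite lee_fin.
move=> h; rewrite /Rintegral; apply: fine_cvg; rewrite fineK//.
exact: integrable_fin_num.
Qed.

End nat_avg_avg.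

(** * Stopped sigma-algebras *)

Section stopping.
Context d (T : measurableType d) (R : realType).
Variable F : nat -> set (set T).
Hypothesis sF : forall k, sigma_algebra setT (F k).
Hypothesis F_nd : forall k l, (k <= l)%N -> F k `<=` F l.
Hypothesis F_meas : forall k, F k `<=` measurable.
Variable tau : T -> nat.
Hypothesis htau : stopping_time F tau.

Local Notation G := (stopped_sigma_algebra F tau).

Lemma sigma_algebra_setD (H : set (set T)) A B : sigma_algebra setT H ->
  H A -> H B -> H (A `\` B).
Proof.
move=> sH HA HB; rewrite -(sigma_algebra_id sH) in HA HB *.
exact: (@measurableD _ (g_sigma_algebraType H) _ _ HA HB).
Qed.

Lemma sigma_algebra_setI (H : set (set T)) A B : sigma_algebra setT H ->
  H A -> H B -> H (A `&` B).
Proof.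
move=> sH HA HB; rewrite -(sigma_algebra_id sH) in HA HB *.
exact: (@measurableI _ (g_sigma_algebraType H) _ _ HA HB).
Qed.

Lemma stopped_sigma_algebraP : sigma_algebra setT G.
Proof.
split.
- split=> // k; rewrite set0I; by have [] := sF k.
- move=> A [mA hA]; split; first by rewrite setTD; exact: measurableC.
  move=> k; rewrite (_ : _ `&` _ =
      [set w | (tau w <= k)%N] `\` (A `&` [set w | (tau w <= k)%N])).
    by apply: sigma_algebra_setD => //; exact: htau.
  apply/seteqP; split => w /=; first by move=> [[_ nA] tk]; split => // -[].
  by move=> [tk nA]; split => //; split => // Aw; apply: nA.
- move=> A hA; split; first by apply: bigcupT_measurable => n; exact: (hA n).1.
  move=> k; rewrite setI_bigcupl; have [_ _ sU] := sF k.
  by apply: sU => n; exact: (hA n).2.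
Qed.

Lemma stopping_time_eq k : F k [set w | tau w = k].
Proof.
case: k => [|k].
  rewrite (_ : [set w | _] = [set w | (tau w <= 0)%N]); first exact: htau.
  by apply/seteqP; split => w /=; [move=> ->|rewrite leqn0 => /eqP].
rewrite (_ : [set w | _] = [set w | (tau w <= k.+1)%N] `\` [set w | (tau w <= k)%N]).
  apply: (sigma_algebra_setD (sF k.+1)); first exact: htau.
  by apply: (F_nd (leqnSn k)); exact: htau.
apply/seteqP; split => w /=; first by move=> ->; rewrite ltnn.
by move=> [tk /negP]; rewrite -ltnNge => kt; apply/eqP; rewrite eqn_leq tk.
Qed.

Lemma stopped_fiber k B : F k B -> G ([set w | tau w = k] `&` B).
Proof.
move=> FB; have FkB : F k ([set w | tau w = k] `&` B).
  by apply: (sigma_algebra_setI (sF k)) => //; exact: stopping_time_eq.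
split; first exact: F_meas FkB.
move=> l; have [kl|lk] := leqP k l.
  rewrite (_ : _ `&` _ = [set w | tau w = k] `&` B); first exact: F_nd FkB.
  by apply/seteqP; split => w /=; [move=> [? _]|move=> [tk Bw]; rewrite tk].
rewrite (_ : _ `&` _ = set0); first by have [] := sF l.
by apply/seteqP; split => // w /= [[tk _]]; rewrite tk leqNgt lk.
Qed.

Lemma stopped_fiber_sub k A : G A -> A `<=` [set w | tau w = k] -> F k A.
Proof.
move=> [_ hA] Ak; rewrite (_ : A = A `&` [set w | (tau w <= k)%N]); first exact: hA.
by apply/seteqP; split => w //=; [move=> Aw; split => //; rewrite (Ak _ Aw)|move=> []].
Qed.

Variable Q : R.-pker (g_sigma_algebraType G) ~> (measurableTypeR R).

Lemma kernel_preimage (B : set (measurableTypeR R)) (U : set \bar R) :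
  measurable B -> measurable U -> G [set w | U (Q w B)].
Proof.
move=> mB mU.
have GE A : <<s G >> A -> G A by rewrite (sigma_algebra_id stopped_sigma_algebraP).
by apply: GE; have := measurable_kernel Q B mB measurableT U mU; rewrite setTI.
Qed.

Lemma measurable_kernel_stopped (B : set (measurableTypeR R)) :
  measurable B -> measurable_fun (setT : set T) (fun w => Q w B).
Proof.
move=> mB _ U mU; rewrite setTI; exact: (kernel_preimage mB mU).1.
Qed.

End stopping.

Section stopped_comparison.
Context d (T : measurableType d) (R : realType) (P : probability T R).

Lemma null_superlevel (A : set T) (g : T -> R) (t : R) : measurable A ->
  measurable_fun setT g -> (forall w, 0 <= g w <= 1) ->
  (forall w, A w -> t < g w) ->
  (\int[P]_(w in A) (g w)%:E <= (fine (P A) * t)%:E)%E -> P A = 0%E.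
Proof.
move=> mA mg g01 gt gle.
have ig : P.-integrable setT (EFin \o g).
  apply: (@integrable_bounded _ _ _ _ _ 1) => // w.
  by have /andP[h0 h1] := g01 w; rewrite ger0_norm.
have igA := integrableS measurableT mA (@subsetT _ _) ig.
have ict := integrableS measurableT mA (@subsetT _ _) (integrable_prob_cst P t).
have idf := integrableB mA igA ict.
have If : (\int[P]_(w in A) ((g w)%:E - t%:E) = 0)%E.
  apply/eqP; rewrite eq_le; apply/andP; split; last first.
    by apply: integral_ge0 => w Aw; rewrite -EFinB lee_fin subr_ge0 ltW// gt.
  have E : (\int[P]_(w in A) t%:E = (fine (P A) * t)%:E)%E.
    by rewrite integral_cst// EFinM fineK ?fin_num_measure// muleC.
  by rewrite (integralB mA igA ict)/= E leeBlDr// add0e.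
have : (\int[P]_(w in A) `|((g w)%:E - t%:E)| = 0)%E.
  rewrite -[RHS]If; apply: eq_integral => w /[!inE] Aw.
  by rewrite gee0_abs// -EFinB lee_fin subr_ge0 ltW// gt.
move/(ae_eq_integral_abs P mA (measurable_int P idf)) => [Z [mZ Z0 sZ]].
apply/eqP; rewrite eq_le measure_ge0 andbT -Z0 le_measure ?inE//.
move=> w Aw; apply: sZ => /= /(_ Aw) /eqP.
by rewrite -EFinB eqe subr_eq0 gt_eqF// gt.
Qed.

End stopped_comparison.

(** * Independence of the future offspring *)

Section galton_watson_process.
Context d (T : measurableType d) (R : realType) (P : probability T R).
Variables (xi : nat -> nat -> {RV P >-> nat}) (N : nat -> {RV P >-> nat}).
Hypothesis hind : mutually_independent P
  (fun ni : nat * nat => xi ni.1 ni.2 : T -> nat).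
Hypothesis hid : forall n i (B : set nat),
  distribution P (xi n i) B = distribution P (xi 0%N 0%N) B.
Hypothesis N0 : forall w, N 0%N w = 1%N.
Hypothesis NS : forall n w, N n.+1 w = (\sum_(i < N n w) xi n i w)%N.

Local Notation F := (natural_filtration (fun n => N n : T -> nat)).

Local Notation xij j := (xi j.1 j.2 : T -> nat).

(** The lexicographic order on pairs (generation, individual). *)
Definition not_before (k i : nat) (j : nat * nat) : bool :=
  (k < j.1)%N || ((j.1 == k) && (i <= j.2)%N).

(** Independence of B from the offspring numbers of all individuals from (k, i)
    on, tested on finite families of events as in [mutually_independent]. *)
Definition future_indep (k i : nat) (B : set T) : Prop := measurable B /\
  forall (J : seq (nat * nat)) (A : nat * nat -> set nat), uniq J ->
    (forall j, j \in J -> not_before k i j) ->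
    P (B `&` \bigcap_(j in [set` J]) (xij j @^-1` A j)) =
    (P B * \prod_(j <- J) P (xij j @^-1` A j))%E.

Lemma future_indep_setT k i : future_indep k i setT.
Proof.
split=> // J A uJ _; rewrite setTI [X in (X * _)%E]probability_setT mul1e.
exact: hind.
Qed.

Lemma future_indepS k z B : future_indep k z B -> future_indep k.+1 0 B.
Proof.
move=> [mB h]; split=> // J A uJ hJ; apply: h => // j /hJ.
by rewrite /not_before => /orP[kj|/andP[/eqP -> _]]; rewrite ?ltnS ?leqnn ?(ltnW kj).
Qed.

(** Adding the factor (k, i) to the family of events moves it from the future to
    the past. *)
Lemma future_indep_next k i B S : future_indep k i B ->
  future_indep k i.+1 (B `&` (xi k i : T -> nat) @^-1` S) /\
  P (B `&` (xi k i : T -> nat) @^-1` S) =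
    (P B * P ((xi k i : T -> nat) @^-1` S))%E.
Proof.
move=> [mB h].
have PBS : P (B `&` (xi k i : T -> nat) @^-1` S) =
    (P B * P ((xi k i : T -> nat) @^-1` S))%E.
  have := h [:: (k, i)] (fun=> S) isT.
  rewrite big_seq1 /= => <-; last first.
    by move=> j; rewrite inE => /eqP ->; rewrite /not_before/= eqxx leqnn orbT.
  congr (P (_ `&` _)); apply/seteqP; split => w /=.
    by move=> Sw j /=; rewrite inE => /eqP ->.
  by move=> /(_ (k, i)); apply; rewrite /= inE.
split=> //; split; first by apply: measurableI => //; exact: measurable_preim_nat.
move=> J A uJ hJ.
have kiJ : (k, i) \notin J.
  by apply/negP => /hJ; rewrite /not_before/= !ltnn andbF.
pose A' j := if j == (k, i) then S else A j.
have EA' j : j \in J -> A' j = A j.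
  by move=> jJ; rewrite /A'; case: eqP => // jE; rewrite -jE jJ in kiJ.
have := h ((k, i) :: J) A'; rewrite /= kiJ uJ => /(_ isT) H.
rewrite PBS -muleA.
have -> : B `&` (xi k i : T -> nat) @^-1` S `&`
    \bigcap_(j in [set` J]) (xij j @^-1` A j) =
  B `&` \bigcap_(j in [set` (k, i) :: J]) (xij j @^-1` A' j).
  rewrite -setIA; congr (_ `&` _); apply/seteqP; split => w /=.
    move=> [Sw Jw] j /=; rewrite inE => /orP[/eqP ->|jJ].
      by rewrite /A' eqxx.
    by rewrite EA'//; exact: Jw.
  move=> H'; split.
    by have := H' (k, i); rewrite /A' eqxx; apply; rewrite /= mem_head.
  by move=> j /= jJ; have := H' j; rewrite EA'//; apply; rewrite /= inE jJ orbT.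
rewrite H; last first.
  move=> j; rewrite inE => /orP[/eqP ->|/hJ]; rewrite /not_before/= ?eqxx ?leqnn ?orbT//.
  by move=> /orP[->//|/andP[-> /ltnW ->]]; rewrite orbT.
rewrite big_cons {1}/A' eqxx; congr (_ * (_ * _))%E.
by apply: eq_big_seq => j jJ; rewrite EA'.
Qed.

Lemma prod_prob_fin_num (J : seq (nat * nat)) (A : nat * nat -> set nat) :
  (\prod_(j <- J) P (xij j @^-1` A j))%E \is a fin_num.
Proof.
apply: (big_ind (fun x : \bar R => x \is a fin_num)) => //.
- by move=> x y; exact: fin_numM.
- by move=> j _; apply: fin_num_measure; exact: measurable_preim_nat.
Qed.

Lemma future_indep_bigcup k i (B_ : nat -> set T) : trivIset setT B_ ->
  (forall n, future_indep k i (B_ n)) -> future_indep k i (\bigcup_n B_ n).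
Proof.
move=> tB hB; have mB n := (hB n).1.
split; first exact: bigcup_measurable.
move=> J A uJ hJ; rewrite setI_bigcupl.
set C := \bigcap_(_ in _) _; set c := (\prod_(j <- J) _)%E.
have mC : measurable C.
  rewrite /C bigcap_seq; apply: big_ind => //; first exact: measurableI.
  by move=> j _; exact: measurable_preim_nat.
rewrite measure_bigcup//; last 2 first.
- by move=> n _; exact: measurableI.
- by apply/trivIset_setIr.
rewrite measure_bigcup//.
have cfin : c \is a fin_num by exact: prod_prob_fin_num.
rewrite -(fineK cfin) muleC -nneseriesZl//.
apply: eq_eseriesr => n _; rewrite (fineK cfin) muleC.
exact: (hB n).2.
Qed.

Lemma future_indep_split k i (Y : T -> nat) B :
  (forall n, future_indep k i (B `&` Y @^-1` [set n])) -> future_indep k i B.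
Proof.
move=> h; rewrite (setI_preim_bigcup Y B); apply: future_indep_bigcup => //.
exact: trivIset_preim.
Qed.

(** The first z individuals of generation k are added one by one; the value c of
    the partial sum must be fixed before the next offspring number is
    constrained. *)
Lemma future_indep_sum k B z y : future_indep k 0 B ->
  future_indep k z (B `&` [set w | (\sum_(i < z) xi k i w)%N = y]).
Proof.
move=> hB; elim: z y => [|z IH] y.
  have [->|y0] := eqVneq y 0%N.
    rewrite (_ : [set w | _] = setT) ?setIT//.
    by apply/seteqP; split => // w _ /=; rewrite big_ord0.
  rewrite (_ : B `&` _ = set0).
    split=> // J A uJ _; rewrite set0I measure0 mul0e//.
  apply/seteqP; split => // w [_ /=]; rewrite big_ord0 => /eqP.
  by rewrite eq_sym (negbTE y0).
apply: (@future_indep_split _ _ (fun w => (\sum_(i < z) xi k i w)%N)) => c.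
rewrite (_ : _ `&` _ = (B `&` [set w | (\sum_(i < z) xi k i w)%N = c]) `&`
  (xi k z : T -> nat) @^-1` [set t | (c + t)%N = y]).
  by have [] := future_indep_next [set t | (c + t)%N = y] (IH c).
apply/seteqP; split => w /=; rewrite big_ord_recr/=.
  by move=> [[Bw <-] <-].
by move=> [[Bw <-] <-].
Qed.

Lemma natural_filtration_sigma k : sigma_algebra setT (F k).
Proof. exact: smallest_sigma_algebra. Qed.

Lemma natural_filtration_preim k i (B : set nat) : (i <= k)%N ->
  F k ((N i : T -> nat) @^-1` B).
Proof.
move=> ik; apply: sub_sigma_algebra; exists i => //=.
by exists B => //; rewrite setTI.
Qed.

Lemma natural_filtration_sub k l : (k <= l)%N -> F k `<=` F l.
Proof.
move=> kl; apply: sub_sigma_algebra2 => A [i /= ik Ai].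
by exists i => //=; exact: leq_trans ik _.
Qed.

(** Once N_(k+1) is known, an event of F_(k+1) only depends on the previous
    generations. *)
Lemma natural_filtration_local k A z : F k.+1 A ->
  exists2 A', F k A' & A `&` (N k.+1 : T -> nat) @^-1` [set z] =
    A' `&` (N k.+1 : T -> nat) @^-1` [set z].
Proof.
suff : F k.+1 `<=` [set A | forall z, exists2 A', F k A' &
    A `&` (N k.+1 : T -> nat) @^-1` [set z] =
    A' `&` (N k.+1 : T -> nat) @^-1` [set z]] by move=> h /h.
apply: smallest_sub => {A z}.
- have [s0 sC sU] := natural_filtration_sigma k.
  split.
  + by move=> z; exists set0 => //.
  + move=> A hA z; have [A' FA' E] := hA z; exists (setT `\` A'); first exact: sC.
    rewrite !setTD; apply/seteqP; split => w [nA zw]; split => // Aw; apply: nA.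
      by have : (A' `&` (N k.+1 : T -> nat) @^-1` [set z]) w by []; rewrite -E => -[].
    by have : (A `&` (N k.+1 : T -> nat) @^-1` [set z]) w by []; rewrite E => -[].
  + move=> A hA z.
    have /choice[A' hA'] : forall n, exists A', F k A' /\
      A n `&` (N k.+1 : T -> nat) @^-1` [set z] = A' `&` (N k.+1 : T -> nat) @^-1` [set z].
      by move=> n; have [A' ? ?] := hA n z; exists A'.
    exists (\bigcup_n A' n); first by apply: sU => n; exact: (hA' n).1.
    by rewrite !setI_bigcupl; apply: eq_bigcupr => n _; exact: (hA' n).2.
- move=> A [i /= ik [B _ <-]] z; rewrite setTI.
  move: ik; rewrite ltnS leq_eqVlt => /predU1P[->|ik].
    have [Bz|Bz] := pselect (B z).
      exists setT.
        by rewrite -(setD0 setT); have [s0 sC _] := natural_filtration_sigma k; exact: sC.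
      by rewrite setTI; apply/seteqP; split => w /=; [move=> [_ ->]|move=> ->].
    exists set0; first by have [] := natural_filtration_sigma k.
    by rewrite set0I; apply/seteqP; split => // w /= [+ zw]; rewrite zw.
  exists ((N i : T -> nat) @^-1` B) => //.
  exact: natural_filtration_preim.
Qed.

(** Induction on k. Where N_k = y and N_(k+1) = z, an event of F_(k+1) is an event
    of F_k intersected with the condition that the first y offspring numbers of
    generation k add up to z. *)
Lemma natural_filtration_future k : F k `<=` future_indep k 0.
Proof.
elim: k => [|k IH] A FA.
  have : A = set0 \/ A = setT.
    suff : F 0%N `<=` [set A | A = set0 \/ A = setT] by apply.
    apply: smallest_sub => {A FA}.
    - split; first by left.
      + by move=> A [->|->]; [right; rewrite setD0|left; rewrite setDv].
      + move=> A hA.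
        have [[n An]|nA] := pselect (exists n, A n = setT).
          by right; apply/seteqP; split => // w _; exists n => //; rewrite An.
        left; apply/seteqP; split => // w [n _]; have [->//|An] := hA n.
        by exfalso; apply: nA; exists n.
    - move=> A [i /=]; rewrite ltnS leqn0 => /eqP -> [B _ <-]; rewrite setTI.
      have [B1|B1] := pselect (B 1%N).
        by right; apply/seteqP; split => // w _ /=; rewrite N0.
      by left; apply/seteqP; split => // w /=; rewrite N0.
  move=> [->|->]; last exact: future_indep_setT.
  by split=> // J B uJ _; rewrite set0I measure0 mul0e.
apply: (@future_indep_split _ _ (N k.+1)) => z.
have [A' FA' ->] := natural_filtration_local z FA.
apply: (@future_indep_split _ _ (N k)) => y.
rewrite (_ : _ `&` _ = (A' `&` (N k : T -> nat) @^-1` [set y]) `&`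
  [set w | (\sum_(i < y) xi k i w)%N = z]).
  apply: (@future_indepS _ y); apply: future_indep_sum; apply: IH.
  have [s0 sC sU] := natural_filtration_sigma k.
  have mk : F k ((N k : T -> nat) @^-1` [set y]) by exact: natural_filtration_preim.
  exact: (@measurableI _ (g_sigma_algebraType _) _ _ FA' mk).
apply/seteqP; split => w /=; first by move=> [[Aw <-] <-]; rewrite NS.
by move=> [[Aw <-] <-]; rewrite NS.
Qed.

Lemma natural_filtration_measurable k A : F k A -> measurable A.
Proof. by move=> /natural_filtration_future[]. Qed.

Lemma natural_filtrationI k A B : F k A -> F k B -> F k (A `&` B).
Proof. by move=> FA FB; exact: (@measurableI _ (g_sigma_algebraType _) _ _ FA FB). Qed.

Let mF k B : F k B -> measurable B := @natural_filtration_measurable k B.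

(** * The branching property *)

Section branching.

Local Open Scope ereal_scope.
Implicit Types g : nat -> \bar R.

Lemma measurable_offspring_sum k i z :
  measurable_fun setT (fun w => (\sum_(j < z) xi k (i + j) w)%N).
Proof.
elim: z => [|z IH].
  by apply: (eq_measurable_fun (cst 0%N)) => // w _; rewrite big_ord0.
apply: (eq_measurable_fun (fun w => (\sum_(j < z) xi k (i + j) w + xi k (i + z) w)%N)).
  by move=> w _; rewrite big_ord_recr.
exact: measurable_fun_addn.
Qed.

(** The offspring numbers are integrated out one at a time, by splitting B
    according to the value c of the first of them: B and that event are
    independent, and their intersection is still independent of the others. *)
Lemma integral_offspring_sum k i B z g n : (forall j, 0 <= g j) ->
  future_indep k i B ->
  \int[P]_(w in B) g (n + \sum_(j < z) xi k (i + j) w)%N =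
  P B * iter z (nat_avg P (xi 0%N 0%N)) g n.
Proof.
move=> g0; elim: z i B n => [|z IH] i B n hB; have mB := hB.1.
  under eq_integral do rewrite big_ord0 addn0.
  by rewrite integral_cst// muleC.
have mg m (C : set T) : measurable C ->
    measurable_fun C (fun w => g (m + \sum_(j < z) xi k (i.+1 + j) w)%N).
  move=> mC; apply: measurable_funTS.
  apply: (@measurableT_comp _ _ _ _ _ _ (fun y => g (m + y)%N)) => //.
  exact: measurable_offspring_sum.
have Esum w : (\sum_(j < z.+1) xi k (i + j) w =
    xi k i w + \sum_(j < z) xi k (i.+1 + j) w)%N.
  rewrite big_ord_recl/= addn0; congr (_ + _)%N.
  by apply: eq_bigr => j _; rewrite /bump/= add1n addSnnS.
under eq_integral do rewrite Esum.
rewrite (integral_nat_split (xi k i))//; last first.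
  apply: measurable_funTS.
  apply: (@measurableT_comp _ _ _ _ _ _ (fun y => g (n + y)%N)) => //.
  by apply: measurable_fun_addn => //; exact: measurable_offspring_sum.
set G := iter z (nat_avg P (xi 0%N 0%N)) g in IH *.
have PBfin : P B \is a fin_num by exact: fin_num_measure.
rewrite iterS -/G /nat_avg (integral_nat_split (xi 0%N 0%N))//; last 2 first.
- exact: measurable_nat_fun.
- by move=> w _; exact: iter_nat_avg_ge0.
rewrite -(fineK PBfin) -nneseriesZl; last first.
  by move=> c _; apply: integral_ge0 => w _; exact: iter_nat_avg_ge0.
apply: eq_eseriesr => c _.
have [hBc PBc] := future_indep_next [set c] hB.
rewrite (@eq_integral _ _ _ _ _
  (fun w => g (n + c + \sum_(j < z) xi k (i.+1 + j) w)%N)); last first.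
  by move=> w /[!inE] -[_ /= ->]; rewrite addnA.
rewrite IH// PBc (fineK PBfin) -muleA; congr (_ * _).
rewrite (@eq_integral _ _ _ _ _ (cst (G (n + c)%N))); last first.
  by move=> w /[!inE] -[_ /= ->].
rewrite setTI integral_cst; last exact: measurable_preim_nat.
by rewrite muleC; congr (_ * _); exact: hid.
Qed.

Lemma integral_next_generation k B z g : (forall j, 0 <= g j) ->
  F k B -> B `<=` [set w | N k w = z] ->
  \int[P]_(w in B) g (N k.+1 w) = P B * iter z (nat_avg P (xi 0%N 0%N)) g 0%N.
Proof.
move=> g0 FB Bz.
rewrite -(@integral_offspring_sum k 0 B z g 0)//; last first.
  exact: natural_filtration_future FB.
by apply: eq_integral => w /[!inE] /Bz /= Nz; rewrite NS Nz add0n.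
Qed.

Lemma first_generation w : N 1%N w = xi 0%N 0%N w.
Proof. by rewrite NS N0 big_ord1. Qed.

Lemma filtration_fiber k B z : F k B -> F k (B `&` (N k : T -> nat) @^-1` [set z]).
Proof.
by move=> FB; apply: natural_filtrationI => //; exact: natural_filtration_preim.
Qed.

Lemma integral_fiberwise k B (f : T -> \bar R) (h : nat -> \bar R) :
  F k B -> measurable_fun setT f -> (forall w, 0 <= f w) -> (forall i, 0 <= h i) ->
  (forall z, \int[P]_(w in B `&` (N k : T -> nat) @^-1` [set z]) f w =
     P (B `&` (N k : T -> nat) @^-1` [set z]) * h z) ->
  \int[P]_(w in B) f w = \int[P]_(w in B) h (N k w).
Proof.
move=> FB mf f0 h0 H; have mB := mF FB.
rewrite (integral_nat_split (N k))//; last exact: measurable_funTS.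
rewrite [RHS](integral_nat_split (N k))//; last first.
  exact: (@measurable_nat_fun _ _ _ _ B (N k) h 0 mB).
apply: eq_eseriesr => z _; rewrite H.
rewrite (@eq_integral _ _ _ _ _ (cst (h z))); last by move=> w /[!inE] -[_ /= ->].
rewrite integral_cst; first exact: muleC.
by apply: measurableI => //; exact: measurable_preim_nat.
Qed.

(** Each of the z individuals of generation k founds an independent copy of the
    process. The induction is on the number j of generations ahead, conditioning
    on generation k + 1: with U and V the averaging operators of N_j and N_(j+1),
    and G h y = U^y h 0, it amounts to the identity
    (xi-average of G h) = G (V h), where V is the average of U^xi since the first
    generation has xi individuals. *)
Theorem branching_property j k B z g : (forall i, 0 <= g i) ->
  F k B -> B `<=` [set w | N k w = z] ->
  \int[P]_(w in B) g (N (k + j)%N w) = P B * iter z (nat_avg P (N j)) g 0%N.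
Proof.
have FT k' : F k' setT by rewrite -(setD0 setT); have [s0 sC _] := natural_filtration_sigma k'; exact: sC.
have mgN g' k' : measurable_fun setT (fun w => g' (N k' w)).
  by exact: (@measurable_nat_fun _ _ _ _ setT (N k') g' 0 measurableT).
elim: j k B z g => [|j IH] k B z g g0 FB Bz.
  rewrite addn0; transitivity (\int[P]_(w in B) cst (g z) w).
    by apply: eq_integral => w /[!inE] /Bz ->.
  rewrite integral_cst; last exact: mF FB.
  rewrite muleC; congr (_ * _).
  have nop0 g' n : nat_avg P (N 0%N) g' n = g' n.+1.
    rewrite /nat_avg; transitivity (\int[P]_w cst (g' n.+1) w).
      by apply: eq_integral => w _; rewrite N0 addn1.
    by rewrite integral_cst// [X in _ * X]probability_setT mule1.
  have -> : forall n, iter z (nat_avg P (N 0%N)) g n = g (n + z)%N; last by [].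
  by elim: z {Bz} => [|z IHz] n /=; rewrite ?addn0// nop0 IHz addSnnS.
set U := nat_avg P (N j) in IH *.
pose G h y := iter y U h 0%N.
have G0 h y : (forall i, 0 <= h i) -> 0 <= G h y.
  by move=> h0; exact: iter_nat_avg_ge0.
have step k' B' h : (forall i, 0 <= h i) -> F k' B' ->
    \int[P]_(w in B') h (N (k' + j)%N w) = \int[P]_(w in B') G h (N k' w).
  move=> h0 FB'; apply: (@integral_fiberwise k') => //.
    by move=> i; exact: G0.
  by move=> y; apply: IH; [exact: h0|exact: filtration_fiber|move=> w []].
rewrite addnS -addSn step//; last exact: natural_filtration_sub FB.
set V := nat_avg P (N j.+1).
rewrite (integral_next_generation (fun y => G0 g y g0) FB Bz); congr (_ * _).
set xi0 := nat_avg P (xi 0%N 0%N).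
have GV h : (forall i, 0 <= h i) -> xi0 (G h) = G (V h).
  move=> h0; apply/funext => n; rewrite /G.
  (* The operators U and V commute, so V acts on U^n h, where it can be computed
     by conditioning on the first generation. *)
  rewrite /V -iter_nat_avg_comm// [RHS]/nat_avg.
  set h' := iter n U h.
  have h'0 i : 0 <= h' i by exact: iter_nat_avg_ge0.
  transitivity (\int[P]_w (fun m => h' (0 + m)%N) (N (1 + j)%N w)); last by [].
  rewrite step//= /xi0 /nat_avg; apply: eq_integral => w _.
  by rewrite first_generation /G addnC iterD.
have GVz h : (forall i, 0 <= h i) -> iter z xi0 (G h) = G (iter z V h).
  move=> h0; elim: z {Bz} => //= z ->; apply: GV => i; exact: iter_nat_avg_ge0.
by rewrite GVz.
Qed.

Lemma tower j k B g : (forall i, 0 <= g i) -> F k B ->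
  \int[P]_(w in B) g (N (k + j)%N w) =
  \int[P]_(w in B) iter (N k w) (nat_avg P (N j)) g 0%N.
Proof.
move=> g0 FB; apply: (@integral_fiberwise k B _
    (fun y => iter y (nat_avg P (N j)) g 0%N)) => //.
- exact: (@measurable_nat_fun _ _ _ _ setT (N (k + j)%N) g 0 measurableT).
- by move=> i; exact: iter_nat_avg_ge0.
- move=> z; apply: branching_property => //; exact: filtration_fiber.
Qed.

End branching.

(** * Moments of the generations *)

Variables (m v : R).
Hypothesis m1 : 1 < m.
Hypothesis v0 : 0 < v.
Hypothesis iN1 : P.-integrable setT (EFin \o (fun w => ((N 1%N w)%:R : R) ^+ 2)).
Hypothesis EN1 : \int[P]_w (N 1%N w)%:R = m.
Hypothesis VN1 : \int[P]_w ((N 1%N w)%:R - m) ^+ 2 = v.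

Local Notation M k w := ((N k w)%:R / m ^+ k : R).

Local Notation W := (gw_limit m (fun n => N n : T -> nat)).

Let m0 : 0 < m. Proof. exact: lt_trans m1. Qed.
Let mk0 k : 0 < m ^+ k. Proof. by rewrite exprn_gt0. Qed.

Lemma filtration_setT k : F k setT.
Proof.
by rewrite -(setD0 setT); have [s0 sC _] := natural_filtration_sigma k; exact: sC.
Qed.

(** Variance of N_j / m^j. The recursion conditions on the first generation, which
    contributes v / m^2, while the averages of its descendants contribute the
    variance of N_(j-1) / m^(j-1) divided by m. *)
Fixpoint gw_var (j : nat) : R :=
  if j is j'.+1 then v / m ^+ 2 + gw_var j' / m else 0.

Lemma gw_moments j :
  [/\ P.-integrable setT (EFin \o (fun w => ((N j w)%:R : R) ^+ 2)),
      \int[P]_w (N j w)%:R = m ^+ j &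
      \int[P]_w ((N j w)%:R - m ^+ j) ^+ 2 = m ^+ j ^+ 2 * gw_var j].
Proof.
elim: j => [|j [iNj ENj VNj]].
  have E : (fun w => (N 0%N w)%:R : R) = cst 1 by apply/funext => w; rewrite N0.
  split.
  - rewrite (_ : (fun w => _) = cst 1); first exact: integrable_prob_cst.
    by apply/funext => w; rewrite N0 expr1n.
  - by rewrite E expr0 Rintegral_prob_cst.
  - under eq_Rintegral do rewrite N0 expr0 subrr expr0n/=.
    by rewrite Rintegral_prob_cst mulr0.
have mN k := measurable_natR (N k).
have FT := @filtration_setT 1%N.
have iN1' := square_integrable (mN 1%N) iN1.
have [iM EM] : P.-integrable setT (EFin \o (fun w => (N j.+1 w)%:R : R)) /\
    \int[P]_w (N j.+1 w)%:R = m ^+ j.+1.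
  apply: ge0_integrableR => //.
  have g0 i : (0 <= (i%:R : R)%:E)%E by rewrite lee_fin.
  have := tower j g0 FT; rewrite add1n => ->.
  under eq_integral do rewrite (nat_avg_id iNj ENj) add0r mulrC.
  by rewrite EFin_Rintegral ?RintegralZl// ?EN1 ?exprSr//; exact: integrableRZ.
have [iQ EQ] : P.-integrable setT (EFin \o (fun w => ((N j.+1 w)%:R - m ^+ j.+1) ^+ 2)) /\
    \int[P]_w ((N j.+1 w)%:R - m ^+ j.+1) ^+ 2 = m ^+ j.+1 ^+ 2 * gw_var j.+1.
  apply: ge0_integrableR => //.
  - by apply: measurable_funX; exact: measurable_funB.
  - by move=> w; exact: sqr_ge0.
  have g0 i : (0 <= (((i%:R : R) - m ^+ j.+1) ^+ 2)%:E)%E by rewrite lee_fin sqr_ge0.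
  have := tower j g0 FT; rewrite add1n => ->.
  under eq_integral do rewrite (nat_avg_sq iNj ENj VNj) add0r.
  have [i2 h2] := integral_shift_sq iN1 EN1 VN1 (- m).
  have i2' := integrableRZ (m ^+ j ^+ 2) i2.
  have i1' := integrableRZ (m ^+ j ^+ 2 * gw_var j) iN1'.
  rewrite (_ : (fun w => _) = EFin \o (fun w =>
    m ^+ j ^+ 2 * ((N 1%N w)%:R - m) ^+ 2 +
    m ^+ j ^+ 2 * gw_var j * (N 1%N w)%:R)); last first.
    by apply/funext => w /=; congr EFin; rewrite [m ^+ j.+1]exprS; ring.
  rewrite EFin_Rintegral; last exact: integrableRD i2' i1'.
  rewrite RintegralD// !RintegralZl// VN1 EN1 /= [m ^+ j.+1]exprS; congr EFin.
  by field; rewrite gt_eqF.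
split=> //.
have mM : measurable_fun setT (fun w => (N j.+1 w)%:R - m ^+ j.+1) by exact: measurable_funB.
have [+ _] := integrable_shift_sq (m ^+ j.+1) mM iQ.
by under eq_fun do rewrite subrK.
Qed.

Lemma gw_var_ge0 j : 0 <= gw_var j.
Proof.
elim: j => //= j IH; rewrite addr_ge0// divr_ge0// ?exprn_ge0// ltW//.
Qed.

Lemma gw_var_ub j : gw_var j <= v / (m * (m - 1)).
Proof.
have m10 : 0 < m - 1 by rewrite subr_gt0.
elim: j => [|j IH] /=; first by rewrite divr_ge0 ?(ltW v0)// mulr_ge0// ltW.
have -> : v / (m * (m - 1)) = v / m ^+ 2 + v / (m * (m - 1)) / m.
  by field; rewrite !gt_eqF.
by rewrite lerD2l ler_pM2r// invr_gt0.
Qed.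

Lemma gw_var_lb j : v / m ^+ 2 <= gw_var j.+1.
Proof. by rewrite /= lerDl divr_ge0 ?gw_var_ge0// ltW. Qed.

(** Given N_k = z, the difference N_(k+j) - m^j z is a centred sum of z
    independent terms of variance m^(2j) times [gw_var j]; then E N_k = m^k. *)
Lemma gw_increment_sq k j :
  (\int[P]_w (((N (k + j)%N w)%:R / m ^+ (k + j) - (N k w)%:R / m ^+ k) ^+ 2)%:E)%E =
  (gw_var j / m ^+ k)%:E.
Proof.
have [iNj ENj VNj] := gw_moments j.
have [iNk ENk _] := gw_moments k.
have mN k' := measurable_natR (N k').
have iNk' := square_integrable (mN k) iNk.
have h : (\int[P]_w (((N (k + j)%N w)%:R - m ^+ j * (N k w)%:R) ^+ 2)%:E)%E =
    (\int[P]_w ((N k w)%:R * (m ^+ j ^+ 2 * gw_var j))%:E)%E.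
  have w0 : 0 <= m ^+ j ^+ 2 * gw_var j.
    by rewrite -VNj; apply: Rintegral_ge0 => w _; exact: sqr_ge0.
  apply: (@integral_fiberwise k setT _
    (fun z => (z%:R * (m ^+ j ^+ 2 * gw_var j))%:E)) => //.
  - exact: filtration_setT.
  - apply/measurable_EFinP/measurable_funX/measurable_funB => //.
    exact: measurable_funM.
  - by move=> w; rewrite lee_fin sqr_ge0.
  - by move=> z; rewrite lee_fin mulr_ge0.
  move=> z; rewrite setTI.
  rewrite (@eq_integral _ _ _ _ _
    (fun w => (((N (k + j)%N w)%:R - m ^+ j * z%:R) ^+ 2)%:E)); last first.
    by move=> w /[!inE] /= ->.
  have g0 i : (0 <= (((i%:R : R) - m ^+ j * z%:R) ^+ 2)%:E)%E.
    by rewrite lee_fin sqr_ge0.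
  rewrite (branching_property j g0
    (natural_filtration_preim [set z] (leqnn k)) (fun w => id)).
  congr (_ * _)%E; rewrite (nat_avg_sq iNj ENj VNj); congr EFin; ring.
rewrite [in LHS](_ : (fun w => _) = (fun w => ((m ^+ (k + j) ^+ 2)^-1)%:E *
   (((N (k + j)%N w)%:R - m ^+ j * (N k w)%:R) ^+ 2)%:E)%E); last first.
  apply/funext => w; rewrite -EFinM; congr EFin; rewrite exprD.
  by field; rewrite !gt_eqF.
rewrite ge0_integralZl//; last 3 first.
- apply/measurable_EFinP/measurable_funX/measurable_funB => //.
  exact: measurable_funM.
- by move=> w _; rewrite lee_fin sqr_ge0.
- by rewrite lee_fin invr_ge0 sqr_ge0.
rewrite h; under eq_integral do rewrite mulrC.
rewrite EFin_Rintegral; last exact: integrableRZ.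
rewrite RintegralZl// ENk -EFinM; congr EFin; rewrite exprD.
by field; rewrite !gt_eqF.
Qed.

(** * The limit of the normalized process *)

Lemma measurable_normalized k : measurable_fun setT (fun w => M k w).
Proof. by apply: measurable_funM => //; exact: measurable_natR. Qed.

Lemma measurable_gw_limit : measurable_fun setT W.
Proof. by apply: measurable_limn_real; exact: measurable_normalized. Qed.

Let r : R := Num.sqrt m^-1.

Let r0 : 0 < r. Proof. by rewrite sqrtr_gt0 invr_gt0. Qed.
Let r2 : r ^+ 2 = m^-1. Proof. by rewrite sqr_sqrtr// invr_ge0 ltW. Qed.
Let r1 : r < 1.
Proof. by rewrite -sqrtr1 ltr_sqrt// invf_lt1. Qed.

(** The inequality 2 |x| <= r^k + x^2 / r^k with r^2 = 1/m replaces the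
    Cauchy-Schwarz inequality and still yields a geometric rate. *)
Lemma L1_le_L2 (X : T -> R) (c : R) k : measurable_fun setT X ->
  (\int[P]_w (X w ^+ 2)%:E <= (c / m ^+ k)%:E)%E ->
  (\int[P]_w (`|X w|)%:E <= ((1 + c) / 2 * r ^+ k)%:E)%E.
Proof.
move=> mX hX; have rk : 0 < r ^+ k by rewrite exprn_gt0.
have mk : (m ^+ k)^-1 = r ^+ k * r ^+ k by rewrite -expr2 exprAC r2 exprVn.
have h0 : 0 <= 2^-1 * (r ^+ k)^-1 by rewrite mulr_ge0// invr_ge0 ltW.
apply: (@le_trans _ _
  (\int[P]_w ((r ^+ k / 2)%:E + (2^-1 * (r ^+ k)^-1)%:E * (X w ^+ 2)%:E))%E).
  apply: ge0_le_integral => //.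
  - by apply/measurable_EFinP; exact: measurableT_comp.
  - apply/measurable_EFinP; apply: measurable_funD => //.
    by apply: measurable_funM => //; exact: measurable_funX.
  move=> w _; rewrite -EFinM -EFinD lee_fin.
  have := sqr_ge0 (`|X w| - r ^+ k); rewrite -[X w ^+ 2]real_normK ?num_real// => h.
  rewrite -(ler_pM2r rk) -subr_ge0.
  rewrite (_ : _ - _ = (`|X w| - r ^+ k) ^+ 2 / 2) ?divr_ge0//.
  by field; rewrite gt_eqF.
rewrite ge0_integralD//; last 3 first.
- by move=> w _; rewrite lee_fin divr_ge0// ltW.
- by move=> w _; rewrite -EFinM lee_fin mulr_ge0// sqr_ge0.
- apply/measurable_EFinP; apply: measurable_funM => //; exact: measurable_funX.
rewrite integral_cst// [X in (_ * X + _)%E]probability_setT mule1.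
rewrite ge0_integralZl//; last 2 first.
- by apply/measurable_EFinP; exact: measurable_funX.
- by move=> w _; rewrite lee_fin sqr_ge0.
apply: (@le_trans _ _ ((r ^+ k / 2)%:E + (2^-1 * (r ^+ k)^-1)%:E * (c / m ^+ k)%:E)%E).
  by rewrite leeD2l// lee_wpmul2l.
rewrite -EFinM -EFinD lee_fin le_eqVlt; apply/orP; left; apply/eqP.
by rewrite mk; field; rewrite gt_eqF.
Qed.

Let vmax : R := v / (m * (m - 1)).

Let vmax0 : 0 <= vmax.
Proof. by rewrite divr_ge0 ?(ltW v0)// mulr_ge0 ?(ltW m0)// subr_ge0 ltW. Qed.

Lemma gw_ae_cvg : {ae P, forall w, M n w @[n --> \oo] --> W w}.
Proof.
pose c := gw_var 1.
have c0 : 0 <= c by exact: gw_var_ge0.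
have : {ae P, forall w, cvgn (fun n => M n w)}.
  apply: (@ae_cvg_summable_increments _ _ _ P (fun n w => M n w)
    (fun k => (1 + c) / 2 * r ^+ k) ((1 + c) / 2 / (1 - r))).
  - exact: measurable_normalized.
  - move=> k; apply: L1_le_L2.
      by apply: measurable_funB; exact: measurable_normalized.
    by have := gw_increment_sq k 1; rewrite addn1 => ->.
  - move=> n; have r1' : 0 < 1 - r by rewrite subr_gt0.
    rewrite -mulr_sumr ler_wpM2l//; first by rewrite divr_ge0// addr_ge0.
    rewrite -[leRHS]mul1r ler_pdivlMr// mulrC.
    rewrite -[leLHS]opprK -mulNr opprB -subrX1 opprB.
    by rewrite gerBl exprn_ge0// ltW.
by apply: filterS => w; apply: cvgP.
Qed.

(** Fatou's lemma applied to the squared increments from time k on. *)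
Lemma gw_limit_L2 k :
  (\int[P]_w ((W w - M k w) ^+ 2)%:E <= (vmax / m ^+ k)%:E)%E.
Proof.
have mD j : measurable_fun setT (fun w => ((M (k + j) w - M k w) ^+ 2)%:E).
  apply/measurable_EFinP/measurable_funX/measurable_funB; exact: measurable_normalized.
have fat := @fatou _ _ _ P setT measurableT
  (fun j w => ((M (k + j) w - M k w) ^+ 2)%:E) mD
  (fun j w _ => sqr_ge0 _).
apply: (@le_trans _ _ (\int[P]_w limn_einf (fun j => ((M (k + j) w - M k w) ^+ 2)%:E))%E).
  apply: ae_ge0_le_integral => //.
  - by move=> w _; rewrite lee_fin sqr_ge0.
  - apply/measurable_EFinP/measurable_funX/measurable_funB.
      exact: measurable_gw_limit.
    exact: measurable_normalized.
  - move=> w _; rewrite limn_einf_lim; apply: lime_ge; first exact: is_cvg_einfs.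
    apply: nearW => j; apply: le_ereal_inf_tmp => _ [i _ <-].
    by rewrite lee_fin sqr_ge0.
  - apply: measurableT_comp => //; apply: measurable_fun_limn_esup => j.
    exact: measurableT_comp.
  apply: filterS gw_ae_cvg => w Ww _.
  have h : ((M (k + j) w - M k w) ^+ 2)%:E @[j --> \oo] --> ((W w - M k w) ^+ 2)%:E.
    apply: cvg_EFin; first exact: nearW.
    have h : M (k + j) w - M k w @[j --> \oo] --> W w - M k w.
      apply: cvgB; last exact: cvg_cst.
      by have := Ww; rewrite -(cvg_shiftn k); under eq_fun do rewrite addnC.
    exact: (cvgM h h).
  by rewrite (cvg_limn_einf_sup h).1.
apply: (le_trans fat).
rewrite (_ : (fun j => _) = (fun j => (gw_var j / m ^+ k)%:E)); last first.
  by apply/funext => j; exact: (gw_increment_sq k j).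
apply: (le_trans (limn_einf_sup _)).
apply: ge_ereal_inf.
exists (ereal_sup ((fun j => (gw_var j / m ^+ k)%:E) @` setT)).
  by exists setT => //; exact: filterT.
by apply: ge_ereal_sup => _ [j _ <-]; rewrite lee_fin ler_pM2r ?invr_gt0// gw_var_ub.
Qed.

Lemma integrable_gw_limit_sub k :
  P.-integrable setT (EFin \o (fun w => (W w - M k w) ^+ 2)) /\
  \int[P]_w (W w - M k w) ^+ 2 <= vmax / m ^+ k.
Proof.
have mD : measurable_fun setT (fun w => (W w - M k w) ^+ 2).
  apply: measurable_funX; apply: measurable_funB; first exact: measurable_gw_limit.
  exact: measurable_normalized.
have iD : P.-integrable setT (EFin \o (fun w => (W w - M k w) ^+ 2)).
  apply/integrableP; split; first exact/measurable_EFinP.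
  under eq_integral do rewrite /= ger0_norm ?sqr_ge0//.
  by rewrite (le_lt_trans (gw_limit_L2 k))// ltry.
by split=> //; rewrite -lee_fin -EFin_Rintegral// gw_limit_L2.
Qed.

Lemma normalized0 w : M 0%N w = 1.
Proof. by rewrite N0 expr0 divr1. Qed.

Let mW1 : measurable_fun setT (fun w => W w - 1).
Proof. by apply: measurable_funB => //; exact: measurable_gw_limit. Qed.

Lemma gw_limit_centered_sq : P.-integrable setT (EFin \o (fun w => (W w - 1) ^+ 2)).
Proof.
have [+ _] := integrable_gw_limit_sub 0.
by under eq_fun do rewrite normalized0.
Qed.

Lemma gw_limit_centered_integrable : P.-integrable setT (EFin \o (fun w => W w - 1)).
Proof. exact: square_integrable gw_limit_centered_sq. Qed.

Let Mmean k : P.-integrable setT (EFin \o (fun w => M k w - 1)) /\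
  \int[P]_w (M k w - 1) = 0.
Proof.
have [iNk ENk _] := gw_moments k.
have iNk' := square_integrable (measurable_natR (N k)) iNk.
have i1 := integrableRZ (m ^+ k)^-1 iNk'.
have ic := integrable_prob_cst P 1.
have E : (fun w => M k w - 1) = (fun w => (m ^+ k)^-1 * (N k w)%:R - cst 1 w).
  by apply/funext => w /=; rewrite mulrC.
rewrite E; split; first exact: integrableRB.
by rewrite RintegralB// RintegralZl// ENk Rintegral_prob_cst mulVf ?subrr// gt_eqF.
Qed.

(** The mean of N_k / m^k - 1 is 0 for every k, and N_k / m^k converges in L^1. *)
Lemma gw_limit_mean : \int[P]_w (W w - 1) = 0.
Proof.
have bound k : `|\int[P]_w (W w - 1)| <= (1 + vmax) / 2 * r ^+ k.
  have [iM EM] := Mmean k; have iW := gw_limit_centered_integrable.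
  rewrite -[X in `|X|]subr0 -EM -RintegralB//.
  rewrite (le_trans (le_normr_Rintegral _ _))//; first exact: integrableRB.
  have iX := integrableRB iW iM.
  rewrite -lee_fin -EFin_Rintegral; last exact: integrable_norm.
  under eq_integral do rewrite opprB addrA subrK.
  apply: L1_le_L2; last exact: gw_limit_L2.
  apply: measurable_funB; first exact: measurable_gw_limit.
  exact: measurable_normalized.
have lim0 : (1 + vmax) / 2 * r ^+ k @[k --> \oo] --> 0.
  rewrite -[X in _ --> X](mulr0 ((1 + vmax) / 2)); apply: cvgM; first exact: cvg_cst.
  by apply: cvg_expr; rewrite ger0_norm// ltW.
apply/eqP; rewrite -normr_le0 -(cvg_lim _ lim0)//.
apply: limr_ge; first by apply/cvg_ex; exists 0.
exact: nearW.
Qed.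

(** For k >= 1 the variance of N_k / m^k is at least v / m^2, and at most twice
    that of the limit plus a term that vanishes as k grows. *)
Lemma gw_limit_var_gt0 : 0 < \int[P]_w (W w - 1) ^+ 2.
Proof.
have vm : 0 < v / m ^+ 2 by rewrite divr_gt0// exprn_gt0.
have bound k : v / m ^+ 2 <= 2 * \int[P]_w (W w - 1) ^+ 2 + 2 * (vmax / m ^+ k.+1).
  have [iX hX] := integrable_gw_limit_sub k.+1.
  have iW := gw_limit_centered_sq.
  have := gw_increment_sq 0 k.+1.
  rewrite expr0 divr1 add0n; under eq_integral do rewrite normalized0.
  have mX : measurable_fun setT (fun w => (M k.+1 w - 1) ^+ 2).
    apply: measurable_funX; apply: measurable_funB => //; exact: measurable_normalized.
  move=> /(ge0_integrableR mX (fun w => sqr_ge0 _))[iM EM].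
  apply: (le_trans (gw_var_lb k)); rewrite -EM.
  apply: (@le_trans _ _ (2 * \int[P]_w (W w - 1) ^+ 2 +
     2 * \int[P]_w (W w - M k.+1 w) ^+ 2)); last by rewrite lerD2l ler_pM2l.
  rewrite -!RintegralZl// -RintegralD//; try exact: integrableRZ.
  apply: le_Rintegral => //; first by apply: integrableRD; exact: integrableRZ.
  move=> w _; set a := W w; set b := M k.+1 w.
  rewrite -subr_ge0 (_ : _ - _ = ((a - 1) + (a - b)) ^+ 2) ?sqr_ge0//; ring.
have lim0 : 2 * \int[P]_w (W w - 1) ^+ 2 + 2 * (vmax / m ^+ k.+1) @[k --> \oo] -->
    2 * \int[P]_w (W w - 1) ^+ 2 + 2 * (vmax * 0).
  apply: cvgD; first exact: cvg_cst.
  do 2 (apply: cvgM; first exact: cvg_cst).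
  rewrite (cvg_shiftS (fun k => (m ^+ k)^-1)); under eq_fun do rewrite -exprVn.
  by apply: cvg_expr; rewrite ger0_norm ?invr_ge0 ?invf_lt1// ltW.
have : v / m ^+ 2 <= 2 * \int[P]_w (W w - 1) ^+ 2 + 2 * (vmax * 0).
  rewrite -(cvg_lim _ lim0)//; apply: limr_ge; last exact: nearW.
  by apply/cvg_ex; eexists; exact: lim0.
by rewrite !mulr0 addr0; lra.
Qed.

Lemma gw_limit_integrable : P.-integrable setT (EFin \o W).
Proof.
have := integrableRD gw_limit_centered_integrable (integrable_prob_cst P 1).
by under eq_fun do rewrite /= subrK.
Qed.

Lemma gw_limit_expectation : \int[P]_w W w = 1.
Proof.
have := gw_limit_mean.
rewrite (@RintegralB _ _ _ _ _ W (cst 1))//; last 2 first.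
- exact: gw_limit_integrable.
- exact: integrable_prob_cst.
by rewrite Rintegral_prob_cst => /eqP; rewrite subr_eq0 => /eqP.
Qed.

Let mW : measurable_fun setT W := measurable_gw_limit.
Let cvgW := gw_ae_cvg.

(** The branching property for functions of N_(k+j) / m^(k+j), as j tends to
    infinity: dominated convergence on the left, [cvg_iter_avg] on the right. *)
Lemma branching_limit k z B (f : R -> R) (c x : R) :
  continuous f -> (forall y, 0 <= f y <= 1) ->
  F k B -> B `<=` [set w | N k w = z] ->
  \int[P]_(w in B) f (x + c * W w) =
  fine (P B) * iter z (avg P (fun w => c / m ^+ k * W w)) f x.
Proof.
move=> cf f01 FB Bz; have mB := mF FB.
have f1 y : `|f y| <= 1 by have /andP[h0 h1] := f01 y; rewrite ger0_norm.
have bf : bounded_cts f by split=> //; exists 1.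
have fin_j j : \int[P]_(w in B) f (x + c * M (k + j) w) =
    fine (P B) * iter z (avg P (fun w => c / m ^+ k * M j w)) f x.
  have g0 i : (0 <= (f (x + c / m ^+ (k + j) * i%:R))%:E)%E.
    by rewrite lee_fin; have /andP[] := f01 (x + c / m ^+ (k + j) * i%:R).
  have := branching_property j g0 FB Bz.
  rewrite iter_nat_avg_avg// mulr0 addr0 => E.
  have -> : (fun w => c / m ^+ k * M j w) = (fun w => c / m ^+ (k + j) * (N j w)%:R).
    by apply/funext => w; rewrite exprD; field; rewrite !gt_eqF.
  rewrite /Rintegral.
  rewrite (_ : fine (P B) * _ = fine (P B *
    (iter z (avg P (fun w => c / m ^+ (k + j) * (N j w)%:R)) f x)%:E)%E); last first.
    by rewrite fineM// fin_num_measure.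
  rewrite -E; congr fine; apply: eq_integral => w _; congr (f (x + _))%:E.
  by field; rewrite gt_eqF.
have cL : \int[P]_(w in B) f (x + c * M (k + j) w) @[j --> \oo] -->
    \int[P]_(w in B) f (x + c * W w).
  apply: (@cvg_Rintegral_bounded _ _ _ P _ _ B 1) => //.
  - move=> j; apply: (measurable_shift x (Y := fun w => c * M (k + j) w)) => //.
    by apply: measurable_funM => //; exact: measurable_normalized.
  - apply: (measurable_shift x (Y := fun w => c * W w)) => //.
    exact: measurable_funM.
  apply: filterS cvgW => w Ww; apply: continuous_cvg; first exact: cf.
  apply: cvgD; first exact: cvg_cst.
  apply: cvgM; first exact: cvg_cst.
  by have := Ww; rewrite -(cvg_shiftn k); under eq_fun do rewrite addnC.
have cR : fine (P B) * iter z (avg P (fun w => c / m ^+ k * M j w)) f x @[j --> \oo] -->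
    fine (P B) * iter z (avg P (fun w => c / m ^+ k * W w)) f x.
  apply: cvgM; first exact: cvg_cst.
  apply: (@cvg_iter_avg _ _ _ P (fun j w => c / m ^+ k * M j w) _ f z (fun=> x)) => //.
  - by move=> j; apply: measurable_funM => //; exact: measurable_normalized.
  - exact: measurable_funM.
  - by apply: filterS cvgW => w Ww; apply: cvgM => //; exact: cvg_cst.
  - exact: cvg_cst.
by move: cL; under eq_cvg do rewrite fin_j; move=> cL; exact: (cvg_unique _ cL cR).
Qed.

Lemma gw_limit_ge0 : {ae P, forall w, 0 <= W w}.
Proof.
apply: filterS cvgW => w Ww; rewrite -(cvg_lim _ Ww)//.
apply: limr_ge; first by apply/cvg_ex; eexists; exact: Ww.
by apply: nearW => n; rewrite divr_ge0// ltW.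
Qed.

(** * Positivity of the limit *)

Section positivity.
Hypothesis N1pos : {ae P, forall w, (0 < N 1%N w)%N}.

Let expneg (l x : R) : R := expR (- (l * Num.max x 0)).

Let expneg_cts l : continuous (expneg l).
Proof.
move=> x; apply: continuous_comp; last exact: continuous_expR.
apply: cvgN; apply: cvgM; first exact: cvg_cst.
by apply: continuous_max; [exact: cvg_id|exact: cvg_cst].
Qed.

Let expneg01 l x : 0 <= l -> 0 <= expneg l x <= 1.
Proof.
move=> l0; rewrite expR_ge0/= -expR0 ler_expR oppr_le0 mulr_ge0//.
by rewrite le_max lexx orbT.
Qed.

Let expnegD l x y : 0 <= x -> 0 <= y -> expneg l (x + y) = expneg l x * expneg l y.
Proof.
by move=> x0 y0; rewrite /expneg !max_l ?addr_ge0// -expRD mulrDr opprD.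
Qed.

Let laplace (l : R) : R := \int[P]_w expneg l (W w).

Let measurable_expneg l : measurable_fun setT (fun w => expneg l (W w)).
Proof.
apply: (@measurableT_comp _ _ _ _ _ _ (expneg l)) => //.
exact: continuous_measurable_fun.
Qed.

Let iter_avg_expneg l z x : 0 <= l -> 0 <= x ->
  iter z (avg P (fun w => 1 / m ^+ 1 * W w)) (expneg l) x =
  expneg l x * laplace (l / m) ^+ z.
Proof.
move=> l0; elim: z x => [|z IH] x x0; first by rewrite expr0 mulr1.
rewrite iterS /avg.
have lm0 : 0 <= l / m by rewrite divr_ge0// ltW.
have mY : measurable_fun setT (fun w => 1 / m ^+ 1 * W w) by exact: measurable_funM.
have bc : bounded_cts (expneg l).
  split=> //; exists 1 => y; have /andP[h0 h1] := expneg01 y l0.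
  by rewrite ger0_norm.
have iLap : P.-integrable setT (EFin \o (fun w => expneg (l / m) (W w))).
  apply: (@integrable_bounded _ _ _ _ _ 1) => // w.
  by have /andP[h0 h1] := expneg01 (W w) lm0; rewrite ger0_norm.
transitivity (\int[P]_w (expneg l x * laplace (l / m) ^+ z * expneg (l / m) (W w))).
  rewrite /Rintegral; congr fine; apply: ae_eq_integral => //.
  - apply/measurable_EFinP.
    apply: (measurable_shift x mY).
    by have [] := bounded_cts_iter_avg P z mY bc.
  - by apply/measurable_EFinP; exact: measurable_funM.
  apply: filterS gw_limit_ge0 => w W0 _; congr EFin.
  have W0' : 0 <= 1 / m ^+ 1 * W w by rewrite mulr_ge0// divr_ge0// ltW.
  rewrite IH ?addr_ge0// expnegD// mulrAC; congr (_ * _ * _).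
  rewrite /expneg !max_l// expr1; congr (expR (- _)).
  by field; rewrite gt_eqF.
by rewrite RintegralZl// exprSr mulrA.
Qed.

Let laplace01 l : 0 <= l -> 0 <= laplace l <= 1.
Proof.
move=> l0; apply/andP; split.
  by apply: Rintegral_ge0 => w _; have /andP[] := expneg01 (W w) l0.
rewrite -[leRHS](Rintegral_prob_cst P); apply: le_Rintegral => //.
- apply: (@integrable_bounded _ _ _ _ _ 1) => // w.
  by have /andP[h0 h1] := expneg01 (W w) l0; rewrite ger0_norm.
- exact: integrable_prob_cst.
- by move=> w _; have /andP[] := expneg01 (W w) l0.
Qed.

Let laplace_rec l : 0 <= l -> laplace l = \int[P]_w (laplace (l / m) ^+ N 1%N w).
Proof.
move=> l0; rewrite /Rintegral; congr fine.
have lm0 : 0 <= l / m by rewrite divr_ge0// ltW.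
have /andP[L0 L1] := laplace01 lm0.
have FT : F 1%N setT by exact: filtration_setT.
apply: (@integral_fiberwise 1%N setT _
  (fun z => (laplace (l / m) ^+ z)%:E)) => //.
- exact/measurable_EFinP.
- by move=> w; rewrite lee_fin; have /andP[] := expneg01 (W w) l0.
- by move=> i; rewrite lee_fin exprn_ge0.
move=> z; rewrite setTI.
have FB : F 1%N ((N 1%N : T -> nat) @^-1` [set z]) by exact: natural_filtration_preim.
have := @branching_limit 1%N z _ (expneg l) 1 0 (@expneg_cts l)
  (fun y => expneg01 y l0) FB (fun w => id).
rewrite iter_avg_expneg//.
have -> : expneg l 0 = 1 by rewrite /expneg max_l// mulr0 oppr0 expR0.
rewrite mul1r => E.
have mB := mF FB.
have iB : P.-integrable ((N 1%N : T -> nat) @^-1` [set z]) (EFin \o (fun w => expneg l (W w))).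
  apply: (integrableS measurableT) => //.
  apply: (@integrable_bounded _ _ _ _ _ 1) => // w.
  by have /andP[h0 h1] := expneg01 (W w) l0; rewrite ger0_norm.
rewrite -[LHS]fineK; last exact: integrable_fin_num.
rewrite -[X in (X * _)%E]fineK ?fin_num_measure// -EFinM -E; congr EFin.
by apply: eq_Rintegral => w _; rewrite add0r mul1r.
Qed.

Let ind01 (w : T) : 0 <= (\1_[set w | W w <= 0] w : R) <= 1.
Proof. by rewrite indicE; case: (_ \in _); rewrite ?lexx ?ler01. Qed.

Let ind_norm (w : T) : `|\1_[set w | W w <= 0] w : R| <= 1.
Proof. by have /andP[h0 h1] := ind01 w; rewrite ger0_norm. Qed.

Let q : R := \int[P]_w \1_[set w | W w <= 0] w.

Let mNeg : measurable [set w | W w <= 0].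
Proof.
have -> : [set w | W w <= 0] = W @^-1` `]-oo, 0].
  by apply/seteqP; split => w /=; rewrite in_itv.
by rewrite -[X in measurable X]setTI; exact: mW.
Qed.

Let cvg_laplace : laplace (m ^+ k) @[k --> \oo] --> q.
Proof.
apply: (@cvg_Rintegral_bounded _ _ _ P (fun k w => expneg (m ^+ k) (W w))
  (fun w => \1_[set w | W w <= 0] w) setT 1) => //.
- exact: measurable_indic.
- by move=> k w; have /andP[h0 h1] := expneg01 (W w) (ltW (mk0 k)); rewrite ger0_norm.
apply: aeW => w; rewrite indicE; have [/set_mem/= W0|] := boolP (w \in [set w | W w <= 0]).
  under eq_fun do rewrite /expneg max_r// mulr0 oppr0 expR0.
  exact: cvg_cst.
move=> /negP nW; have W0 : 0 < W w.
  by rewrite ltNge; apply/negP => W0; apply: nW; exact: mem_set.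
have mi : `|m^-1| < 1 by rewrite ger0_norm ?invr_ge0 ?invf_lt1// ltW.
have c0 : (W w)^-1 * m^-1 ^+ k @[k --> \oo] --> (0 : R).
  rewrite -[X in _ --> X](mulr0 (W w)^-1); apply: cvgM; first exact: cvg_cst.
  exact: cvg_expr.
apply: (@squeeze_cvgr _ _ _ _ (cst 0) (fun k => (W w)^-1 * m^-1 ^+ k)) => //;
  last exact: cvg_cst.
apply: nearW => k; rewrite expR_ge0/= /expneg max_l ?(ltW W0)// expRN exprVn -invfM.
rewrite lef_pV2 ?posrE ?expR_gt0 ?mulr_gt0// mulrC.
by apply: le_trans (expR_ge1Dx _); rewrite lerDr.
Qed.

Let q01 : 0 <= q <= 1.
Proof.
apply/andP; split; first by apply: Rintegral_ge0 => w _; have /andP[] := ind01 w.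
rewrite -[leRHS](Rintegral_prob_cst P); apply: le_Rintegral => //.
- by apply: (@integrable_bounded _ _ _ _ _ 1); first exact: measurable_indic.
- exact: integrable_prob_cst.
Qed.

Let measurable_pow (s : R) : measurable_fun setT (fun w => s ^+ N 1%N w).
Proof. exact: (@measurableT_comp _ _ _ _ _ _ (fun n : nat => s ^+ n)). Qed.

Let q_fixpoint : q = \int[P]_w (q ^+ N 1%N w).
Proof.
have /andP[q0 q1] := q01.
have h : laplace (m ^+ k.+1) @[k --> \oo] --> \int[P]_w (q ^+ N 1%N w).
  under eq_fun do rewrite (laplace_rec (ltW (mk0 _))) exprS mulrAC divff ?gt_eqF// mul1r.
  apply: (@cvg_Rintegral_bounded _ _ _ P
    (fun k w => laplace (m ^+ k) ^+ N 1%N w) _ setT 1) => //.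
    move=> k w; have /andP[L0 L1] := laplace01 (ltW (mk0 k)).
    by rewrite ger0_norm ?exprn_ge0// exprn_ile1.
  apply: aeW => w; apply: (@continuous_cvg _ _ _ _ _ _ (fun x : R => x ^+ N 1%N w)).
    exact: exprn_continuous.
  exact: cvg_laplace.
have h' : laplace (m ^+ k.+1) @[k --> \oo] --> q.
  by rewrite (cvg_shiftS (fun k => laplace (m ^+ k))); exact: cvg_laplace.
by rewrite -(cvg_lim _ h)// -(cvg_lim _ h').
Qed.

Let Rintegral0_ae (f : T -> R) : P.-integrable setT (EFin \o f) ->
  {ae P, forall w, 0 <= f w} -> \int[P]_w f w = 0 -> {ae P, forall w, f w = 0}.
Proof.
move=> jf f0 If.
have : (\int[P]_w `|(f w)%:E|)%E = 0%E.
  have <- : (\int[P]_w (f w)%:E)%E = 0%E by rewrite EFin_Rintegral// If.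
  apply: ae_eq_integral => //.
  - by apply: measurableT_comp => //; case/integrableP : jf.
  - by case/integrableP : jf.
  by apply: filterS f0 => w w0 _; rewrite gee0_abs.
move/(ae_eq_integral_abs P measurableT (measurable_int P jf)).
by apply: filterS => w /(_ I) [].
Qed.

Lemma gw_limit_gt0 : {ae P, forall w, 0 < W w}.
Proof.
have /andP[q0 q1] := q01.
have iInd : P.-integrable setT (EFin \o (fun w => \1_[set w | W w <= 0] w : R)).
  apply: (@integrable_bounded _ _ _ _ _ 1); first exact: measurable_indic.
  exact: ind_norm.
have ae_false : {ae P, forall w : T, False} -> False.
  move=> [A [mA A0 sA]]; have := probability_setT P.
  rewrite (_ : setT = A); last by apply/seteqP; split => // w _; apply: sA.
  by rewrite A0 => /eqP; rewrite eq_sym onee_eq0.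
(* If q = 1 the limit is nonpositive, which contradicts its mean 1. *)
have q_lt1 : q < 1.
  rewrite lt_neqAle q1 andbT; apply/eqP => qE.
  have h0 : \int[P]_w (1 - \1_[set w | W w <= 0] w) = 0 :> R.
    rewrite (@RintegralB _ _ _ _ _ (cst 1))//; last exact: integrable_prob_cst.
    by rewrite Rintegral_prob_cst -/q qE subrr.
  have iB : P.-integrable setT (EFin \o (fun w => cst 1 w - \1_[set w | W w <= 0] w : R)).
    by apply: integrableRB => //; exact: integrable_prob_cst.
  have : {ae P, forall w, 0 <= 1 - \1_[set w | W w <= 0] w :> R}.
    by apply: aeW => w; rewrite subr_ge0; have /andP[] := ind01 w.
  move=> /(Rintegral0_ae iB) /(_ h0) Wle.
  have : \int[P]_w W w <= 0.
    have i0 := integrable_prob_cst P 0.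
    rewrite -[leRHS](Rintegral_prob_cst P) /Rintegral.
    have iW := gw_limit_integrable.
    rewrite (@ae_eq_integral _ _ _ P setT (fun w => (- `|W w|)%:E)
      (fun w => (W w)%:E)) //; last 3 first.
    - exact/measurable_EFinP.
    - apply/measurable_EFinP; apply: measurableT_comp => //; exact: measurableT_comp.
    - apply: filterS Wle => w + _; rewrite indicE.
      have [/set_mem/= W0 _|_] := boolP (w \in _); first by rewrite ler0_norm// opprK.
      by rewrite subr0 => /eqP; rewrite oner_eq0.
    rewrite -/(Rintegral P setT (fun w => - `|W w|)) -/(Rintegral P setT (fun=> 0)).
    apply: le_Rintegral => //.
    - have := integrableRZ (-1) (integrable_norm iW).
      by under eq_fun do rewrite mulN1r.
  by rewrite (gw_limit_expectation) ler10.
have iP : P.-integrable setT (EFin \o (fun w => q ^+ N 1%N w)).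
  apply: (@integrable_bounded _ _ _ _ _ 1) => // w.
  by rewrite ger0_norm ?exprn_ge0// exprn_ile1.
(* If 0 < q < 1, then q^(N_1) <= q with equality only for N_1 = 1, and the
   fixed-point equation forces N_1 = 1 almost surely, hence m = 1. *)
have qz : q = 0.
  apply/eqP; apply/negPn/negP => qn0.
  have qgt0 : 0 < q by rewrite lt_neqAle eq_sym qn0.
  have h0 : \int[P]_w (q - q ^+ N 1%N w) = 0.
    rewrite (@RintegralB _ _ _ _ _ (cst q))//; last exact: integrable_prob_cst.
    by rewrite Rintegral_prob_cst -q_fixpoint subrr.
  have iB : P.-integrable setT (EFin \o (fun w => cst q w - q ^+ N 1%N w)).
    by apply: integrableRB => //; exact: integrable_prob_cst.
  have : {ae P, forall w, 0 <= q - q ^+ N 1%N w}.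
    apply: filterS N1pos => w; case: (N 1%N w) => // n _.
    by rewrite subr_ge0 exprS ler_piMr// exprn_ile1.
  move=> /(Rintegral0_ae iB) /(_ h0) Nq.
  have N1E : {ae P, forall w, N 1%N w = 1%N}.
    apply: filterS2 N1pos Nq => w; case: (N 1%N w) => // -[//|n] _.
    move=> /eqP; rewrite subr_eq0 => /eqP E.
    have : q ^+ n.+2 < q.
      rewrite exprS -[ltRHS]mulr1 ltr_pM2l// exprn_ilt1//.
    by rewrite -E /= ltxx.
  have : m = 1; last by move=> E; move: m1; rewrite E ltxx.
  rewrite -EN1; apply: etrans (Rintegral_prob_cst P 1); rewrite /Rintegral; congr fine.
  apply: ae_eq_integral => //; first by apply/measurable_EFinP; exact: measurable_natR.
  by apply: filterS N1E => w -> _.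
have q_int : \int[P]_w \1_[set w | W w <= 0] w = 0 by [].
have : {ae P, forall w, 0 <= \1_[set w | W w <= 0] w :> R}.
  by apply: aeW => w; have /andP[] := ind01 w.
move=> /(Rintegral0_ae iInd) /(_ q_int).
apply: filterS => w; rewrite indicE; have [|nW _] := boolP (w \in _).
  by move=> _ /eqP; rewrite oner_eq0.
by rewrite ltNge; apply: contra nW => W0; exact: mem_set.
Qed.

End positivity.

(** * Conditional law of the fluctuations *)

Let sqk k : 0 < Num.sqrt (m ^+ k). Proof. by rewrite sqrtr_gt0. Qed.

(** Expectation of f at m^(-k/2) times a sum of z independent copies of the limit
    minus 1: the conditional expectation of f at the fluctuation at time k, given
    z individuals in generation k. *)
Definition clt_functional k z (f : R -> R) : R :=
  iter z (avg P (fun w => (Num.sqrt (m ^+ k))^-1 * (W w - 1))) f 0.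

Definition fluctuation k w : R := Num.sqrt (m ^+ k) * (W w - (N k w)%:R / m ^+ k).

Lemma measurable_fluctuation k : measurable_fun setT (fluctuation k).
Proof.
apply: measurable_funM => //; apply: measurable_funB => //.
exact: measurable_normalized.
Qed.

Lemma clt_functionalE k z A (f : R -> R) :
  continuous f -> (forall y, 0 <= f y <= 1) ->
  F k A -> A `<=` [set w | N k w = z] ->
  \int[P]_(w in A) f (fluctuation k w) = fine (P A) * clt_functional k z f.
Proof.
move=> cf f01 FA Az; set s := Num.sqrt (m ^+ k).
have s0 : 0 < s := sqk k.
have ss : m ^+ k = s * s by rewrite -expr2 sqr_sqrtr// ltW.
have := branching_limit s (- (s^-1 *+ z)) cf f01 FA Az.
have -> : (fun w => s / m ^+ k * W w) = (fun w => s^-1 * W w).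
  by apply/funext => w; rewrite ss; field; rewrite gt_eqF.
rewrite /clt_functional -/s.
have -> : (fun w => s^-1 * (W w - 1)) = (fun w => s^-1 * W w - s^-1).
  by apply/funext => w; rewrite mulrBr mulr1.
rewrite iter_avg_sub sub0r => <-; apply: eq_Rintegral => w /[!inE] /Az /= Nz.
rewrite /fluctuation -/s Nz ss; congr f; rewrite -[s^-1 *+ z]mulr_natr.
by field; rewrite gt_eqF.
Qed.

Lemma clt_functional_onem k z (f : R -> R) : bounded_cts f ->
  clt_functional k z (fun x => 1 - f x) = 1 - clt_functional k z f.
Proof.
move=> bf; rewrite /clt_functional.
have mY : measurable_fun setT (fun w => (Num.sqrt (m ^+ k))^-1 * (W w - 1)).
  exact: measurable_funM.
elim: z (0 : R) => // z IH x; rewrite !iterS /avg.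
under eq_Rintegral do rewrite IH.
rewrite (@RintegralB _ _ _ _ _ (cst 1))//.
- by rewrite Rintegral_prob_cst.
- exact: integrable_prob_cst.
- exact: (integrable_shift P _ mY (bounded_cts_iter_avg P z mY bf)).
Qed.

Lemma clt_functional_cvg (k_ z_ : nat -> nat) (c a b : R) : a < b -> 0 < c ->
  k_ n @[n --> \oo] --> \oo ->
  (z_ n)%:R / m ^+ k_ n @[n --> \oo] --> c ->
  clt_functional (k_ n) (z_ n) (ramp a b) @[n --> \oo] -->
  gavg (Num.sqrt (\int[P]_w (W w - 1) ^+ 2 * c)) (ramp a b) 0.
Proof.
move=> ab c0 kcvg zcvg.
have [K [M [h1 [h2 [K0 S]]]]] := smooth2_ramp ab.
have iD := gw_limit_centered_integrable.
have D0 := gw_limit_mean.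
have iD2 := gw_limit_centered_sq.
have V0 := gw_limit_var_gt0.
apply: (clt_smooth mW1 iD D0 iD2 erefl K0 S V0 c0).
- by move=> n; rewrite invr_ge0 ltW.
- have e j : (Num.sqrt (m ^+ j))^-1 = Num.sqrt m^-1 ^+ j.
    elim: j => [|j IH]; first by rewrite !expr0 sqrtr1 invr1.
    by rewrite [in LHS]exprS sqrtrM ?(ltW m0)// invfM IH -sqrtrV ?(ltW m0)// -exprS.
  under eq_fun do rewrite e.
  apply: (cvg_comp _ _ kcvg); apply: cvg_expr.
  by rewrite ger0_norm// -sqrtr1 ltr_sqrt// invf_lt1.
- under eq_fun do rewrite exprVn sqr_sqrtr ?(ltW (mk0 _))//.
  exact: zcvg.
Qed.

Section stopped.
Variable tau : T -> nat.
Hypothesis htau : stopping_time F tau.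
Local Notation G := (stopped_sigma_algebra F tau).
Variable Q : R.-pker (g_sigma_algebraType G) ~> (measurableTypeR R).
Hypothesis hQ : regular_cond_law P (fun w => Num.sqrt (m ^+ tau w) *
                 (W w - (N (tau w) w)%:R / m ^+ tau w)) Q.

Let sF k : sigma_algebra setT (F k). Proof. exact: natural_filtration_sigma. Qed.
Let F_nd k l : (k <= l)%N -> F k `<=` F l. Proof. exact: natural_filtration_sub. Qed.
Let F_meas k : F k `<=` measurable.
Proof. by move=> A; exact: (natural_filtration_measurable). Qed.

(** The exceptional set A is an event of the stopped sigma-algebra contained in
    tau = k, hence an event of F_k, on which the integral of the kernel is
    P(A and fluctuation in B), at most the integral of f at the fluctuation,
    that is [clt_functional] times P(A). So A is a null set. *)
Lemma kernel_fiber_bound (B : set (measurableTypeR R)) (f : R -> R) k z :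
  measurable B -> continuous f -> (forall y, 0 <= f y <= 1) ->
  (forall y, B y -> f y = 1) ->
  {ae P, forall w : T, tau w = k -> N k w = z -> fine (Q w B) <= clt_functional k z f}.
Proof.
move=> mB cf f01 fB; set t := clt_functional k z f.
have Q1 w : (Q w B <= 1)%E.
  by rewrite -(@prob_kernel _ _ _ _ _ Q w) le_measure ?inE.
have Qfin w : Q w B \is a fin_num.
  by rewrite ge0_fin_numE// (le_lt_trans (Q1 w))// ltry.
pose A := ([set w | tau w = k] `&` (N k : T -> nat) @^-1` [set z]) `&`
  [set w | (t%:E < Q w B)%E].
have GA : G A.
  apply: (sigma_algebra_setI (stopped_sigma_algebraP sF htau)).
    apply: (stopped_fiber sF F_nd F_meas htau).
    exact: natural_filtration_preim.
  apply: (kernel_preimage sF htau Q (U := [set x | (t%:E < x)%E])) => //.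
  have -> : [set x | (t%:E < x)%E] = `]t%:E, +oo[%classic.
    by apply/seteqP; split => x /=; rewrite in_itv/= andbT.
  exact: emeasurable_itv.
have FA : F k A by apply: (stopped_fiber_sub GA) => w [[]].
have mA := F_meas FA.
have PA0 : P A = 0%E.
  apply: (@null_superlevel _ _ _ P A (fun w => fine (Q w B)) t) => //.
  - apply: measurableT_comp => //.
    exact: (measurable_kernel_stopped sF htau).
  - by move=> w; rewrite fine_ge0//= -lee_fin fineK.
  - by move=> w [_ /=]; rewrite -[X in (_ < X)%E]fineK// lte_fin.
  under eq_integral do rewrite fineK//.
  rewrite hQ//.
  have mX : measurable (fluctuation k @^-1` B).
    by rewrite -[X in measurable X]setTI; exact: measurable_fluctuation.
  have -> : A `&` (fun w => Num.sqrt (m ^+ tau w) *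
      (W w - (N (tau w) w)%:R / m ^+ tau w)) @^-1` B =
    fluctuation k @^-1` B `&` A.
    rewrite setIC; apply/seteqP; split => w /= [Bw Aw]; split => //; move: Aw Bw => [[tk _] _];
      by rewrite /fluctuation tk.
  rewrite -(@clt_functionalE k z A f)//; last by move=> w [[]].
  rewrite -integral_indic//.
  have ifl : P.-integrable A (EFin \o (fun w => f (fluctuation k w))).
    apply: (integrableS measurableT) => //.
    apply: (@integrable_bounded _ _ _ _ _ 1).
      apply: (@measurableT_comp _ _ _ _ _ _ f); last exact: measurable_fluctuation.
      exact: continuous_measurable_fun.
    by move=> w; have /andP[h0 h1] := f01 (fluctuation k w); rewrite ger0_norm.
  rewrite /Rintegral fineK; last exact: integrable_fin_num.
  apply: ge0_le_integral => //.
  - by apply/measurable_EFinP; apply: measurable_funTS; exact: measurable_indic.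
  - by case/integrableP : ifl.
  move=> w _; rewrite lee_fin indicE; have /andP[h0 h1] := f01 (fluctuation k w).
  by have [/set_mem/= /fB ->|//] := boolP (w \in fluctuation k @^-1` B).
exists A; split=> // w /= nw.
have [tk|tk] := pselect (tau w = k); last by exfalso; apply: nw.
have [Nz|Nz] := pselect (N k w = z); last by exfalso; apply: nw.
split=> //=; rewrite -[X in (_ < X)%E]fineK// lte_fin ltNge.
by apply/negP => le; apply: nw.
Qed.

Lemma kernel_bound (B : set (measurableTypeR R)) (f : R -> R) :
  measurable B -> continuous f -> (forall y, 0 <= f y <= 1) ->
  (forall y, B y -> f y = 1) ->
  {ae P, forall w : T, fine (Q w B) <= clt_functional (tau w) (N (tau w) w) f}.
Proof.
move=> mB cf f01 fB.
have : {ae P, forall w : T, forall k z, tau w = k -> N k w = z ->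
    fine (Q w B) <= clt_functional k z f}.
  apply/ae_foralln => k; apply/ae_foralln => z; exact: kernel_fiber_bound.
by apply: filterS => w; apply.
Qed.

(** The bound above for the half-line after b and the ramp, and for the half-line
    before a and the complement of the ramp. *)
Lemma kernel_tail_sandwich (a b : R) : a < b ->
  {ae P, forall w : T, tail (Q w) b <=
    clt_functional (tau w) (N (tau w) w) (ramp a b) <= tail (Q w) a}.
Proof.
move=> ab; have uf := unit_fun_ramp ab; have cr := continuous_ramp ab.
have br : bounded_cts (ramp a b) by split=> //; exists 1; exact: unit_fun_norm.
have h1 : {ae P, forall w : T, fine (Q w `]b, +oo[%classic) <=
    clt_functional (tau w) (N (tau w) w) (ramp a b)}.
  apply: kernel_bound => //; first exact: uf.2.
  by move=> y /=; rewrite in_itv/= andbT => /ltW; exact: ramp_ge.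
have h2 : {ae P, forall w : T, fine (Q w `]-oo, a]%classic) <=
    clt_functional (tau w) (N (tau w) w) (fun x => 1 - ramp a b x)}.
  apply: kernel_bound => //.
  - by move=> x; apply: cvgB; [exact: cvg_cst|exact: cr].
  - move=> y; have /andP[u0 u1] := uf.2 y.
    by rewrite subr_ge0 u1 lerBlDr lerDl.
  - by move=> y /=; rewrite in_itv/= => ya; rewrite (ramp_le ab ya) subr0.
move: h1 h2; apply: filterS2 => w b1; rewrite clt_functional_onem// => b2.
rewrite b1/=; move: b2.
have : (Q w `]-oo, a]%classic + Q w `]a, +oo[%classic = 1)%E.
  rewrite -(@prob_kernel _ _ _ _ _ Q w) -measureU//.
    by rewrite -itv_bndbnd_setU ?bnd_simp// set_itvNyy.
  apply/seteqP; split => // x /= []; rewrite !in_itv/= andbT => xa ax.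
  by move: (le_lt_trans xa ax); rewrite ltxx.
rewrite -[Q w `]-oo, a]%classic]fineK ?fin_num_mass1 ?prob_kernel//.
rewrite -[Q w `]a, +oo[%classic]fineK ?fin_num_mass1 ?prob_kernel//.
by rewrite -EFinD => -[E]; rewrite /tail; lra.
Qed.

End stopped.

End galton_watson_process.

(** * Convergence of the conditional laws *)

Lemma integrable_sq_of_moment d (T : measurableType d) (R : realType)
    (P : probability T R) (Y : {RV P >-> nat}) (p : R) : 2 < p ->
  ('E_P[fun w => ((Y w)%:R `^ p)%R : R] < +oo)%E ->
  P.-integrable setT (EFin \o (fun w => ((Y w)%:R : R) ^+ 2)).
Proof.
move=> p2; rewrite unlock => hp.
have mY := measurable_natR Y.
have mYp : measurable_fun setT (fun w => ((Y w)%:R : R) `^ p).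
  exact: (@measurableT_comp _ _ _ _ _ _ (fun n : nat => (n%:R : R) `^ p)).
apply/integrableP; split; first by apply/measurable_EFinP; exact: measurable_funX.
apply: le_lt_trans hp; apply: ge0_le_integral => //.
- by apply: measurableT_comp => //; apply/measurable_EFinP; exact: measurable_funX.
- exact/measurable_EFinP.
move=> w _ /=; rewrite ger0_norm ?sqr_ge0// lee_fin.
case: (Y w) => [|n]; first by rewrite expr0n powR_ge0.
by rewrite -powR_mulrn// ler_powR ?ler1n// ltW.
Qed.

Theorem theorem5p5 (R : realType) (d : measure_display) (T : measurableType d)
    (P : probability T R) (N : nat -> {RV P >-> nat}) (m p0 : R)
    (hN : galton_watson P 1 (fun n => N n : T -> nat))
    (hmean : ('E_P[fun w => (N 1%N w)%:R : R] = m%:E)%E)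
    (hm : 1 < m)
    (hvar : (0 < 'V_P[fun w => (N 1%N w)%:R : R])%E)
    (hp0 : 2 < p0)
    (hmoment : ('E_P[fun w => ((N 1%N w)%:R `^ p0)%R : R] < +oo)%E)
    (h0 : P [set w | N 1%N w = 0%N] = 0%E) :
  let Ninf : T -> R := gw_limit m (fun n => N n : T -> nat) in
  let sigma2 : R := fine ('V_P[Ninf])%E in
  let F := natural_filtration (fun n => N n : T -> nat) in
  {ae P, forall w, (N n w)%:R / m ^+ n @[n --> \oo] --> Ninf w /\ 0 < Ninf w} /\
  forall tau : nat -> T -> nat,
    (forall n, stopping_time F (tau n)) ->
    {ae P, forall w, nondecreasing_seq (tau ^~ w) /\
                     tau n w @[n --> \oo] --> \oo} ->
  forall Q : forall n,
      R.-pker (g_sigma_algebraType (stopped_sigma_algebra F (tau n))) ~>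
              (measurableTypeR R),
    (forall n, regular_cond_law P
       (fun w => Num.sqrt (m ^+ tau n w) *
                 (Ninf w - (N (tau n w) w)%:R / m ^+ tau n w)) (Q n)) ->
    (* [normal_prob] takes the standard deviation; it is the normal law only for
       a nonzero one, which holds here for almost every [w]. *)
    {ae P, forall w, weakly_cvg (fun n => Q n w)
                       (normal_prob 0 (Num.sqrt (sigma2 * Ninf w)))}.
Proof.
have [xi [hind hid N0 NS]] := hN.
have iN1 := integrable_sq_of_moment hp0 hmoment.
have EN1 : \int[P]_w (N 1%N w)%:R = m.
  by move: hmean; rewrite unlock /Rintegral => ->.
set v := \int[P]_w ((N 1%N w)%:R - m) ^+ 2.
have [iv _] := integral_shift_sq iN1 EN1 erefl (- m).
have v0 : 0 < v.
  move: hvar; rewrite /variance unlock hmean /= unlock.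
  by rewrite EFin_Rintegral.
have posN1 : {ae P, forall w, (0 < N 1%N w)%N}.
  exists ((N 1%N : T -> nat) @^-1` [set 0%N]); split=> //.
    exact: measurable_preim_nat.
  by move=> w /= /negP; rewrite -eqn0Ngt => /eqP.
move=> Ninf sigma2 F.
have cvgN := gw_ae_cvg hind hid N0 NS hm v0 iN1 EN1 erefl.
have gt0N := gw_limit_gt0 hind hid N0 NS hm v0 iN1 EN1 erefl posN1.
have s2E : sigma2 = \int[P]_w (Ninf w - 1) ^+ 2.
  have E1 : ('E_P[Ninf] = 1)%E.
    rewrite unlock EFin_Rintegral.
      by rewrite (gw_limit_expectation hind hid N0 NS hm v0 iN1 EN1 erefl).
    exact: (gw_limit_integrable hind hid N0 NS hm v0 iN1 EN1 erefl).
  by rewrite /sigma2 /variance unlock E1 unlock.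
have s20 : 0 < sigma2.
  by rewrite s2E; exact: (gw_limit_var_gt0 hind hid N0 NS hm v0 iN1 EN1 erefl).
split; first by apply: filterS2 cvgN gt0N => w; split.
move=> tau htau tauP Q hQ.
(* Quantifying over codes of rationals turns the family of exceptional sets
   into a countable one. *)
have sandwich : {ae P, forall w : T, forall (n i j : nat) (p q : rat),
    unpickle i = Some p -> unpickle j = Some q -> p < q ->
    tail (Q n w) (ratr q) <=
    clt_functional N m (tau n w) (N (tau n w) w) (ramp (ratr p) (ratr q)) <=
    tail (Q n w) (ratr p)}.
  apply/ae_foralln => n; apply/ae_foralln => i; apply/ae_foralln => j.
  case: (@unpickle rat i) => [p|]; last by apply: aeW.
  case: (@unpickle rat j) => [q|]; last by apply: aeW.
  have [pq|pq] := boolP (p < q); last first.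
    by apply: aeW => w p' q' [<-] [<-] pq'; rewrite pq' in pq.
  have pqR : (ratr p : R) < ratr q by rewrite ltr_rat.
  have := kernel_tail_sandwich hind hid N0 NS hm v0 iN1 EN1 erefl (htau n) (hQ n) pqR.
  by apply: filterS => w h p' q' [<-] [<-] _.
have all_ae : {ae P, forall w : T, weakly_cvg (fun n => Q n w)
                       (normal_prob 0 (Num.sqrt (sigma2 * Ninf w)))}.
  apply: filterS2 (filterI cvgN gt0N) (filterI tauP sandwich).
  move=> w [Nw Ww] [[_ tw] sw].
  have sd0 : 0 < Num.sqrt (sigma2 * Ninf w) by rewrite sqrtr_gt0 mulr_gt0.
  apply: weakly_cvg_sandwich => //.
    by move=> n; exact: prob_kernel.
  move=> p q pq; exists (fun n =>
    clt_functional N m (tau n w) (N (tau n w) w) (ramp (ratr p) (ratr q))).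
    rewrite s2E; apply: (clt_functional_cvg hind hid N0 NS hm v0 iN1 EN1 erefl) => //.
      by rewrite ltr_rat.
    exact: (cvg_comp _ _ tw Nw).
  by move=> n; apply: (sw n (pickle p) (pickle q)) => //; exact: pickleK.
exact: all_ae.
Qed.
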